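(* Let $\lambda,b\in\mathbb{C}$ and let $T_{\lambda,b}:H(\mathbb{C})\to H(\mathbb{C})$ be the operator defined by $T_{\lambda,b}:f(z)\mapsto f'(\lambda z+b)$. The algebra of operators $$\{\psi(T_{\lambda,b}) : \psi(z)\in H(\mathbb{C}),\ \psi(0)=0 \text{ and } \psi(T_{\lambda,b}) \text{ is continuous}\}$$ consists entirely of hypercyclic operators if $|\lambda|\geq 1$ and consists entirely of non-hypercyclic operators if $|\lambda|<1$.
   Context: $H(\mathbb{C})$ is the set of all entire functions endowed with the topology of uniform convergence on compact sets, which makes it a separable Fréchet space. For an entire function $\psi(z)=\sum_{k=0}^\infty w_kz^k$ and an operator $T$ on $H(\mathbb{C})$, $\psi(T)$ denotes $\sum_{k=0}^\infty w_kT^k$; the condition that $\psi(T_{\lambda,b})$ is continuous means that it is a continuous linear operator on $H(\mathbb{C})$. A continuous linear operator $T$ on a Fréchet space $\mathcal{F}$ is hypercyclic if there is $f\in\mathcal{F}$ whose orbit $\{T^nf:n\in\mathbb{N}\}$ is dense in $\mathcal{F}$. The word ''algebra'' refers to the usual addition and multiplication (composition) of operators.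
   Formalization: For |λ| ≥ 1, hypercyclicity is asserted only for the nonzero operators of the algebra: ψ = 0 is allowed by the definition and gives the zero operator, which is not hypercyclic. *)

(* Defs.v *)
From Stdlib Require Import Reals List.
From Coquelicot Require Import Coquelicot.
Local Open Scope C_scope.

Definition entire (f : C -> C) : Prop :=
  forall z : C, @ex_derive C_AbsRing C_NormedModule f z.

Record HC : Type := mkHC { HC_fun :> C -> C; HC_entire : entire HC_fun }.

Lemma entire_zero : entire (fun _ => RtoC 0).
Proof. intro z. apply ex_derive_const. Qed.

Lemma entire_plus (f g : HC) : entire (fun z => f z + g z).
Proof.
  intro z.
  apply (@ex_derive_plus C_AbsRing C_NormedModule f g z); apply HC_entire.
Qed.

Lemma entire_scal (c : C) (f : HC) : entire (fun z => c * f z).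
Proof.
  intro z. destruct (HC_entire f z) as [l Hl].
  exists (c * l).
  eapply (@filterdiff_ext_lin C_AbsRing (AbsRing_NormedModule C_AbsRing)
            C_NormedModule _ _).
  - exact (@filterdiff_scal_r_fct C_AbsRing (AbsRing_NormedModule C_AbsRing)
             C_NormedModule _ _ c f _ Cmult_comm Hl).
  - intro y. change (c * (y * l) = y * (c * l)). ring.
Qed.

Definition HC_zero : HC := mkHC _ entire_zero.
Definition HC_plus (f g : HC) : HC := mkHC _ (entire_plus f g).
Definition HC_scal (c : C) (f : HC) : HC := mkHC _ (entire_scal c f).

Definition compactC (K : C -> Prop) : Prop :=
  forall U : (C -> Prop) -> Prop,
    (forall A, U A -> @open C_UniformSpace A) ->
    (forall z, K z -> exists A, U A /\ A z) ->
    exists l : list (C -> Prop),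
      (forall A, In A l -> U A) /\
      (forall z, K z -> exists A, In A l /\ A z).

Definition near_on (K : C -> Prop) (eps : posreal) (f g : C -> C) : Prop :=
  forall z, K z -> (Cmod (g z - f z) < eps)%R.

Definition ucc_cvg (u : nat -> C -> C) (g : C -> C) : Prop :=
  forall (K : C -> Prop) (eps : posreal), compactC K ->
    eventually (fun n => near_on K eps g (u n)).

(* Finite unions of compact sets are compact, so the sets [near_on K eps f]
   form a neighbourhood basis of [f], not merely a subbasis. *)
Definition HC_nbhs (f : HC) (P : HC -> Prop) : Prop :=
  exists (K : C -> Prop) (eps : posreal),
    compactC K /\ forall g : HC, near_on K eps f g -> P g.

Definition HC_dense (A : HC -> Prop) : Prop :=
  forall (f : HC) (P : HC -> Prop), HC_nbhs f P -> exists g, A g /\ P g.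

Definition HC_linear (S : HC -> HC) : Prop :=
  (forall f g, S (HC_plus f g) = HC_plus (S f) (S g)) /\
  (forall c f, S (HC_scal c f) = HC_scal c (S f)).

Definition HC_continuous (S : HC -> HC) : Prop :=
  forall f : HC, filterlim S (HC_nbhs f) (HC_nbhs (S f)).

Definition orbit (S : HC -> HC) (f g : HC) : Prop :=
  exists n : nat, g = Nat.iter n S f.

Definition hypercyclic (S : HC -> HC) : Prop :=
  exists f : HC, HC_dense (orbit S f).

Definition op_zero : HC -> HC := fun _ => HC_zero.
Definition op_plus (S1 S2 : HC -> HC) : HC -> HC :=
  fun f => HC_plus (S1 f) (S2 f).
Definition op_scal (c : C) (S : HC -> HC) : HC -> HC :=
  fun f => HC_scal c (S f).
Definition op_comp (S1 S2 : HC -> HC) : HC -> HC := fun f => S1 (S2 f).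

(* Not required to contain the identity operator. *)
Definition operator_algebra (A : (HC -> HC) -> Prop) : Prop :=
  A op_zero /\
  (forall S1 S2, A S1 -> A S2 -> A (op_plus S1 S2)) /\
  (forall c S, A S -> A (op_scal c S)) /\
  (forall S1 S2, A S1 -> A S2 -> A (op_comp S1 S2)).

(* [C_derive] is total; it is the complex derivative wherever the argument is
   complex differentiable, hence everywhere on entire functions. Working on
   [C -> C] avoids having to know that [T f] is again entire. *)
Definition T (lambda b : C) (f : C -> C) : C -> C :=
  fun z => C_derive f (lambda * z + b).

(* [S] is psi(T), where psi has Taylor coefficients [w]: for every [f] the
   series of the [w k * T^k f] converges to [S f] in the topology of H(C). *)
Definition is_series_op (lambda b : C) (w : nat -> C) (S : HC -> HC) : Prop :=
  forall f : HC,
    ucc_cvg (fun n z => sum_n (fun k => w k * Nat.iter k (T lambda b) f z) n)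
            (S f).

Definition psi_algebra (lambda b : C) (S : HC -> HC) : Prop :=
  exists (psi : HC) (w : nat -> C),
    (forall z : C, @is_pseries C_AbsRing C_NormedModule w z (psi z)) /\
    psi 0 = 0 /\
    is_series_op lambda b w S /\
    HC_linear S /\ HC_continuous S.

(* Main.v *)
Require Import Defs.
From Stdlib Require Import Reals Lra Lia List Factorial Classical ClassicalEpsilon.
From Stdlib Require Import FunctionalExtensionality ProofIrrelevance.
From Stdlib Require Cantor.
From Coquelicot Require Import Coquelicot.
Local Open Scope R_scope.

(** Write [phi z = lambda z + b]. Everything rests on the identity
    [(T^k f)(z) = lambda^(k (k - 1) / 2) f^(k)(phi^k z)] ([iterT_formula]) and on
    the fact that complex differentiable functions on the plane are analytic,
    which is developed from Goursat's theorem: Cauchy's estimate for the first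
    derivative ([cauchy_estimate]), closure under locally uniform limits
    ([weierstrass]), factorial estimates for all derivatives and Taylor expansion.

    The algebra. The composition of [psi_1(T)] and [psi_2(T)] should be
    [(psi_1 psi_2)(T)], but convergence of two operator series does not by itself
    allow their terms to be regrouped along the Cauchy product. What saves the
    argument is that convergence on every entire function is a strong condition.
    By Banach-Steinhaus the functionals [f |-> w_k (T^k f)(z0)] are equicontinuous,
    and testing them on powers of [z - c] gives a dichotomy. If [phi] has a fixed
    point [c] and [|lambda| <= 1], then
    [|w_k| |lambda|^(k (k - 1) / 2) k! <= K rho^k]. Otherwise an orbit of [phi]
    escapes to infinity and [w_k = 0] for large [k]. In both cases
    the double series of the [w1_j w2_k T^(j + k) f] converges geometrically and
    uniformly on disks ([double_series_tame]), so it may be rearranged. In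
    particular [S^n] is the operator with symbol [psi^n], for [S = psi(T)].

    Case [|lambda| >= 1]. Let [w_m], with [m >= 1], be the first nonzero
    coefficient. On polynomials [T] lowers the degree, hence [S^n p = 0] for large
    [n]. Conversely every polynomial [p] is [S^n g_n] with [g_n] tending to zero.
    To see this, solve [T^(m n) h_n = p] by integrating [m n] times from the
    origin, which gains a factorial, and divide by [w_m^n]; the error
    [S^n (h_n / w_m^n) - p] is a combination of [T p, T^2 p, ...] with
    coefficients of geometric growth, and induction on the degree removes it.
    Density of the polynomials and Baire's theorem then yield a dense orbit
    ([hypercyclicity_criterion]).

    Case [|lambda| < 1]. At the fixed point [c] of [phi] the values
    [(T^k f)(c)] carry the factor [lambda^(k (k - 1) / 2)], which beats [k!] and
    every geometric sequence. The coefficients of [psi^n] are at most [W^n] and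
    vanish below index [n], so [(S^n f)(c)] stays bounded in [n] and no orbit is
    dense. *)

(** * Complex differentiability in elementary terms *)

(** The quantified form of [is_derive] over [C]: it is insensitive to which of the
    equivalent norms and uniform structures on [C] is chosen. *)
Definition cderiv (f : C -> C) (z l : C) : Prop :=
  forall eps, 0 < eps -> exists delta, 0 < delta /\
    forall w, Cmod (w - z) < delta ->
      Cmod (f w - f z - l * (w - z)) <= eps * Cmod (w - z).

Lemma cderiv_iff_is_derive f z l : cderiv f z l <-> is_derive f z l.
Proof.
split.
- intros H; split; [apply is_linear_scal_l|].
  intros x Hx; apply (is_filter_lim_locally_unique (V:=AbsRing_NormedModule C_AbsRing)) in Hx; subst x.
  intros eps.
  destruct (H eps (cond_pos eps)) as [d [Hd H']].
  exists (mkposreal d Hd). intros w Hw.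
  replace (norm (minus w z)) with (Cmod (w - z)) by reflexivity.
  replace (norm _) with (Cmod (f w - f z - l * (w - z))%C).
  2:{ change (Cmod (f w - f z - l * (w - z)) = Cmod (f w - f z - (w - z) * l))%C.
      f_equal. ring. }
  apply H'. exact Hw.
- intros [_ H] eps He.
  destruct (H z (fun P HP => HP) (mkposreal eps He)) as [d Hd].
  exists d; split; [apply cond_pos|].
  intros w Hw. specialize (Hd w Hw).
  change (Cmod (f w - f z - (w - z) * l) <= eps * Cmod (w - z))%C in Hd.
  replace (f w - f z - l * (w - z))%C with (f w - f z - (w - z) * l)%C by ring.
  exact Hd.
Qed.

Lemma cderiv_iff_is_derive_abs f z l :
  cderiv f z l <-> @is_derive C_AbsRing (AbsRing_NormedModule C_AbsRing) f z l.
Proof.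
rewrite cderiv_iff_is_derive.
split; intros [_ H]; (split; [apply is_linear_scal_l|exact H]).
Qed.

Lemma C_derive_eq f z l : cderiv f z l -> C_derive f z = l.
Proof. intros H; apply is_C_derive_unique, cderiv_iff_is_derive, H. Qed.

Lemma cderiv_HC (f : HC) z : cderiv f z (C_derive f z).
Proof.
apply cderiv_iff_is_derive, (C_derive_correct f z z), HC_entire.
Qed.

Lemma entire_cderiv f g : (forall z, cderiv f z (g z)) -> entire f.
Proof. intros H z; exists (g z); apply cderiv_iff_is_derive, H. Qed.

Lemma cderiv_ext f g z l : (forall w, f w = g w) -> cderiv f z l -> cderiv g z l.
Proof.
intros E H eps He; destruct (H eps He) as [d [Hd H']].
exists d; split; [exact Hd|]; intros w Hw; rewrite <- !E; auto.
Qed.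

Lemma cderiv_eq f z l m : cderiv f z l -> l = m -> cderiv f z m.
Proof. now intros H <-. Qed.

Lemma cderiv_const c z : cderiv (fun _ => c) z 0.
Proof.
intros eps He; exists 1; split; [lra|]; intros w _.
replace (c - c - 0 * (w - z))%C with (RtoC 0) by ring.
rewrite Cmod_0; apply Rmult_le_pos; [lra|apply Cmod_ge_0].
Qed.

Lemma cderiv_affine a b z : cderiv (fun w => a * w + b)%C z a.
Proof.
intros eps He; exists 1; split; [lra|]; intros w _.
replace (a * w + b - (a * z + b) - a * (w - z))%C with (RtoC 0) by ring.
rewrite Cmod_0; apply Rmult_le_pos; [lra|apply Cmod_ge_0].
Qed.

Lemma cderiv_plus f g z l m :
  cderiv f z l -> cderiv g z m -> cderiv (fun w => f w + g w)%C z (l + m)%C.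
Proof.
intros Hf Hg. apply cderiv_iff_is_derive_abs.
apply cderiv_iff_is_derive_abs in Hf, Hg.
exact (is_derive_plus (K:=C_AbsRing) (V:=AbsRing_NormedModule C_AbsRing) f g z l m Hf Hg).
Qed.

Lemma cderiv_mult f g z l m :
  cderiv f z l -> cderiv g z m -> cderiv (fun w => f w * g w)%C z (l * g z + f z * m)%C.
Proof.
intros Hf Hg. apply cderiv_iff_is_derive_abs.
apply cderiv_iff_is_derive_abs in Hf, Hg.
exact (is_derive_mult (K:=C_AbsRing) f g z l m Hf Hg Cmult_comm).
Qed.

Lemma cderiv_comp f g z l m :
  cderiv f (g z) l -> cderiv g z m -> cderiv (fun w => f (g w)) z (l * m)%C.
Proof.
intros Hf Hg. apply cderiv_iff_is_derive_abs.
apply cderiv_iff_is_derive_abs in Hf, Hg.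
rewrite Cmult_comm.
exact (is_derive_comp (K:=C_AbsRing) (V:=AbsRing_NormedModule C_AbsRing) f g z l m Hf Hg).
Qed.

Lemma cderiv_scal c f z l : cderiv f z l -> cderiv (fun w => c * f w)%C z (c * l)%C.
Proof.
intros Hf. replace (c * l)%C with (0 * f z + c * l)%C by ring.
apply (cderiv_mult (fun _ => c)); [apply cderiv_const|exact Hf].
Qed.

Lemma cderiv_minus f g z l m :
  cderiv f z l -> cderiv g z m -> cderiv (fun w => f w - g w)%C z (l - m)%C.
Proof.
intros Hf Hg.
apply (cderiv_ext (fun w => f w + (- (1)) * g w)%C); [intros w; ring|].
replace (l - m)%C with (l + (- (1)) * m)%C by ring.
apply cderiv_plus; [exact Hf|apply cderiv_scal, Hg].
Qed.

Lemma cderiv_translate f h z l : cderiv f (z + h) l -> cderiv (fun w => f (w + h))%C z l.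
Proof.
intros H. replace l with (l * 1)%C by ring.
apply (cderiv_comp f (fun w => w + h)%C); [exact H|].
apply (cderiv_ext (fun w => 1 * w + h)%C); [intros; ring|apply cderiv_affine].
Qed.

Lemma cderiv_continuous f z l : cderiv f z l ->
  forall eps, 0 < eps -> exists delta, 0 < delta /\
    forall w, Cmod (w - z) < delta -> Cmod (f w - f z) < eps.
Proof.
intros H eps He. destruct (H 1 Rlt_0_1) as [d [Hd H']].
assert (HL := Cmod_ge_0 l).
set (K := 1 + Cmod l). assert (HK : 0 < K) by (unfold K; lra).
exists (Rmin d (eps / K)); split.
{ apply Rmin_pos; [lra|apply Rdiv_lt_0_compat; lra]. }
intros w Hw.
assert (Hw1 := Rlt_le_trans _ _ _ Hw (Rmin_l _ _)).
assert (Hw2 := Rlt_le_trans _ _ _ Hw (Rmin_r _ _)).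
specialize (H' w Hw1).
replace (f w - f z)%C with ((f w - f z - l * (w - z)) + l * (w - z))%C by ring.
apply Rle_lt_trans with (K * Cmod (w - z)).
- eapply Rle_trans; [apply Cmod_triangle|].
  rewrite Cmod_mult. unfold K. lra.
- apply (Rmult_lt_compat_l K) in Hw2; [|exact HK].
  replace (K * (eps / K)) with eps in Hw2 by (field; lra). exact Hw2.
Qed.

Lemma Cmod_minus_sym (x y : C) : Cmod (x - y) = Cmod (y - x).
Proof. rewrite <- Cmod_opp. f_equal. ring. Qed.

Lemma HC_ext (f g : HC) : (forall z, f z = g z) -> f = g.
Proof.
destruct f as [f Hf], g as [g Hg]; simpl; intros E.
assert (f = g) by (apply functional_extensionality, E). subst g.
f_equal. apply proof_irrelevance.
Qed.

(** * The integral of a holomorphic function around a rectangle *)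

Lemma dependent_choice (A : Type) (P : nat -> A -> Prop) (Q : nat -> A -> A -> Prop) :
  (exists a, P 0%nat a) ->
  (forall n a, P n a -> exists a', P (S n) a' /\ Q n a a') ->
  exists s : nat -> A, forall n, P n (s n) /\ Q n (s n) (s (S n)).
Proof.
intros [a0 H0] Hstep.
pose (next := fun n (x : {a | P n a}) =>
  constructive_indefinite_description _ (Hstep n (proj1_sig x) (proj2_sig x))).
pose (s := fix s n : {a | P n a} :=
  match n with
  | O => exist _ a0 H0
  | S m => exist _ (proj1_sig (next m (s m))) (proj1 (proj2_sig (next m (s m))))
  end).
exists (fun n => proj1_sig (s n)); intros n; split.
- exact (proj2_sig (s n)).
- exact (proj2 (proj2_sig (next n (s n)))).
Qed.

Lemma nested_halving (x : nat -> R) (a : R) : 0 <= a ->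
  (forall n, x n <= x (S n) <= x n + a / 2 ^ S n) ->
  exists p, forall n, x n <= p <= x n + a / 2 ^ n.
Proof.
intros Ha H.
assert (Hpow : forall n, 0 < 2 ^ n) by (intros; apply pow_lt; lra).
assert (Hpos : forall n, 0 <= a / 2 ^ n).
{ intros n; apply Rmult_le_pos; [exact Ha|]; left; apply Rinv_0_lt_compat, Hpow. }
assert (Hhalf : forall n, a / 2 ^ n = a / 2 ^ S n + a / 2 ^ S n).
{ intros n; simpl; field; apply Rgt_not_eq, Hpow. }
assert (Hup : forall n k, x n <= x (n + k)%nat).
{ intros n k; induction k; [rewrite Nat.add_0_r; lra|].
  rewrite Nat.add_succ_r. specialize (H (n + k)%nat). lra. }
assert (Hdn : forall n k, x (n + k)%nat + a / 2 ^ (n + k) <= x n + a / 2 ^ n).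
{ intros n k; induction k; [rewrite Nat.add_0_r; lra|].
  rewrite Nat.add_succ_r. specialize (H (n + k)%nat).
  specialize (Hhalf (n + k)%nat). lra. }
assert (Hall : forall m n, x m <= x n + a / 2 ^ n).
{ intros m n. destruct (Nat.le_gt_cases m n) as [L|L].
  - replace n with (m + (n - m))%nat by lia.
    specialize (Hup m (n - m)%nat). specialize (Hpos (m + (n - m))%nat). lra.
  - replace m with (n + (m - n))%nat by lia.
    specialize (Hdn n (m - n)%nat). specialize (Hpos (n + (m - n))%nat). lra. }
destruct (completeness (fun y => exists n, y = x n)) as [p [Hp1 Hp2]].
- exists (x 0%nat + a / 2 ^ 0); intros y [n ->]; apply Hall.
- exists (x 0%nat); now exists 0%nat.
- exists p; intros n; split.
  + apply Hp1; now exists n.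
  + apply Hp2; intros y [m ->]; apply Hall.
Qed.

Lemma continuous_R_eps (g : R -> R) x :
  (forall eps, 0 < eps -> exists d, 0 < d /\
     forall y, Rabs (y - x) < d -> Rabs (g y - g x) < eps) -> continuous g x.
Proof.
intros H. apply filterlim_locally. intros eps.
destruct (H eps (cond_pos eps)) as [d [Hd H']].
exists (mkposreal d Hd). intros y Hy. apply H', Hy.
Qed.

Lemma Cmod_fst (z : C) : Rabs (fst z) <= Cmod z.
Proof. eapply Rle_trans; [apply Rmax_l|apply Rmax_Cmod]. Qed.

Lemma Cmod_snd (z : C) : Rabs (snd z) <= Cmod z.
Proof. eapply Rle_trans; [apply Rmax_r|apply Rmax_Cmod]. Qed.

Lemma Cmod_le_abs (x y : R) : Cmod (x, y) <= Rabs x + Rabs y.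
Proof.
replace (x, y) with (RtoC x + Ci * RtoC y)%C.
2:{ unfold Cplus, Cmult, RtoC; simpl; f_equal; ring. }
eapply Rle_trans; [apply Cmod_triangle|].
rewrite Cmod_mult, Cmod_Ci, !Cmod_R. lra.
Qed.

Lemma entire_diff f z : entire f -> cderiv f z (C_derive f z).
Proof. intros H; exact (cderiv_HC (mkHC f H) z). Qed.

Lemma entire_continuous_line f (h k : R -> R) : entire f ->
  (forall s t, Rabs (h s - h t) + Rabs (k s - k t) <= Rabs (s - t)) ->
  forall t, continuous (fun s => fst (f (h s, k s))) t /\
            continuous (fun s => snd (f (h s, k s))) t.
Proof.
intros Hf Hhk t.
assert (E : forall eps, 0 < eps -> exists d, 0 < d /\ forall s, Rabs (s - t) < d ->
  Cmod (f (h s, k s) - f (h t, k t)) < eps).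
{ intros eps He.
  destruct (cderiv_continuous _ _ _ (entire_diff f (h t, k t) Hf) eps He) as [d [Hd H]].
  exists d; split; [exact Hd|]. intros s Hs. apply H.
  eapply Rle_lt_trans; [apply (Cmod_le_abs (h s - h t) (k s - k t))|].
  eapply Rle_lt_trans; [apply Hhk|exact Hs]. }
split; apply continuous_R_eps; intros eps He; destruct (E eps He) as [d [Hd H]];
  exists d; (split; [exact Hd|]); intros s Hs;
  (eapply Rle_lt_trans; [|apply (H s Hs)]); [apply (Cmod_fst (f _ - f _)%C)|apply (Cmod_snd (f _ - f _)%C)].
Qed.

Lemma continuous_horizontal f y : entire f -> forall t,
  continuous (fun s => fst (f (s, y))) t /\ continuous (fun s => snd (f (s, y))) t.
Proof.
intros Hf. apply (entire_continuous_line f (fun s => s) (fun _ => y) Hf).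
intros s t. rewrite Rminus_diag, Rabs_R0. lra.
Qed.

Lemma continuous_vertical f x : entire f -> forall t,
  continuous (fun s => fst (f (x, s))) t /\ continuous (fun s => snd (f (x, s))) t.
Proof.
intros Hf. apply (entire_continuous_line f (fun _ => x) (fun s => s) Hf).
intros s t. rewrite Rminus_diag, Rabs_R0. lra.
Qed.

Lemma RInt_Rminus (g h : R -> R) a b : ex_RInt g a b -> ex_RInt h a b ->
  RInt (fun t => g t - h t) a b = RInt g a b - RInt h a b.
Proof. exact (RInt_minus (V:=R_CompleteNormedModule) g h a b). Qed.

Lemma RInt_Rconst c a b : RInt (fun _ => c) a b = c * (b - a).
Proof. rewrite RInt_const. unfold scal; simpl. unfold mult; simpl. ring. Qed.

(** The real part of the integral of [f] along the boundary of
    [[x0, x1] * [y0, y1]]; the imaginary part is the same quantity for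
    [- i f]. *)
Definition rect_integral (f : C -> C) (x0 x1 y0 y1 : R) : R :=
  RInt (fun t => fst (f (t, y0)) - fst (f (t, y1))) x0 x1 -
  RInt (fun t => snd (f (x1, t)) - snd (f (x0, t))) y0 y1.

Section Rectangle.
Variable f : C -> C.
Hypothesis Hf : entire f.

Let ex_horizontal y0 y1 a b : ex_RInt (fun t => fst (f (t, y0)) - fst (f (t, y1))) a b.
Proof.
apply (ex_RInt_continuous (V:=R_CompleteNormedModule)); intros t _.
apply (continuous_minus (V:=R_NormedModule)); apply (continuous_horizontal f _ Hf).
Qed.

Let ex_vertical x0 x1 a b : ex_RInt (fun t => snd (f (x1, t)) - snd (f (x0, t))) a b.
Proof.
apply (ex_RInt_continuous (V:=R_CompleteNormedModule)); intros t _.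
apply (continuous_minus (V:=R_NormedModule)); apply (continuous_vertical f _ Hf).
Qed.

Let ex_h y a b : ex_RInt (fun t => fst (f (t, y))) a b.
Proof.
apply (ex_RInt_continuous (V:=R_CompleteNormedModule)); intros t _.
apply (continuous_horizontal f _ Hf).
Qed.

Let ex_v x a b : ex_RInt (fun t => snd (f (x, t))) a b.
Proof.
apply (ex_RInt_continuous (V:=R_CompleteNormedModule)); intros t _.
apply (continuous_vertical f _ Hf).
Qed.

Lemma rect_integral_split_x x0 m x1 y0 y1 :
  rect_integral f x0 x1 y0 y1 = rect_integral f x0 m y0 y1 + rect_integral f m x1 y0 y1.
Proof.
unfold rect_integral.
rewrite <- (RInt_Chasles (V:=R_CompleteNormedModule) _ x0 m x1 (ex_horizontal _ _ _ _) (ex_horizontal _ _ _ _)).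
rewrite !(RInt_Rminus (fun t => snd (f (_, t)))) by apply ex_v.
unfold plus; simpl. ring.
Qed.

Lemma rect_integral_split_y x0 x1 y0 m y1 :
  rect_integral f x0 x1 y0 y1 = rect_integral f x0 x1 y0 m + rect_integral f x0 x1 m y1.
Proof.
unfold rect_integral.
rewrite <- (RInt_Chasles (V:=R_CompleteNormedModule) _ y0 m y1 (ex_vertical _ _ _ _) (ex_vertical _ _ _ _)).
rewrite !(RInt_Rminus (fun t => fst (f (t, _)))) by apply ex_h.
unfold plus; simpl. ring.
Qed.

Lemma RInt_near_const (g : R -> R) a b c M : a <= b -> ex_RInt g a b ->
  (forall t, a <= t <= b -> Rabs (g t - c) <= M) ->
  Rabs (RInt g a b - c * (b - a)) <= M * (b - a).
Proof.
intros Hab Hg HM.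
replace (RInt g a b - c * (b - a)) with (RInt (fun t => g t - c) a b).
- rewrite Rmult_comm. apply abs_RInt_le_const; [exact Hab| |exact HM].
  apply (ex_RInt_minus (V:=R_NormedModule) g (fun _ => c)); [exact Hg|apply ex_RInt_const].
- rewrite RInt_Rminus, RInt_Rconst by (exact Hg || apply ex_RInt_const). reflexivity.
Qed.

(** The boundary integral of an affine function vanishes, so only the
    remainder of the first-order expansion at [p] contributes. *)
Lemma rect_integral_local p l eps x0 x1 y0 y1 : x0 <= x1 -> y0 <= y1 ->
  (forall x y, x0 <= x <= x1 -> y0 <= y <= y1 ->
     Cmod (f (x, y) - f p - l * ((x, y) - p)) <= eps) ->
  Rabs (rect_integral f x0 x1 y0 y1) <= 2 * eps * (x1 - x0 + (y1 - y0)).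
Proof.
intros Hx Hy H.
assert (H1 : Rabs (RInt (fun t => fst (f (t, y0)) - fst (f (t, y1))) x0 x1
              - snd l * (y1 - y0) * (x1 - x0)) <= 2 * eps * (x1 - x0)).
{ apply RInt_near_const; [exact Hx|apply ex_horizontal|]. intros t Ht.
  assert (E0 := H t y0 Ht (conj (Rle_refl _) Hy)).
  assert (E1 := H t y1 Ht (conj Hy (Rle_refl _))).
  assert (F0 := Rle_trans _ _ _ (Cmod_fst _) E0).
  assert (F1 := Rle_trans _ _ _ (Cmod_fst _) E1).
  simpl in F0, F1. apply Rabs_le_between in F0, F1. apply Rabs_le_between. lra. }
assert (H2 : Rabs (RInt (fun t => snd (f (x1, t)) - snd (f (x0, t))) y0 y1
              - snd l * (x1 - x0) * (y1 - y0)) <= 2 * eps * (y1 - y0)).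
{ apply RInt_near_const; [exact Hy|apply ex_vertical|]. intros t Ht.
  assert (E0 := H x0 t (conj (Rle_refl _) Hx) Ht).
  assert (E1 := H x1 t (conj Hx (Rle_refl _)) Ht).
  assert (F0 := Rle_trans _ _ _ (Cmod_snd _) E0).
  assert (F1 := Rle_trans _ _ _ (Cmod_snd _) E1).
  simpl in F0, F1. apply Rabs_le_between in F0, F1. apply Rabs_le_between. lra. }
unfold rect_integral. apply Rabs_le_between in H1, H2. apply Rabs_le_between. lra.
Qed.

Lemma rect_integral_quarter x y a b :
  exists x' y', (x' = x \/ x' = x + a / 2) /\ (y' = y \/ y' = y + b / 2) /\
    Rabs (rect_integral f x (x + a) y (y + b)) <=
    4 * Rabs (rect_integral f x' (x' + a / 2) y' (y' + b / 2)).
Proof.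
assert (Ha : x + a / 2 + a / 2 = x + a) by field.
assert (Hb : y + b / 2 + b / 2 = y + b) by field.
assert (E : rect_integral f x (x + a) y (y + b) =
  rect_integral f x (x + a / 2) y (y + b / 2) +
  rect_integral f x (x + a / 2) (y + b / 2) (y + b / 2 + b / 2) +
  (rect_integral f (x + a / 2) (x + a / 2 + a / 2) y (y + b / 2) +
   rect_integral f (x + a / 2) (x + a / 2 + a / 2) (y + b / 2) (y + b / 2 + b / 2))).
{ rewrite Ha, Hb. rewrite (rect_integral_split_x x (x + a / 2)).
  now rewrite (rect_integral_split_y x _ y (y + b / 2)), (rect_integral_split_y (x + a / 2) _ y (y + b / 2)). }
apply NNPP; intros N.
assert (N' : forall x' y', (x' = x \/ x' = x + a / 2) -> (y' = y \/ y' = y + b / 2) ->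
  4 * Rabs (rect_integral f x' (x' + a / 2) y' (y' + b / 2)) <
  Rabs (rect_integral f x (x + a) y (y + b))).
{ intros x' y' Hx' Hy'. apply Rnot_le_lt; intros L. apply N. now exists x', y'. }
assert (N1 := N' x y (or_introl eq_refl) (or_introl eq_refl)).
assert (N2 := N' x (y + b / 2) (or_introl eq_refl) (or_intror eq_refl)).
assert (N3 := N' (x + a / 2) y (or_intror eq_refl) (or_introl eq_refl)).
assert (N4 := N' (x + a / 2) (y + b / 2) (or_intror eq_refl) (or_intror eq_refl)).
revert N1 N2 N3 N4. rewrite E. intros N1 N2 N3 N4.
match type of N1 with _ < Rabs (?p + ?q + (?r + ?s)) =>
  assert (T1 := Rabs_triang (p + q) (r + s)); assert (T2 := Rabs_triang p q);
  assert (T3 := Rabs_triang r s) end.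
lra.
Qed.

(** Goursat's theorem: complex differentiability alone suffices. Halving the
    rectangle repeatedly, some quarter keeps at least a quarter of the integral,
    while near the common point [p] of the chosen quarters the integral is
    [o(area)]. *)
Theorem goursat_rectangle x0 x1 y0 y1 : x0 <= x1 -> y0 <= y1 ->
  rect_integral f x0 x1 y0 y1 = 0.
Proof.
intros Hx Hy.
apply NNPP; intros Hne.
set (a := x1 - x0). set (b := y1 - y0).
set (eta := Rabs (rect_integral f x0 x1 y0 y1)).
assert (Heta : 0 < eta) by (apply Rabs_pos_lt, Hne).
assert (Ha : 0 <= a) by (unfold a; lra). assert (Hb : 0 <= b) by (unfold b; lra).
assert (Hpow : forall n, 0 < 2 ^ n) by (intros; apply pow_lt; lra).
destruct (dependent_choice (R * R)
  (fun n p => eta <= 4 ^ n * Rabs (rect_integral f (fst p) (fst p + a / 2 ^ n)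
                              (snd p) (snd p + b / 2 ^ n)))
  (fun n p q => (fst p <= fst q <= fst p + a / 2 ^ S n) /\
                (snd p <= snd q <= snd p + b / 2 ^ S n))) as [s Hs].
- exists (x0, y0); simpl. replace (x0 + a / 1) with x1 by (unfold a; field).
  replace (y0 + b / 1) with y1 by (unfold b; field). unfold eta. lra.
- intros n [x y] H; simpl in H.
  destruct (rect_integral_quarter x y (a / 2 ^ n) (b / 2 ^ n)) as [x' [y' [Hx' [Hy' HQ]]]].
  assert (Ea : a / 2 ^ n / 2 = a / 2 ^ S n) by (simpl; field; apply Rgt_not_eq, Hpow).
  assert (Eb : b / 2 ^ n / 2 = b / 2 ^ S n) by (simpl; field; apply Rgt_not_eq, Hpow).
  rewrite Ea in *; rewrite Eb in *.
  assert (0 <= a / 2 ^ S n).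
  { apply Rmult_le_pos; [exact Ha|]; left; apply Rinv_0_lt_compat, Hpow. }
  assert (0 <= b / 2 ^ S n).
  { apply Rmult_le_pos; [exact Hb|]; left; apply Rinv_0_lt_compat, Hpow. }
  exists (x', y'); simpl fst; simpl snd; split.
  + eapply Rle_trans; [exact H|].
    eapply Rle_trans; [apply Rmult_le_compat_l; [|exact HQ]|].
    * apply pow_le; lra.
    * simpl (4 ^ S n). lra.
  + split; [destruct Hx' as [-> | ->]|destruct Hy' as [-> | ->]]; lra.
- destruct (nested_halving (fun n => fst (s n)) a Ha) as [px Hpx].
  { intros n; apply (Hs n). }
  destruct (nested_halving (fun n => snd (s n)) b Hb) as [py Hpy].
  { intros n; apply (Hs n). }
  set (p := (px, py)).
  set (c := a + b).
  set (eps := eta / (4 * (c * c + 1))).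
  assert (Hc : 0 <= c * c) by apply Rle_0_sqr.
  assert (Heps : 0 < eps) by (apply Rdiv_lt_0_compat; lra).
  destruct (entire_diff f p Hf eps Heps) as [d [Hd Hdiff]].
  assert (Hn : exists n, c / 2 ^ n < d).
  { destruct (pow_lt_1_zero (1 / 2)) with (y := d / (c + 1)) as [n Hn].
    - rewrite Rabs_pos_eq; lra.
    - apply Rdiv_lt_0_compat; unfold c in *; lra.
    - exists n. specialize (Hn n (Nat.le_refl n)).
      rewrite Rabs_pos_eq in Hn by (apply pow_le; lra).
      apply Rle_lt_trans with ((c + 1) * (1 / 2) ^ n).
      + unfold Rdiv. rewrite Rmult_1_l, pow_inv.
        apply Rmult_le_compat_r; [left; apply Rinv_0_lt_compat, Hpow|lra].
      + apply (Rmult_lt_compat_l (c + 1)) in Hn; [|unfold c in *; lra].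
        replace ((c + 1) * (d / (c + 1))) with d in Hn by (field; unfold c in *; lra).
        exact Hn. }
  destruct Hn as [n Hn].
  destruct (Hs n) as [HP _]. specialize (Hpx n). specialize (Hpy n).
  simpl in HP, Hpx, Hpy.
  set (X := fst (s n)) in *. set (Y := snd (s n)) in *.
  set (h := 2 ^ n) in *. assert (Hh : 0 < h) by apply Hpow.
  assert (Ea : 0 <= a / h) by (apply Rmult_le_pos; [exact Ha|left; apply Rinv_0_lt_compat, Hh]).
  assert (Eb : 0 <= b / h) by (apply Rmult_le_pos; [exact Hb|left; apply Rinv_0_lt_compat, Hh]).
  assert (Ec : c / h = a / h + b / h) by (unfold c; field; lra).
  assert (L : Rabs (rect_integral f X (X + a / h) Y (Y + b / h)) <=
              2 * (eps * (c / h)) * (X + a / h - X + (Y + b / h - Y))).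
  { apply (rect_integral_local p (C_derive f p)); [lra|lra|].
    intros x y Hxx Hyy.
    assert (Hxy : Cmod ((x, y) - p) <= c / h).
    { eapply Rle_trans; [apply (Cmod_le_abs (x - px) (y - py))|].
      rewrite Ec. apply Rplus_le_compat; apply Rabs_le_between; lra. }
    eapply Rle_trans; [apply Hdiff; lra|].
    apply Rmult_le_compat_l; lra. }
  replace (X + a / h - X + (Y + b / h - Y)) with (c / h) in L by (rewrite Ec; ring).
  assert (E4 : 4 ^ n = h * h).
  { unfold h. rewrite <- Rpow_mult_distr. f_equal; ring. }
  assert (L2 : eta <= 2 * eps * (c * c)).
  { eapply Rle_trans; [exact HP|]. rewrite E4.
    eapply Rle_trans; [apply Rmult_le_compat_l; [|exact L]|].
    - apply Rlt_le, Rmult_lt_0_compat; exact Hh.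
    - right. field. lra. }
  assert (L3 : 4 * eps * (c * c + 1) = eta) by (unfold eps; field; lra).
  assert (0 <= eps * (c * c)) by (apply Rmult_le_pos; lra).
  nra.
Qed.

End Rectangle.

(** * Cauchy's estimate for the derivative *)

Definition cexp (w : C) : C := (exp (fst w) * cos (snd w), exp (fst w) * sin (snd w)).

Lemma cexp_plus v w : cexp (v + w) = (cexp v * cexp w)%C.
Proof.
unfold cexp, Cplus, Cmult; simpl. rewrite exp_plus, cos_plus, sin_plus.
f_equal; ring.
Qed.

Lemma cexp_0 : cexp 0 = 1%C.
Proof. unfold cexp, RtoC; simpl. rewrite exp_0, cos_0, sin_0. f_equal; ring. Qed.

Lemma Cmod_cexp w : Cmod (cexp w) = exp (fst w).
Proof.
unfold Cmod, cexp; simpl.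
replace (_ + _) with (exp (fst w) * exp (fst w) * (Rsqr (sin (snd w)) + Rsqr (cos (snd w))))
  by (unfold Rsqr; ring).
rewrite sin2_cos2, Rmult_1_r. apply sqrt_square. left; apply exp_pos.
Qed.

Lemma derivable_pt_lim_expand g x l : derivable_pt_lim g x l -> forall eps, 0 < eps ->
  exists d, 0 < d /\ forall h, Rabs h < d -> Rabs (g (x + h) - g x - l * h) <= eps * Rabs h.
Proof.
intros H eps He. destruct (H eps He) as [d Hd].
exists d; split; [apply cond_pos|]. intros h Hh.
destruct (Req_dec h 0) as [->|Hn].
- rewrite Rplus_0_r. replace (g x - g x - l * 0) with 0 by ring. rewrite Rabs_R0; lra.
- specialize (Hd h Hn Hh).
  replace (g (x + h) - g x - l * h) with (((g (x + h) - g x) / h - l) * h) by (field; exact Hn).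
  rewrite Rabs_mult. apply Rmult_le_compat_r; [apply Rabs_pos|lra].
Qed.

Lemma cderiv_cexp_0 : cderiv cexp 0 1.
Proof.
intros eps He.
set (e := Rmin 1 (eps / 6)).
assert (He0 : 0 < e) by (apply Rmin_pos; lra).
assert (H6 : e <= 1) by apply Rmin_l.
assert (H7 : 6 * e <= eps) by (assert (e <= eps / 6) by apply Rmin_r; lra).
destruct (derivable_pt_lim_expand _ _ _ (derivable_pt_lim_exp 0) e He0) as [d1 [Hd1 E1]].
destruct (derivable_pt_lim_expand _ _ _ (derivable_pt_lim_cos 0) e He0) as [d2 [Hd2 E2]].
destruct (derivable_pt_lim_expand _ _ _ (derivable_pt_lim_sin 0) e He0) as [d3 [Hd3 E3]].
exists (Rmin (Rmin d1 d2) (Rmin d3 (e / 2))); split.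
{ repeat apply Rmin_pos; lra. }
intros [x y] Hw. replace (Cminus (x, y) 0) with ((x, y) : C) in *
  by (unfold Cminus, Cplus, Copp, RtoC; simpl; f_equal; ring).
assert (Hw12 := Rlt_le_trans _ _ _ Hw (Rmin_l _ _)).
assert (Hw34 := Rlt_le_trans _ _ _ Hw (Rmin_r _ _)).
assert (Hw1 := Rlt_le_trans _ _ _ Hw12 (Rmin_l _ _)).
assert (Hw2 := Rlt_le_trans _ _ _ Hw12 (Rmin_r _ _)).
assert (Hw3 := Rlt_le_trans _ _ _ Hw34 (Rmin_l _ _)).
assert (Hw4 := Rlt_le_trans _ _ _ Hw34 (Rmin_r _ _)).
assert (Hx := Cmod_fst (x, y)). assert (Hy := Cmod_snd (x, y)). simpl in Hx, Hy.
specialize (E1 x ltac:(lra)). specialize (E2 y ltac:(lra)). specialize (E3 y ltac:(lra)).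
rewrite Rplus_0_l, exp_0 in E1. rewrite Rplus_0_l, cos_0, sin_0 in E2.
rewrite Rplus_0_l, cos_0, sin_0 in E3.
set (h := Cmod (x, y)) in *.
rewrite cexp_0.
replace (cexp (x, y) - 1 - 1 * (x, y))%C with
  ((exp x * cos y - 1 - x, exp x * sin y - y) : C).
2:{ unfold cexp, Cminus, Cplus, Copp, Cmult, RtoC; simpl; f_equal; ring. }
eapply Rle_trans; [apply Cmod_le_abs|].
assert (Hax : 0 <= Rabs x) by apply Rabs_pos.
assert (Hay : 0 <= Rabs y) by apply Rabs_pos.
assert (P1 : Rabs (exp x * cos y - 1 - x) <= e * h + 2 * (e * h)).
{ replace (exp x * cos y - 1 - x) with ((exp x - 1 - 1 * x) * cos y + (1 + x) * (cos y - 1 - -0 * y)) by ring.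
  eapply Rle_trans; [apply Rabs_triang|]. rewrite !Rabs_mult.
  apply Rplus_le_compat.
  - rewrite <- (Rmult_1_r (e * h)). apply Rmult_le_compat; try apply Rabs_pos.
    + eapply Rle_trans; [exact E1|]. apply Rmult_le_compat_l; lra.
    + apply Rabs_le, COS_bound.
  - apply Rmult_le_compat; try apply Rabs_pos.
    + apply Rabs_le_between. apply Rabs_le_between in Hx. lra.
    + eapply Rle_trans; [exact E2|]. apply Rmult_le_compat_l; lra. }
assert (P2 : Rabs (exp x * sin y - y) <= e * (2 * h) + e * h).
{ replace (exp x * sin y - y) with ((exp x - 1) * sin y + (sin y - 0 - 1 * y)) by ring.
  eapply Rle_trans; [apply Rabs_triang|]. rewrite Rabs_mult.
  apply Rplus_le_compat.
  - apply Rmult_le_compat; try apply Rabs_pos.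
    + replace (exp x - 1) with ((exp x - 1 - 1 * x) + x) by ring.
      eapply Rle_trans; [apply Rabs_triang|].
      assert (e * Rabs x <= 1 * Rabs x) by (apply Rmult_le_compat_r; lra). lra.
    + replace (sin y) with ((sin y - 0 - 1 * y) + y) by ring.
      eapply Rle_trans; [apply Rabs_triang|].
      assert (e * Rabs y <= 1 * Rabs y) by (apply Rmult_le_compat_r; lra).
      apply Rle_trans with (2 * Rabs y); [lra|]. apply Rmult_le_compat_l; lra.
  - eapply Rle_trans; [exact E3|]. apply Rmult_le_compat_l; lra. }
assert (e * h * 6 <= eps * h).
{ assert (0 <= h) by apply Cmod_ge_0. replace (e * h * 6) with (6 * e * h) by ring.
  apply Rmult_le_compat_r; lra. }
lra.
Qed.


Lemma cderiv_cexp w : cderiv cexp w (cexp w).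
Proof.
apply (cderiv_ext (fun v => cexp w * cexp (1 * v + - w))%C).
{ intros v. rewrite <- cexp_plus. f_equal. ring. }
apply (cderiv_eq _ _ (cexp w * (1 * 1))%C); [|ring].
apply cderiv_scal, (cderiv_comp cexp); [|apply cderiv_affine].
replace (1 * w + - w)%C with (RtoC 0) by ring. apply cderiv_cexp_0.
Qed.

Lemma rotate_to_real (l : C) : exists zeta, Cmod zeta = 1 /\ (zeta * l = RtoC (Cmod l))%C.
Proof.
destruct (Ceq_dec l 0) as [->|Hl].
- exists 1%C. rewrite Cmod_1, Cmod_0. split; [reflexivity|ring].
- assert (Hm : Cmod l <> 0) by (intros E; apply Hl, Cmod_eq_0, E).
  exists (Cconj l / RtoC (Cmod l))%C; split.
  + rewrite Cmod_div, Cmod_conj, Cmod_R, Rabs_pos_eq by (apply Cmod_ge_0 || (intros E; apply Hm; injection E; auto)).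
    field; exact Hm.
  + replace (Cconj l / RtoC (Cmod l) * l)%C with ((l * Cconj l) / RtoC (Cmod l))%C
      by (unfold Cdiv; ring).
    rewrite <- Cmod2_conj, <- RtoC_div by exact Hm.
    f_equal. field; exact Hm.
Qed.

(** In the coordinate [w] with [v = z + e^w], the function
    [(f v - f z) / (v - z)] is entire and [2 pi i]-periodic, so by Goursat its
    mean over a vertical period does not depend on [Re w]. As [Re w] tends to
    minus infinity the mean tends to [f' z]; at [Re w = ln r] it is at most
    [2 M / r]. *)
Theorem cauchy_estimate f z r M : entire f -> 0 < r ->
  (forall w, Cmod (w - z) <= r -> Cmod (f w) <= M) -> Cmod (C_derive f z) <= 2 * M / r.
Proof.
intros Hf Hr HM.
assert (HPI := PI_RGT_0).
apply le_epsilon; intros eps He.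
destruct (rotate_to_real (C_derive f z)) as [zeta0 [Hz0 Hl]].
(* the extra factor [i] moves the rotated derivative into the imaginary part,
   which is the one that Goursat's real identity controls on vertical sides *)
set (zeta := (Ci * zeta0)%C).
assert (Hz : Cmod zeta = 1) by (unfold zeta; rewrite Cmod_mult, Cmod_Ci, Hz0; ring).
set (F := fun w => (zeta * ((f (z + cexp w) - f z) * cexp (- w)))%C).
assert (HF : entire F).
{ apply (entire_cderiv F (fun w => zeta * ((C_derive f (z + cexp w) * cexp w - 0) * cexp (- w)
    + (f (z + cexp w) - f z) * (cexp (- w) * - (1))))%C).
  intros w. unfold F. apply cderiv_scal.
  apply (cderiv_mult (fun w => f (z + cexp w) - f z)%C (fun w => cexp (- w))).
  - apply (cderiv_minus (fun w => f (z + cexp w)%C)); [|apply cderiv_const].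
    apply (cderiv_comp f (fun w => z + cexp w)%C); [apply entire_diff, Hf|].
    apply (cderiv_eq _ _ (0 + cexp w)%C); [|ring].
    apply (cderiv_plus (fun _ => z)); [apply cderiv_const|apply cderiv_cexp].
  - apply (cderiv_comp cexp Copp); [apply cderiv_cexp|].
    apply (cderiv_ext (fun w => - (1) * w + 0)%C); [intros; ring|apply cderiv_affine]. }
destruct (entire_diff f z Hf eps He) as [d [Hd Hdiff]].
set (s := ln r). set (s0 := Rmin s (ln (d / 2))).
assert (Hs0 : exp s0 < d).
{ apply Rle_lt_trans with (exp (ln (d / 2))); [|rewrite exp_ln; lra].
  destruct (Rmin_r s (ln (d / 2))) as [L|E]; [left; now apply exp_increasing|right; unfold s0; now rewrite E]. }
assert (Hexv : forall x, ex_RInt (fun t => snd (F (x, t))) 0 (2 * PI)).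
{ intros x. apply (ex_RInt_continuous (V:=R_CompleteNormedModule)); intros t _.
  apply (continuous_vertical F _ HF). }
assert (HG : RInt (fun t => snd (F (s, t))) 0 (2 * PI) = RInt (fun t => snd (F (s0, t))) 0 (2 * PI)).
{ assert (G := goursat_rectangle F HF s0 s 0 (2 * PI) (Rmin_l _ _) ltac:(lra)).
  unfold rect_integral in G.
  rewrite (RInt_Rminus (fun t => snd (F (s, t)))) in G by apply Hexv.
  rewrite (RInt_ext _ (fun _ => 0)) in G.
  - rewrite RInt_Rconst in G. lra.
  - intros t _. unfold F.
    assert (E : forall x, cexp (x, 2 * PI) = cexp (x, 0)).
    { intros x; unfold cexp; simpl. now rewrite cos_2PI, sin_2PI, cos_0, sin_0. }
    assert (E' : forall x, cexp (Copp (x, 2 * PI)) = cexp (Copp (x, 0))).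
    { intros x; unfold cexp; simpl. now rewrite !cos_neg, !sin_neg, cos_2PI, sin_2PI, cos_0, sin_0. }
    cbv beta. rewrite E, E'. apply Rminus_diag. }
assert (Hinv : forall w, Cmod (cexp (- w)) = / Cmod (cexp w)).
{ intros w. rewrite !Cmod_cexp. simpl. apply exp_Ropp. }
assert (B1 : Rabs (RInt (fun t => snd (F (s, t))) 0 (2 * PI) - 0 * (2 * PI - 0)) <= 2 * M / r * (2 * PI - 0)).
{ apply RInt_near_const; [lra|apply Hexv|]. intros t _. rewrite Rminus_0_r.
  eapply Rle_trans; [apply Cmod_snd|]. unfold F.
  rewrite !Cmod_mult, Hz, Hinv, Cmod_cexp. simpl. unfold s. rewrite exp_ln by exact Hr.
  rewrite Rmult_1_l. apply Rmult_le_compat_r; [left; apply Rinv_0_lt_compat, Hr|].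
  unfold Cminus. eapply Rle_trans; [apply Cmod_triangle|]. rewrite Cmod_opp.
  assert (Cmod (f (z + cexp (ln r, t))%C) <= M).
  { apply HM. replace (z + cexp (ln r, t) - z)%C with (cexp (ln r, t)) by ring.
    rewrite Cmod_cexp. simpl. rewrite exp_ln; lra. }
  assert (Cmod (f z) <= M).
  { apply HM. replace (z - z)%C with (RtoC 0) by ring. rewrite Cmod_0. lra. }
  lra. }
assert (B0 : Rabs (RInt (fun t => snd (F (s0, t))) 0 (2 * PI) - Cmod (C_derive f z) * (2 * PI - 0))
             <= eps * (2 * PI - 0)).
{ apply RInt_near_const; [lra|apply Hexv|]. intros t _.
  assert (E : (zeta * C_derive f z)%C = (0, Cmod (C_derive f z))).
  { unfold zeta. rewrite <- Cmult_assoc, Hl. unfold Cmult, Ci, RtoC; simpl. f_equal; ring. }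
  set (w := (s0, t)).
  replace (snd (F w) - Cmod (C_derive f z)) with (snd (F w - zeta * C_derive f z)%C)
    by (rewrite E; reflexivity).
  eapply Rle_trans; [apply Cmod_snd|].
  assert (E1 : (cexp w * cexp (- w) = 1)%C).
  { rewrite <- cexp_plus. replace (w + - w)%C with (RtoC 0) by ring. apply cexp_0. }
  replace (F w - zeta * C_derive f z)%C with
    (zeta * ((f (z + cexp w) - f z - C_derive f z * (cexp w)) * cexp (- w)))%C.
  2:{ unfold F.
      replace (zeta * ((f (z + cexp w) - f z - C_derive f z * cexp w) * cexp (- w)))%C with
        (zeta * ((f (z + cexp w) - f z) * cexp (- w)) - zeta * C_derive f z * (cexp w * cexp (- w)))%C
        by ring.
      rewrite E1. ring. }
  rewrite !Cmod_mult, Hz, Hinv, Rmult_1_l.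
  specialize (Hdiff (z + cexp w)%C).
  replace (z + cexp w - z)%C with (cexp w) in Hdiff by ring.
  assert (Hm : Cmod (cexp w) = exp s0) by apply Cmod_cexp.
  rewrite Hm in *. assert (0 < exp s0) by apply exp_pos.
  replace eps with (eps * exp s0 * / exp s0) by (field; lra).
  apply Rmult_le_compat_r; [left; now apply Rinv_0_lt_compat|].
  apply Hdiff. exact Hs0. }
rewrite HG in B1. rewrite Rminus_0_r in *.
apply Rabs_le_between in B0, B1.
assert (Hfin : Cmod (C_derive f z) * (2 * PI) <= (2 * M / r + eps) * (2 * PI)) by lra.
apply Rmult_le_reg_r with (2 * PI); lra.
Qed.

(** * Compact sets and closed disks *)

Definition disk (R : R) (z : C) : Prop := Cmod z <= R.

(** Heine-Borel for arbitrary open covers, from the compactness of boxes with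
    respect to a gauge: the gauge at a point of the disk comes from a member of the
    cover, and outside the disk it is small enough to miss the disk. *)
Lemma compactC_disk r : compactC (disk r).
Proof.
intros U HU Hcov.
assert (Hex : forall t : Compactness.Tn 2 R, exists p : posreal * (C -> Prop),
  let c : C := (fst t, fst (snd t)) in
  (disk r c -> U (snd p)) /\
  (forall w : C, Rabs (fst w - fst c) < fst p -> Rabs (snd w - snd c) < fst p ->
     disk r w -> disk r c /\ snd p w)).
{ intros [x [y []]]; simpl. destruct (Rle_lt_dec (Cmod (x, y)) r) as [Hin|Hout].
  - destruct (Hcov (x, y) Hin) as [A [HA Axy]].
    destruct (HU A HA (x, y) Axy) as [d Hd].
    exists (d, A); simpl; split; [auto|]. intros w H1 H2 _. split; [exact Hin|]. apply Hd. now split.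
  - assert (Hd : 0 < (Cmod (x, y) - r) / 2) by lra.
    exists (mkposreal _ Hd, fun _ => False); simpl; split; [unfold disk; lra|].
    intros w H1 H2 Hw. unfold disk in Hw.
    assert (Cmod (x, y) <= Cmod w + (Rabs (fst w - x) + Rabs (snd w - y))).
    { replace ((x, y) : C) with (w - (w - (x, y)))%C.
      - unfold Cminus at 1. eapply Rle_trans; [apply Cmod_triangle|]. rewrite Cmod_opp.
        apply Rplus_le_compat_l. destruct w as [a b]. apply (Cmod_le_abs (a - x) (b - y)).
      - destruct w; unfold Cminus, Cplus, Copp; simpl; f_equal; ring. }
    lra. }
pose (sel := fun t => proj1_sig (constructive_indefinite_description _ (Hex t))).
assert (Hsel : forall t : Compactness.Tn 2 R, let c : C := (fst t, fst (snd t)) in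
  (disk r c -> U (snd (sel t))) /\
  (forall w : C, Rabs (fst w - fst c) < fst (sel t) -> Rabs (snd w - snd c) < fst (sel t) ->
     disk r w -> disk r c /\ snd (sel t) w))
  by (intros t; exact (proj2_sig (constructive_indefinite_description _ (Hex t)))).
apply NNPP; intros Hno.
apply (compactness_list 2 (- r, (- r, tt)) (r, (r, tt)) (fun t => fst (sel t))).
intros [l Hl]. apply Hno.
exists (map (fun t => snd (sel t))
  (filter (fun t => if Rle_dec (Cmod (fst t, fst (snd t))) r then true else false) l)).
split.
- intros A HA. apply in_map_iff in HA. destruct HA as [t [<- Ht]].
  apply filter_In in Ht. destruct Ht as [_ Ht].
  destruct (Rle_dec (Cmod (fst t, fst (snd t))) r) as [Hr|]; [|discriminate].
  now apply (Hsel t).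
- intros [x y] Hz. destruct (Hl (x, (y, tt))) as [t [Ht [_ Hc]]].
  { assert (H1 := Cmod_fst (x, y)). assert (H2 := Cmod_snd (x, y)). simpl in H1, H2.
    unfold disk in Hz. apply Rabs_le_between in H1, H2. simpl. lra. }
  assert (Hm : disk r (fst t, fst (snd t)) /\ snd (sel t) (x, y)).
  { apply (Hsel t); [| |exact Hz]; destruct t as [u [v []]]; simpl in Hc |- *; tauto. }
  exists (snd (sel t)). split; [|apply Hm].
  apply (in_map (fun t => snd (sel t))), filter_In. split; [exact Ht|].
  destruct (Rle_dec (Cmod (fst t, fst (snd t))) r) as [|Hr]; [reflexivity|].
  now elim Hr.
Qed.

Lemma open_of_eps (A : C -> Prop) :
  (forall z, A z -> exists d, 0 < d /\ forall w, Cmod (w - z) < d -> A w) ->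
  @open C_UniformSpace A.
Proof.
intros H z Hz. destruct (H z Hz) as [d [Hd Hw]].
assert (Hd2 : 0 < d / 2) by lra.
exists (mkposreal _ Hd2). intros w [H1 H2]. apply Hw.
eapply Rle_lt_trans; [apply (Cmod_le_abs (fst w - fst z) (snd w - snd z))|].
change (Rabs (fst w - fst z) < d / 2) in H1.
change (Rabs (snd w - snd z) < d / 2) in H2. lra.
Qed.

(** The open sets on which [g] is bounded above cover the plane. *)
Lemma compactC_bounded (K : C -> Prop) (g : C -> R) : compactC K ->
  (forall z, exists d, 0 < d /\ forall w, Cmod (w - z) < d -> g w < g z + 1) ->
  exists M, forall z, K z -> g z <= M.
Proof.
intros HK Hg.
destruct (HK (fun A => @open C_UniformSpace A /\ exists M, forall z, A z -> g z <= M)) as [l [Hl Hcov]].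
- now intros A [HA _].
- intros z _.
  destruct (Hg z) as [d [Hd Hw]].
  exists (fun w => Cmod (w - z) < d). split; [split|].
  + apply open_of_eps. intros w H. exists (d - Cmod (w - z)); split; [lra|].
    intros v Hv. replace (v - z)%C with ((v - w) + (w - z))%C by ring.
    eapply Rle_lt_trans; [apply Cmod_triangle|lra].
  + exists (g z + 1). intros w H; left; now apply Hw.
  + replace (z - z)%C with (RtoC 0) by ring. now rewrite Cmod_0.
- assert (HM : exists M, forall A, In A l -> forall z, A z -> g z <= M).
  { clear Hcov. induction l as [|A l IH].
    - exists 0. intros A [].
    - destruct IH as [M HM]; [now intros B HB; apply Hl; right|].
      destruct (Hl A (or_introl eq_refl)) as [_ [M' HM']].
      exists (Rmax M M'). intros B [<-|HB] z Hz.
      + eapply Rle_trans; [now apply HM'|apply Rmax_r].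
      + eapply Rle_trans; [now apply (HM B)|apply Rmax_l]. }
  destruct HM as [M HM]. exists M. intros z Hz.
  destruct (Hcov z Hz) as [A [HA Az]]. now apply (HM A).
Qed.

Lemma compactC_subset_disk K : compactC K -> exists r, 0 <= r /\ forall z, K z -> disk r z.
Proof.
intros HK. destruct (compactC_bounded K Cmod HK) as [M HM].
- intros z. exists 1. split; [lra|]. intros w Hw.
  replace w with ((w - z) + z)%C by ring. eapply Rle_lt_trans; [apply Cmod_triangle|].
  replace (w - z + z - z)%C with (w - z)%C by ring. lra.
- exists (Rmax 0 M); split; [apply Rmax_l|]. intros z Hz.
  eapply Rle_trans; [now apply HM|apply Rmax_r].
Qed.

Definition bounded_on (f : C -> C) (r M : R) : Prop := forall z, disk r z -> Cmod (f z) <= M.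

Lemma Cmod_triangle_inv (x y : C) : Cmod x <= Cmod y + Cmod (x - y).
Proof.
replace x with (y + (x - y))%C at 1 by ring. apply Cmod_triangle.
Qed.

Lemma entire_bounded_on f r : entire f -> exists M, 0 <= M /\ bounded_on f r M.
Proof.
intros Hf. destruct (compactC_bounded (disk r) (fun z => Cmod (f z)) (compactC_disk r)) as [M HM].
- intros z. destruct (cderiv_continuous _ _ _ (entire_diff f z Hf) 1 Rlt_0_1) as [d [Hd H]].
  exists d; split; [exact Hd|]. intros w Hw.
  assert (T := Cmod_triangle_inv (f w) (f z)). specialize (H w Hw). lra.
- exists (Rmax 0 M); split; [apply Rmax_l|]. intros z Hz.
  eapply Rle_trans; [now apply HM|apply Rmax_r].
Qed.

(** * Locally uniform limits of entire functions *)

Lemma Cmod_plus_le (x y : C) a b : Cmod x <= a -> Cmod y <= b -> Cmod (x + y) <= a + b.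
Proof. intros H1 H2. eapply Rle_trans; [apply Cmod_triangle|lra]. Qed.

Lemma Cmod_minus_le (x y : C) a b : Cmod x <= a -> Cmod y <= b -> Cmod (x - y) <= a + b.
Proof. intros H1 H2. apply Cmod_plus_le; [exact H1|now rewrite Cmod_opp]. Qed.

Lemma cauchy_disk f r s M : entire f -> 0 < s -> bounded_on f (r + s) M ->
  bounded_on (C_derive f) r (2 * M / s).
Proof.
intros Hf Hs HM z Hz. apply (cauchy_estimate f z s M Hf Hs).
intros w Hw. apply HM. unfold disk in *.
replace w with (z + (w - z))%C by ring. now apply Cmod_plus_le.
Qed.

Lemma derivable_fst_line g t l : cderiv g (RtoC t) l ->
  derivable_pt_lim (fun s => fst (g (RtoC s))) t (fst l).
Proof.
intros H eps He. destruct (H (eps / 2) ltac:(lra)) as [d [Hd H']].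
exists (mkposreal d Hd). intros h Hh Hhd; simpl in Hhd.
assert (E : Cmod (g (RtoC (t + h)) - g (RtoC t) - l * RtoC h)%C <= eps / 2 * Rabs h).
{ specialize (H' (RtoC (t + h))).
  replace (RtoC (t + h) - RtoC t)%C with (RtoC h) in H' by (rewrite RtoC_plus; ring).
  rewrite Cmod_R in H'. now apply H'. }
assert (F := Rle_trans _ _ _ (Cmod_fst _) E). simpl in F.
replace ((fst (g (RtoC (t + h))) - fst (g (RtoC t))) / h - fst l)
  with ((fst (g (RtoC (t + h))) + - fst (g (RtoC t)) + - (fst l * h - snd l * 0)) / h)
  by (field; exact Hh).
unfold Rdiv. rewrite Rabs_mult, Rabs_inv.
apply Rle_lt_trans with (eps / 2 * Rabs h * / Rabs h).
- apply Rmult_le_compat_r; [|exact F]. left. now apply Rinv_0_lt_compat, Rabs_pos_lt.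
- rewrite Rmult_assoc, Rinv_r, Rmult_1_r by now apply Rabs_no_R0. lra.
Qed.

(** The complex mean value inequality, with a real majorant [beta] along the
    segment; rotating the increment to the positive real axis reduces it to the
    real mean value theorem. *)
Lemma mean_value_majorant f z h (beta dbeta : R -> R) : entire f ->
  (forall t, 0 <= t <= 1 -> derivable_pt_lim beta t (dbeta t)) ->
  (forall t, 0 <= t <= 1 -> Cmod (C_derive f (z + RtoC t * h)%C) * Cmod h <= dbeta t) ->
  Cmod (f (z + h)%C - f z) <= beta 1 - beta 0.
Proof.
intros Hf Hb Hle.
destruct (rotate_to_real (f (z + h) - f z)%C) as [zeta [Hz Hrot]].
set (g := fun w => (zeta * f (w * h + z))%C).
assert (Hg : forall w, cderiv g w (zeta * (C_derive f (w * h + z) * h))%C).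
{ intros w. apply cderiv_scal. apply (cderiv_comp f (fun w => w * h + z)%C).
  - apply entire_diff, Hf.
  - apply (cderiv_ext (fun w => h * w + z)%C); [intros; ring|apply cderiv_affine]. }
destruct (MVT_cor2 (fun t => fst (g (RtoC t)) - beta t)
  (fun t => fst (zeta * (C_derive f (RtoC t * h + z) * h))%C - dbeta t) 0 1 Rlt_0_1) as [c [Hc1 Hc2]].
- intros t Ht. apply derivable_pt_lim_minus; [|now apply Hb].
  apply derivable_fst_line, Hg.
- assert (E1 : fst (g (RtoC 1)) - fst (g (RtoC 0)) = Cmod (f (z + h)%C - f z)).
  { change (fst (g (RtoC 1) - g (RtoC 0))%C = Cmod (f (z + h)%C - f z)).
    replace (g (RtoC 1) - g (RtoC 0))%C with (zeta * (f (z + h) - f z))%C.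
    - rewrite Hrot. reflexivity.
    - unfold g. replace (1 * h + z)%C with (z + h)%C by ring.
      replace (0 * h + z)%C with z by ring. ring. }
  assert (E2 : fst (zeta * (C_derive f (RtoC c * h + z) * h))%C <= dbeta c).
  { eapply Rle_trans; [apply Rle_abs|]. eapply Rle_trans; [apply Cmod_fst|].
    rewrite !Cmod_mult, Hz, Rmult_1_l. rewrite Cplus_comm. apply Hle. lra. }
  nra.
Qed.

Lemma segment_in_disk r z h t : disk r z -> disk r (z + h)%C -> 0 <= t <= 1 ->
  disk r (z + RtoC t * h)%C.
Proof.
unfold disk. intros H1 H2 Ht.
replace (z + RtoC t * h)%C with (RtoC (1 - t) * z + RtoC t * (z + h))%C.
- eapply Rle_trans; [apply Cmod_triangle|]. rewrite !Cmod_mult, !Cmod_R, !Rabs_pos_eq by lra.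
  assert ((1 - t) * Cmod z <= (1 - t) * r) by (apply Rmult_le_compat_l; lra).
  assert (t * Cmod (z + h) <= t * r) by (apply Rmult_le_compat_l; lra). lra.
- rewrite RtoC_minus. ring.
Qed.

Lemma mean_value_disk f r B z h : entire f -> bounded_on (C_derive f) r B ->
  disk r z -> disk r (z + h)%C -> Cmod (f (z + h)%C - f z) <= B * Cmod h.
Proof.
intros Hf HB Hz Hzh.
replace (B * Cmod h) with (B * Cmod h * 1 - B * Cmod h * 0) by ring.
apply (mean_value_majorant f z h (fun t => B * Cmod h * t) (fun _ => B * Cmod h * 1) Hf).
- intros t _. apply derivable_pt_lim_scal, derivable_pt_lim_id.
- intros t Ht. rewrite Rmult_1_r. apply Rmult_le_compat_r; [apply Cmod_ge_0|].
  now apply HB, segment_in_disk.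
Qed.

(** Cauchy's estimate for [f (. + h) - f] makes [f'] locally Lipschitz, with a
    constant depending only on a bound for [f]. *)
Lemma second_order_remainder f r M z h : entire f -> bounded_on f (r + 3) M ->
  disk r z -> Cmod h <= 1 ->
  Cmod (f (z + h)%C - f z - C_derive f z * h) <= 4 * M * (Cmod h * Cmod h).
Proof.
intros Hf HM Hz Hh.
assert (H1 : bounded_on (C_derive f) (r + 2) (2 * M)).
{ replace (2 * M) with (2 * M / 1) by field. apply cauchy_disk; [exact Hf|lra|].
  now replace (r + 2 + 1) with (r + 3) by ring. }
assert (H2 : forall k, Cmod k <= 1 ->
  Cmod (C_derive f (z + k)%C - C_derive f z) <= 4 * M * Cmod k).
{ intros k Hk.
  set (g := fun w => (f (w + k) - f w)%C).
  assert (Hg : forall w, cderiv g w (C_derive f (w + k) - C_derive f w)%C).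
  { intros w. apply (cderiv_minus (fun w => f (w + k)%C)).
    - apply cderiv_translate, entire_diff, Hf.
    - apply entire_diff, Hf. }
  rewrite <- (C_derive_eq _ _ _ (Hg z)).
  replace (4 * M * Cmod k) with (2 * (2 * M * Cmod k) / 1) by field.
  apply (cauchy_disk g r 1); [exact (entire_cderiv _ _ Hg)|lra| |exact Hz].
  intros w Hw. apply (mean_value_disk f (r + 2)); [exact Hf|exact H1| |];
    unfold disk in *; [lra|]. replace (r + 2) with (r + 1 + 1) by ring. now apply Cmod_plus_le. }
set (g := fun k => (f (z + k) - C_derive f z * k)%C).
assert (Hg : forall k, cderiv g k (C_derive f (z + k) - C_derive f z)%C).
{ intros k. apply (cderiv_minus (fun k => f (z + k)%C)).
  - apply (cderiv_ext (fun k => f (k + z)%C)); [intros; now rewrite Cplus_comm|].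
    apply cderiv_translate. rewrite Cplus_comm. apply entire_diff, Hf.
  - apply (cderiv_ext (fun k => C_derive f z * k + 0)%C); [intros; ring|apply cderiv_affine]. }
replace (f (z + h) - f z - C_derive f z * h)%C with (g (0 + h) - g 0)%C.
2:{ unfold g. rewrite !Cplus_0_l, Cplus_0_r. ring. }
rewrite <- Rmult_assoc.
apply (mean_value_disk g (Cmod h)); [exact (entire_cderiv _ _ Hg)| | |].
- intros k Hk. rewrite (C_derive_eq _ _ _ (Hg k)). unfold disk in Hk.
  assert (HM0 : 0 <= M).
  { eapply Rle_trans; [apply Cmod_ge_0|apply (HM z)]. unfold disk in *; lra. }
  eapply Rle_trans; [apply H2; lra|].
  apply Rmult_le_compat_l; lra.
- unfold disk. rewrite Cmod_0. apply Cmod_ge_0.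
- unfold disk. rewrite Cplus_0_l. lra.
Qed.

Definition lu_cvg (u : nat -> C -> C) (g : C -> C) : Prop :=
  forall r eps, 0 < eps -> exists N, forall n, (N <= n)%nat ->
    bounded_on (fun z => u n z - g z)%C r eps.

Definition C_cvg (u : nat -> C) (l : C) : Prop :=
  forall eps, 0 < eps -> exists N, forall n, (N <= n)%nat -> Cmod (u n - l) <= eps.

Lemma C_complete (u : nat -> C) :
  (forall eps, 0 < eps -> exists N, forall n m, (N <= n)%nat -> (N <= m)%nat ->
     Cmod (u n - u m) <= eps) -> exists l, C_cvg u l.
Proof.
intros H.
assert (Hfst : Cauchy_crit (fun n => fst (u n))).
{ intros eps He. destruct (H (eps / 2) ltac:(lra)) as [N HN]. exists N. intros n m Hn Hm.
  eapply Rle_lt_trans; [apply (Cmod_fst (u n - u m)%C)|].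
  eapply Rle_lt_trans; [now apply HN|lra]. }
assert (Hsnd : Cauchy_crit (fun n => snd (u n))).
{ intros eps He. destruct (H (eps / 2) ltac:(lra)) as [N HN]. exists N. intros n m Hn Hm.
  eapply Rle_lt_trans; [apply (Cmod_snd (u n - u m)%C)|].
  eapply Rle_lt_trans; [now apply HN|lra]. }
destruct (Rcomplete.R_complete _ Hfst) as [a Ha]. destruct (Rcomplete.R_complete _ Hsnd) as [b Hb].
exists (a, b). intros eps He.
destruct (Ha (eps / 2) ltac:(lra)) as [N1 H1].
destruct (Hb (eps / 2) ltac:(lra)) as [N2 H2].
exists (max N1 N2). intros n Hn.
specialize (H1 n ltac:(lia)). specialize (H2 n ltac:(lia)).
unfold Rdist in *.
eapply Rle_trans; [apply (Cmod_le_abs (fst (u n) - a) (snd (u n) - b))|lra].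
Qed.

Lemma C_cvg_bound u l M N : C_cvg u l -> (forall n, (N <= n)%nat -> Cmod (u n) <= M) ->
  Cmod l <= M.
Proof.
intros H HM. apply le_epsilon; intros eps He.
destruct (H eps He) as [K HK]. specialize (HK (max N K) ltac:(lia)).
specialize (HM (max N K) ltac:(lia)).
rewrite Cmod_minus_sym in HK.
assert (T := Cmod_triangle_inv l (u (max N K))). lra.
Qed.

Lemma C_cvg_unique u l m : C_cvg u l -> C_cvg u m -> l = m.
Proof.
intros H1 H2. assert (E : Cmod (l - m) <= 0).
{ apply le_epsilon; intros eps He.
  destruct (H1 (eps / 2) ltac:(lra)) as [K1 HK1]. destruct (H2 (eps / 2) ltac:(lra)) as [K2 HK2].
  specialize (HK1 (max K1 K2) ltac:(lia)). specialize (HK2 (max K1 K2) ltac:(lia)).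
  replace (l - m)%C with ((u (max K1 K2) - m) - (u (max K1 K2) - l))%C by ring.
  eapply Rle_trans; [apply Cmod_minus_le; [exact HK2|exact HK1]|lra]. }
assert (Z : (l - m = 0)%C) by (apply Cmod_eq_0, Rle_antisym; [exact E|apply Cmod_ge_0]).
replace l with ((l - m) + m)%C by ring. rewrite Z. ring.
Qed.

Lemma C_cvg_ext u v l : (forall n, u n = v n) -> C_cvg u l -> C_cvg v l.
Proof.
intros E H eps He. destruct (H eps He) as [N HN]. exists N. intros n Hn.
rewrite <- E. now apply HN.
Qed.

Lemma C_cvg_const l : C_cvg (fun _ => l) l.
Proof.
intros eps He. exists 0%nat. intros n _.
replace (l - l)%C with (RtoC 0) by ring. rewrite Cmod_0. lra.
Qed.

Lemma C_cvg_plus u v l m : C_cvg u l -> C_cvg v m -> C_cvg (fun n => u n + v n)%C (l + m)%C.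
Proof.
intros H1 H2 eps He.
destruct (H1 (eps / 2) ltac:(lra)) as [K1 HK1]. destruct (H2 (eps / 2) ltac:(lra)) as [K2 HK2].
exists (max K1 K2). intros n Hn.
specialize (HK1 n ltac:(lia)). specialize (HK2 n ltac:(lia)).
replace (u n + v n - (l + m))%C with ((u n - l) + (v n - m))%C by ring.
eapply Rle_trans; [apply Cmod_plus_le; [exact HK1|exact HK2]|lra].
Qed.

Lemma C_cvg_scal c u l : C_cvg u l -> C_cvg (fun n => c * u n)%C (c * l)%C.
Proof.
intros H eps He. assert (Hc := Cmod_ge_0 c).
destruct (H (eps / (Cmod c + 1))) as [N HN]; [apply Rdiv_lt_0_compat; lra|].
exists N. intros n Hn. specialize (HN n Hn).
replace (c * u n - c * l)%C with (c * (u n - l))%C by ring. rewrite Cmod_mult.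
apply Rle_trans with ((Cmod c + 1) * (eps / (Cmod c + 1))).
- apply Rmult_le_compat; try apply Cmod_ge_0; lra.
- right; field; lra.
Qed.

Lemma lu_cvg_pointwise u g z : lu_cvg u g -> C_cvg (fun n => u n z) (g z).
Proof.
intros H eps He. destruct (H (Cmod z) eps He) as [N HN]. exists N. intros n Hn.
apply (HN n Hn z). apply Rle_refl.
Qed.

Lemma lu_complete (u : nat -> C -> C) :
  (forall r eps, 0 < eps -> exists N, forall n m, (N <= n)%nat -> (N <= m)%nat ->
     bounded_on (fun z => u n z - u m z)%C r eps) ->
  exists g, lu_cvg u g.
Proof.
intros H.
assert (Hpt : forall z, exists l, C_cvg (fun n => u n z) l).
{ intros z. apply C_complete. intros eps He. destruct (H (Cmod z) eps He) as [N HN].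
  exists N. intros n m Hn Hm. apply (HN n m Hn Hm z), Rle_refl. }
exists (fun z => proj1_sig (constructive_indefinite_description _ (Hpt z))).
intros r eps He. destruct (H r eps He) as [N HN]. exists N. intros n Hn z Hz.
destruct (constructive_indefinite_description _ (Hpt z)) as [l Hl]; simpl.
apply (C_cvg_bound (fun m => u n z - u m z)%C _ _ N).
- apply (C_cvg_ext (fun m => u n z + - (1) * u m z)%C); [intros; ring|].
  replace (u n z - l)%C with (u n z + - (1) * l)%C by ring.
  apply C_cvg_plus; [apply C_cvg_const|now apply C_cvg_scal].
- intros m Hm. now apply HN.
Qed.

Lemma entire_minus f g : entire f -> entire g -> entire (fun z => f z - g z)%C.
Proof.
intros Hf Hg. apply (entire_cderiv _ (fun z => C_derive f z - C_derive g z)%C).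
intros z. apply cderiv_minus; now apply entire_diff.
Qed.

Lemma C_derive_minus f g z : entire f -> entire g ->
  C_derive (fun z => f z - g z)%C z = (C_derive f z - C_derive g z)%C.
Proof. intros Hf Hg. apply C_derive_eq, cderiv_minus; now apply entire_diff. Qed.

Lemma cauchy_disk_minus f g r eps : entire f -> entire g ->
  bounded_on (fun z => f z - g z)%C (r + 1) eps ->
  bounded_on (fun z => C_derive f z - C_derive g z)%C r (2 * eps).
Proof.
intros Hf Hg H z Hz. rewrite <- C_derive_minus by assumption.
replace (2 * eps) with (2 * eps / 1) by field.
apply (cauchy_disk _ r 1); [now apply entire_minus|lra|exact H|exact Hz].
Qed.

(** The remainder estimate [second_order_remainder] is uniform along the
    sequence, so it survives in the limit and identifies the limit of the
    derivatives as the derivative of the limit. *)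
Theorem weierstrass (u : nat -> C -> C) g : (forall n, entire (u n)) -> lu_cvg u g ->
  entire g /\ lu_cvg (fun n => C_derive (u n)) (C_derive g).
Proof.
intros Hu Hg.
destruct (lu_complete (fun n => C_derive (u n))) as [g' Hg'].
{ intros r eps He. destruct (Hg (r + 1) (eps / 4) ltac:(lra)) as [N HN].
  exists N. intros n m Hn Hm. replace eps with (2 * (eps / 2)) by field.
  apply cauchy_disk_minus; [apply Hu|apply Hu|]. intros z Hz.
  replace (u n z - u m z)%C with ((u n z - g z) - (u m z - g z))%C by ring.
  replace (eps / 2) with (eps / 4 + eps / 4) by field.
  apply Cmod_minus_le; [now apply (HN n Hn)|now apply (HN m Hm)]. }
assert (Hd : forall z, cderiv g z (g' z)).
{ intros z. set (r := Cmod z).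
  destruct (Hg (r + 3) 1 Rlt_0_1) as [N HN].
  destruct (entire_bounded_on (u N) (r + 3) (Hu N)) as [M [HM0 HM]].
  assert (HB : forall n, (N <= n)%nat -> bounded_on (u n) (r + 3) (M + 2)).
  { intros n Hn w Hw. replace (u n w) with (u N w + ((u n w - g w) - (u N w - g w)))%C by ring.
    replace (M + 2) with (M + (1 + 1)) by ring.
    apply Cmod_plus_le; [now apply HM|]. apply Cmod_minus_le; [now apply (HN n Hn)|now apply (HN N)]. }
  assert (HQ : forall h, Cmod h <= 1 -> Cmod (g (z + h)%C - g z - g' z * h) <= 4 * (M + 2) * (Cmod h * Cmod h)).
  { intros h Hh.
    apply (C_cvg_bound (fun n => u n (z + h) - u n z - C_derive (u n) z * h)%C _ _ N).
    - apply (C_cvg_ext (fun n => u n (z + h) + - (1) * u n z + - h * C_derive (u n) z)%C); [intros; ring|].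
      replace (g (z + h) - g z - g' z * h)%C with (g (z + h) + - (1) * g z + - h * g' z)%C by ring.
      apply C_cvg_plus; [apply C_cvg_plus|]; [|apply C_cvg_scal|apply C_cvg_scal].
      + now apply lu_cvg_pointwise.
      + now apply lu_cvg_pointwise.
      + now apply (lu_cvg_pointwise (fun n => C_derive (u n))).
    - intros n Hn. apply second_order_remainder with r; [apply Hu|now apply HB|apply Rle_refl|exact Hh]. }
  intros eps He. exists (Rmin 1 (eps / (4 * (M + 2)))); split.
  { apply Rmin_pos; [lra|apply Rdiv_lt_0_compat; lra]. }
  intros w Hw. specialize (HQ (w - z)%C).
  replace (z + (w - z))%C with w in HQ by ring.
  assert (Hw1 := Rlt_le_trans _ _ _ Hw (Rmin_l _ _)).
  assert (Hw2 := Rlt_le_trans _ _ _ Hw (Rmin_r _ _)).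
  eapply Rle_trans; [apply HQ; lra|].
  rewrite <- Rmult_assoc. apply Rmult_le_compat_r; [apply Cmod_ge_0|].
  apply Rle_trans with (4 * (M + 2) * (eps / (4 * (M + 2)))).
  - apply Rmult_le_compat_l; lra.
  - right; field; lra. }
split; [exact (entire_cderiv _ _ Hd)|].
intros r eps He. destruct (Hg' r eps He) as [N HN]. exists N. intros n Hn z Hz.
rewrite (C_derive_eq _ _ _ (Hd z)). now apply HN.
Qed.

(** The difference quotients [n (f (z + 1/n) - f z)] converge to [f'] locally
    uniformly. *)
Theorem entire_C_derive f : entire f -> entire (C_derive f).
Proof.
intros Hf.
set (u := fun (n : nat) z => (RtoC (INR (S n)) * (f (z + RtoC (/ INR (S n))) - f z))%C).
apply (weierstrass u).
- intros n. apply (entire_cderiv _ (fun z => RtoC (INR (S n)) *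
    (C_derive f (z + RtoC (/ INR (S n))) - C_derive f z))%C).
  intros z. apply cderiv_scal, (cderiv_minus (fun z => f (z + RtoC (/ INR (S n)))%C)).
  + apply cderiv_translate, entire_diff, Hf.
  + apply entire_diff, Hf.
- intros r eps He.
  destruct (entire_bounded_on f (r + 3) Hf) as [M [HM0 HM]].
  destruct (INR_unbounded (4 * M / eps)) as [N HN].
  exists N. intros n Hn z Hz. unfold u.
  assert (HSn : 1 <= INR (S n)) by (rewrite S_INR; assert (T := pos_INR n); lra).
  set (k := INR (S n)) in *.
  assert (Hk : 4 * M / eps <= k).
  { unfold k. rewrite S_INR. apply le_INR in Hn. lra. }
  assert (Hck : RtoC k <> 0%C) by (intros E; injection E; lra).
  assert (Hm : Cmod (RtoC (/ k)) = / k).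
  { rewrite Cmod_R. apply Rabs_pos_eq. left. apply Rinv_0_lt_compat. lra. }
  replace (RtoC k * (f (z + RtoC (/ k)) - f z) - C_derive f z)%C with
    (RtoC k * (f (z + RtoC (/ k)) - f z - C_derive f z * RtoC (/ k)))%C.
  2:{ rewrite RtoC_inv by lra. field. exact Hck. }
  rewrite Cmod_mult, Cmod_R, (Rabs_pos_eq k) by lra.
  apply Rle_trans with (k * (4 * M * (/ k * / k))).
  + apply Rmult_le_compat_l; [lra|].
    replace (/ k * / k) with (Cmod (RtoC (/ k)) * Cmod (RtoC (/ k))) by now rewrite Hm.
    apply second_order_remainder with r; [exact Hf|exact HM|exact Hz|].
    rewrite Hm. rewrite <- Rinv_1. apply Rinv_le_contravar; lra.
  + replace (k * (4 * M * (/ k * / k))) with (4 * M / k) by (field; lra).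
    apply Rmult_le_reg_r with k; [lra|].
    replace (4 * M / k * k) with (4 * M / eps * eps) by (field; lra).
    rewrite (Rmult_comm eps k). apply Rmult_le_compat_r; lra.
Qed.

(** * Higher derivatives, Taylor expansion and polynomials *)

Definition HC_D (f : HC) : HC := mkHC (C_derive f) (entire_C_derive f (HC_entire f)).

Definition Dn (k : nat) (f : HC) : HC := Nat.iter k HC_D f.

Lemma HC_D_eq (f g : HC) : (forall z, cderiv f z (g z)) -> HC_D f = g.
Proof. intros H. apply HC_ext. intros z. apply C_derive_eq, H. Qed.

Lemma cderiv_D (f : HC) z : cderiv f z (HC_D f z).
Proof. apply cderiv_HC. Qed.

Lemma HC_D_linear : HC_linear HC_D.
Proof.
split.
- intros f g. apply HC_D_eq. intros z. apply cderiv_plus; apply cderiv_D.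
- intros c f. apply HC_D_eq. intros z. apply cderiv_scal, cderiv_D.
Qed.

Lemma HC_scal_0 (f : HC) : HC_scal 0 f = HC_zero.
Proof. apply HC_ext. intros z. simpl. ring. Qed.

Lemma HC_linear_zero L : HC_linear L -> L HC_zero = HC_zero.
Proof.
intros [_ H]. transitivity (L (HC_scal 0 HC_zero)); [now rewrite HC_scal_0|].
rewrite H. apply HC_scal_0.
Qed.

Lemma HC_linear_iter L n : HC_linear L -> HC_linear (Nat.iter n L).
Proof.
intros [Hp Hs]. induction n as [|n [IHp IHs]]; split; intros; simpl; try reflexivity.
- now rewrite IHp, Hp.
- now rewrite IHs, Hs.
Qed.

Lemma Dn_linear k : HC_linear (Dn k).
Proof. apply HC_linear_iter, HC_D_linear. Qed.

Lemma iter_shift (A : Type) (F : A -> A) n x : Nat.iter n F (F x) = F (Nat.iter n F x).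
Proof. symmetry. apply (Nat.iter_succ_r n). Qed.

Fixpoint csum (a : nat -> C) (n : nat) : C :=
  match n with O => RtoC 0 | S m => Cplus (csum a m) (a m) end.

Fixpoint hsum (F : nat -> HC) (n : nat) : HC :=
  match n with O => HC_zero | S m => HC_plus (hsum F m) (F m) end.

Lemma hsum_csum F n z : hsum F n z = csum (fun i => F i z) n.
Proof. induction n as [|n IH]; [reflexivity|]. simpl. now rewrite IH. Qed.

Lemma csum_ext a b n : (forall i, (i < n)%nat -> a i = b i) -> csum a n = csum b n.
Proof.
intros H. induction n as [|n IH]; [reflexivity|]. simpl.
rewrite IH by (intros; apply H; lia). now rewrite H by lia.
Qed.

Lemma csum_bound a b n : (forall i, (i < n)%nat -> Cmod (a i) <= b) -> Cmod (csum a n) <= INR n * b.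
Proof.
intros H. induction n as [|n IH].
- simpl. rewrite Cmod_0. lra.
- rewrite S_INR, Rmult_plus_distr_r, Rmult_1_l. simpl.
  apply Cmod_plus_le; [apply IH; intros; apply H; lia|apply H; lia].
Qed.

Lemma csum_plus a b n : csum (fun i => a i + b i)%C n = (csum a n + csum b n)%C.
Proof. induction n as [|n IH]; simpl; [ring|]. rewrite IH. ring. Qed.

Lemma csum_scal c a n : csum (fun i => c * a i)%C n = (c * csum a n)%C.
Proof. induction n as [|n IH]; simpl; [ring|]. rewrite IH. ring. Qed.

Lemma csum_zero a n : (forall i, (i < n)%nat -> a i = RtoC 0) -> csum a n = RtoC 0.
Proof.
intros H. induction n as [|n IH]; [reflexivity|]. simpl.
rewrite IH by (intros; apply H; lia). rewrite H by lia. ring.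
Qed.

Lemma csum_one_term a n j : (j < n)%nat -> (forall i, (i < n)%nat -> i <> j -> a i = RtoC 0) ->
  csum a n = a j.
Proof.
intros Hj H. induction n as [|n IH]; [lia|]. simpl.
destruct (Nat.eq_dec j n) as [->|Hn].
- rewrite csum_zero by (intros; apply H; lia). ring.
- rewrite IH by (lia || (intros; apply H; lia)). rewrite (H n) by lia. ring.
Qed.

Lemma csum_split a n m : csum a (n + m) = (csum a n + csum (fun i => a (n + i)%nat) m)%C.
Proof.
induction m as [|m IH]; [rewrite Nat.add_0_r; simpl; ring|].
rewrite Nat.add_succ_r. simpl. rewrite IH. ring.
Qed.

Lemma csum_head a n : csum a (S n) = (a 0%nat + csum (fun i => a (S i)) n)%C.
Proof. change (S n) with (1 + n)%nat. rewrite csum_split. simpl. ring. Qed.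

Lemma linear_hsum L F n : HC_linear L -> L (hsum F n) = hsum (fun i => L (F i)) n.
Proof.
intros HL. induction n as [|n IH]; simpl.
- now apply HC_linear_zero.
- destruct HL as [Hp _]. now rewrite Hp, IH.
Qed.

Lemma cauchy_iter (f : HC) r s M k : 0 < s -> bounded_on f (r + INR k * s) M ->
  bounded_on (Dn k f) r (M * (2 / s) ^ k).
Proof.
intros Hs. revert r. induction k as [|k IH]; intros r H.
- simpl. rewrite Rmult_1_r. now replace (r + INR 0 * s) with r in H by (simpl; ring).
- replace (M * (2 / s) ^ S k) with (2 * (M * (2 / s) ^ k) / s) by (simpl; field; lra).
  apply (cauchy_disk (Dn k f)); [apply HC_entire|exact Hs|]. apply IH.
  rewrite S_INR in H. now replace (r + s + INR k * s) with (r + (INR k + 1) * s) by ring.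
Qed.

Lemma exp_pow x n : exp x ^ n = exp (INR n * x).
Proof.
induction n as [|n IH]; [simpl; now rewrite Rmult_0_l, exp_0|].
rewrite S_INR. simpl. rewrite IH, <- exp_plus. f_equal. ring.
Qed.

Lemma pow_self_le_fact k : INR k ^ k <= 3 ^ k * INR (fact k).
Proof.
destruct k as [|k]; [simpl; lra|].
induction k as [|k IH]; [simpl; lra|].
set (x := INR (S k)) in *.
assert (Hx : 0 < x) by (apply lt_0_INR; lia).
assert (E : INR (S (S k)) = x * (1 + / x)) by (rewrite S_INR; fold x; field; lra).
assert (Hexp : (1 + / x) ^ S k <= 3).
{ apply Rle_trans with (exp (/ x) ^ S k).
  - apply pow_incr. assert (0 < / x) by now apply Rinv_0_lt_compat.
    split; [lra|]. apply exp_ineq1_le.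
  - rewrite exp_pow. fold x. replace (x * / x) with 1 by (field; lra).
    apply exp_le_3. }
rewrite fact_simpl, mult_INR.
change (INR (S (S k)) ^ S (S k)) with (INR (S (S k)) * INR (S (S k)) ^ S k).
change (3 ^ S (S k)) with (3 * 3 ^ S k).
replace (INR (S (S k)) ^ S k) with (x ^ S k * (1 + / x) ^ S k) by (rewrite E; now rewrite Rpow_mult_distr).
assert (H0 : 0 < INR (S (S k))) by (apply lt_0_INR; lia).
replace (3 * 3 ^ S k * (INR (S (S k)) * INR (fact (S k)))) with
  (INR (S (S k)) * ((3 ^ S k * INR (fact (S k))) * 3)) by ring.
apply Rmult_le_compat_l; [lra|].
apply Rmult_le_compat; [apply pow_le; lra| |exact IH|exact Hexp].
apply pow_le. assert (0 < / x) by now apply Rinv_0_lt_compat. lra.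
Qed.

(** Cauchy's estimates up to a geometric factor: reaching distance [rho] in [k]
    equal steps gives [(2 k / rho)^k], and [k^k <= 3^k k!]. For entire functions
    [rho] is arbitrary and the geometric loss is harmless. *)
Lemma cauchy_factorial (f : HC) r rho M k : 0 < rho -> 0 <= M -> bounded_on f (r + rho) M ->
  bounded_on (Dn k f) r (M * INR (fact k) * (6 / rho) ^ k).
Proof.
intros Hr HM0 HM. destruct k as [|k].
- simpl. intros z Hz. replace (M * 1 * 1) with M by ring. apply HM. unfold disk in *; lra.
- assert (Hk : 0 < INR (S k)) by (apply lt_0_INR; lia).
  intros z Hz. eapply Rle_trans.
  + apply (cauchy_iter f r (rho / INR (S k)) M (S k)); [apply Rdiv_lt_0_compat; lra| |exact Hz].
    now replace (INR (S k) * (rho / INR (S k))) with rho by (field; lra).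
  + rewrite Rmult_assoc. apply Rmult_le_compat_l; [exact HM0|].
    replace (2 / (rho / INR (S k))) with (2 / rho * INR (S k)) by (field; lra).
    replace (6 / rho) with (2 / rho * 3) by (field; lra).
    rewrite !Rpow_mult_distr.
    replace (INR (fact (S k)) * ((2 / rho) ^ S k * 3 ^ S k)) with
      ((2 / rho) ^ S k * (3 ^ S k * INR (fact (S k)))) by ring.
    apply Rmult_le_compat_l; [apply pow_le; left; apply Rdiv_lt_0_compat; lra|apply pow_self_le_fact].
Qed.

Lemma cderiv_pow c n z :
  cderiv (fun w => (w - c) ^ S n)%C z (RtoC (INR (S n)) * (z - c) ^ n)%C.
Proof.
assert (H1 : cderiv (fun w => w - c)%C z 1%C).
{ apply (cderiv_ext (fun w => 1 * w + - c)%C); [intros; ring|apply cderiv_affine]. }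
induction n as [|n IH].
- apply (cderiv_ext (fun w => w - c)%C).
  + intros w. simpl. ring.
  + apply (cderiv_eq _ _ 1%C); [exact H1|simpl; ring].
- apply (cderiv_eq _ _ (1 * (z - c) ^ S n + (z - c) * (RtoC (INR (S n)) * (z - c) ^ n))%C).
  + exact (cderiv_mult (fun w => w - c)%C (fun w => (w - c) ^ S n)%C z _ _ H1 IH).
  + rewrite (S_INR (S n)), RtoC_plus. simpl. ring.
Qed.

Lemma entire_mono c n : entire (fun z => RtoC (/ INR (fact n)) * (z - c) ^ n)%C.
Proof.
destruct n as [|n].
- apply (entire_cderiv _ (fun _ => RtoC 0)). intros z.
  apply (cderiv_ext (fun _ => RtoC (/ INR (fact 0)) * 1)%C); [reflexivity|apply cderiv_const].
- apply (entire_cderiv _ (fun z => RtoC (/ INR (fact (S n))) * (RtoC (INR (S n)) * (z - c) ^ n))%C).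
  intros z. apply cderiv_scal, cderiv_pow.
Qed.

(** The factor [1 / n!] makes differentiation a shift of the index. *)
Definition Mono (c : C) (n : nat) : HC := mkHC _ (entire_mono c n).

Lemma fact_pos n : 0 < INR (fact n).
Proof. apply lt_0_INR, lt_O_fact. Qed.

Lemma D_Mono_S c n : HC_D (Mono c (S n)) = Mono c n.
Proof.
apply HC_D_eq. intros z.
apply (cderiv_eq _ _ (RtoC (/ INR (fact (S n))) * (RtoC (INR (S n)) * (z - c) ^ n))%C).
- apply cderiv_scal, cderiv_pow.
- simpl HC_fun. rewrite Cmult_assoc, <- RtoC_mult. f_equal. f_equal.
  rewrite fact_simpl, mult_INR. field. split; [apply Rgt_not_eq, fact_pos|].
  apply Rgt_not_eq, lt_0_INR; lia.
Qed.

Lemma D_Mono_0 c : HC_D (Mono c 0) = HC_zero.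
Proof.
apply HC_D_eq. intros z.
apply (cderiv_ext (fun _ => RtoC (/ INR (fact 0)) * 1)%C); [reflexivity|apply cderiv_const].
Qed.

Lemma Dn_Mono c k n : Dn k (Mono c (k + n)) = Mono c n.
Proof.
induction k as [|k IH]; [reflexivity|].
unfold Dn in *. simpl Nat.iter. rewrite <- iter_shift. simpl Nat.add. now rewrite D_Mono_S.
Qed.

Lemma Dn_zero k : Dn k HC_zero = HC_zero.
Proof. apply HC_linear_zero, Dn_linear. Qed.

Lemma Dn_Mono_gt c k n : (n < k)%nat -> Dn k (Mono c n) = HC_zero.
Proof.
intros H. replace k with ((k - S n) + S n)%nat by lia.
unfold Dn. rewrite Nat.iter_add. simpl Nat.iter.
change (Nat.iter n HC_D (Mono c n)) with (Dn n (Mono c n)).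
replace (Mono c n) with (Mono c (n + 0)) at 1 by (f_equal; lia).
rewrite Dn_Mono, D_Mono_0. apply Dn_zero.
Qed.

Lemma Cmod_Mono c n z : Cmod (Mono c n z) = Cmod (z - c) ^ n / INR (fact n).
Proof.
simpl. rewrite Cmod_mult, Cmod_pow, Cmod_R, Rabs_pos_eq.
- unfold Rdiv. ring.
- left. apply Rinv_0_lt_compat, fact_pos.
Qed.

Lemma Mono_center_0 c : Mono c 0 c = RtoC 1.
Proof. simpl. rewrite Rinv_1. ring. Qed.

Definition taylor (c : C) (n : nat) (f : HC) : HC :=
  hsum (fun i => HC_scal (Dn i f c) (Mono c i)) n.

Lemma D_taylor c n f : HC_D (taylor c (S n) f) = taylor c n (HC_D f).
Proof.
unfold taylor. induction n as [|n IH].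
- simpl hsum. rewrite (proj1 HC_D_linear), (proj2 HC_D_linear), D_Mono_0.
  rewrite (HC_linear_zero _ HC_D_linear). apply HC_ext. intros z. simpl. ring.
- change (hsum ?F (S (S n))) with (HC_plus (hsum F (S n)) (F (S n))).
  rewrite (proj1 HC_D_linear), IH. simpl hsum. f_equal.
  rewrite (proj2 HC_D_linear), D_Mono_S. unfold Dn. now rewrite iter_shift.
Qed.

Lemma taylor_center c n f : taylor c (S n) f c = f c.
Proof.
unfold taylor. rewrite hsum_csum, (csum_one_term _ _ 0%nat); [|lia|].
- simpl. rewrite Rinv_1. ring.
- intros [|i] Hi Hn; [lia|]. simpl. ring.
Qed.

(** Only the derivative of order [n] is bounded, along the segment; integrating
    the estimate for [f'] against [t^n] produces the factorial. *)
Theorem taylor_remainder n : forall (f : HC) c h B,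
  (forall t, 0 <= t <= 1 -> Cmod (Dn n f (c + RtoC t * h)%C) <= B) ->
  Cmod (f (c + h)%C - taylor c n f (c + h)%C) <= B * (Cmod h ^ n / INR (fact n)).
Proof.
induction n as [|n IH]; intros f c h B HB.
- specialize (HB 1 ltac:(lra)). simpl in *. rewrite Cmult_1_l in HB.
  replace (f (c + h) - 0)%C with (f (c + h))%C by ring. lra.
- set (g := HC_plus f (HC_scal (- (1)) (taylor c (S n) f))).
  assert (HDg : HC_D g = HC_plus (HC_D f) (HC_scal (- (1)) (taylor c n (HC_D f)))).
  { unfold g. now rewrite (proj1 HC_D_linear), (proj2 HC_D_linear), D_taylor. }
  assert (E : forall z, g z = (f z - taylor c (S n) f z)%C) by (intros z; simpl; ring).
  rewrite <- E.
  replace (g (c + h))%C with (g (c + h) - g c)%C.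
  2:{ rewrite (E c), taylor_center. ring. }
  set (K := B * (Cmod h ^ S n / INR (fact (S n)))).
  replace K with (K * 1 ^ S n - K * 0 ^ S n) by (rewrite pow1; simpl; ring).
  apply (mean_value_majorant g c h (fun t => K * t ^ S n) (fun t => K * (INR (S n) * t ^ n))).
  + apply HC_entire.
  + intros t _. apply derivable_pt_lim_scal, (derivable_pt_lim_pow t (S n)).
  + intros t Ht. change (C_derive g) with (HC_fun (HC_D g)). rewrite HDg.
    replace (HC_plus (HC_D f) (HC_scal (- (1)) (taylor c n (HC_D f))) (c + RtoC t * h)%C)
      with (HC_D f (c + RtoC t * h) - taylor c n (HC_D f) (c + RtoC t * h))%C by (simpl; ring).
    apply Rle_trans with (B * (Cmod (RtoC t * h) ^ n / INR (fact n)) * Cmod h).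
    * apply Rmult_le_compat_r; [apply Cmod_ge_0|]. apply IH. intros s Hs.
      replace (c + RtoC s * (RtoC t * h))%C with (c + RtoC (s * t) * h)%C
        by (rewrite RtoC_mult; ring).
      unfold Dn. rewrite iter_shift. apply HB. split; [apply Rmult_le_pos; lra|].
      rewrite <- (Rmult_1_l 1). apply Rmult_le_compat; lra.
    * right. unfold K. rewrite Cmod_mult, Cmod_R, Rabs_pos_eq, Rpow_mult_distr by lra.
      rewrite fact_simpl, mult_INR. simpl (_ ^ S n). field.
      split; [apply Rgt_not_eq, fact_pos|]. apply Rgt_not_eq, lt_0_INR; lia.
Qed.

Definition near (r eps : R) (f g : HC) : Prop := bounded_on (fun z => g z - f z)%C r eps.

(** With Cauchy's estimates at distance [12 (r + 1)] from the disk, where [|f|] is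
    at most [M], the remainder of order [n] is at most [M 2^-n]. *)
Theorem taylor_cvg (f : HC) r eps : 0 <= r -> 0 < eps -> exists n, near r eps f (taylor 0 n f).
Proof.
intros Hr He. set (rho := 12 * (r + 1)).
assert (Hrho : 0 < rho) by (unfold rho; lra).
destruct (entire_bounded_on f (r + rho) (HC_entire f)) as [M [HM0 HM]].
destruct (pow_lt_1_zero (1 / 2)) with (y := eps / (M + 1)) as [n Hn].
- rewrite Rabs_pos_eq; lra.
- apply Rdiv_lt_0_compat; lra.
- exists n. intros z Hz. specialize (Hn n (Nat.le_refl n)).
  rewrite Rabs_pos_eq in Hn by (apply pow_le; lra).
  rewrite Cmod_minus_sym.
  assert (T := taylor_remainder n f 0 z (M * INR (fact n) * (6 / rho) ^ n)).
  rewrite !Cplus_0_l in T. eapply Rle_trans; [apply T|].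
  + intros t Ht. apply (cauchy_factorial f r rho M n Hrho HM0 HM).
    apply segment_in_disk; [unfold disk; now rewrite Cmod_0|now rewrite Cplus_0_l|exact Ht].
  + replace (M * INR (fact n) * (6 / rho) ^ n * (Cmod z ^ n / INR (fact n)))
      with (M * (6 / rho * Cmod z) ^ n)
      by (rewrite Rpow_mult_distr; field; apply Rgt_not_eq, fact_pos).
    apply Rle_trans with (M * (1 / 2) ^ n).
    * apply Rmult_le_compat_l; [exact HM0|]. apply pow_incr. split.
      -- apply Rmult_le_pos; [left; apply Rdiv_lt_0_compat; lra|apply Cmod_ge_0].
      -- unfold disk in Hz. apply Rle_trans with (6 / rho * (r + 1)).
         ++ apply Rmult_le_compat_l; [left; apply Rdiv_lt_0_compat; lra|lra].
         ++ right. unfold rho. field. lra.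
    * apply Rle_trans with ((M + 1) * (eps / (M + 1))).
      -- apply Rmult_le_compat; [exact HM0|apply pow_le; lra|lra|lra].
      -- right; field; lra.
Qed.

(** Polynomials of degree less than [d] are taken as the kernel of the [d]-th
    derivative, which makes their stability under the operators immediate. *)
Definition is_poly (d : nat) (f : HC) : Prop := Dn d f = HC_zero.

Lemma is_poly_le d e f : (d <= e)%nat -> is_poly d f -> is_poly e f.
Proof.
intros H Hd. unfold is_poly, Dn. replace e with ((e - d) + d)%nat by lia.
rewrite Nat.iter_add. change (Nat.iter d HC_D f) with (Dn d f). rewrite Hd. apply Dn_zero.
Qed.

Lemma is_poly_Mono c n : is_poly (S n) (Mono c n).
Proof. apply Dn_Mono_gt. lia. Qed.

Lemma is_poly_scal d c f : is_poly d f -> is_poly d (HC_scal c f).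
Proof.
unfold is_poly. intros H. rewrite (proj2 (Dn_linear d)), H. apply HC_ext. intros z. simpl. ring.
Qed.

Lemma is_poly_plus d f g : is_poly d f -> is_poly d g -> is_poly d (HC_plus f g).
Proof.
unfold is_poly. intros H1 H2. rewrite (proj1 (Dn_linear d)), H1, H2.
apply HC_ext. intros z. simpl. ring.
Qed.

Lemma is_poly_hsum d F n : (forall i, (i < n)%nat -> is_poly d (F i)) -> is_poly d (hsum F n).
Proof.
intros H. induction n as [|n IH]; [apply Dn_zero|]. simpl.
apply is_poly_plus; [apply IH; intros; apply H; lia|apply H; lia].
Qed.

Lemma is_poly_taylor c n f : is_poly n (taylor c n f).
Proof.
apply is_poly_hsum. intros i Hi. apply is_poly_scal.
apply (is_poly_le (S i)); [lia|apply is_poly_Mono].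
Qed.

(** The Taylor remainder with a vanishing [d]-th derivative. *)
Lemma poly_eq_taylor d p c z : is_poly d p -> p z = taylor c d p z.
Proof.
intros Hp.
assert (T := taylor_remainder d p c (z - c)%C 0).
replace (c + (z - c))%C with z in T by ring. rewrite Rmult_0_l in T.
assert (E : (p z - taylor c d p z = 0)%C).
{ apply Cmod_eq_0, Rle_antisym; [|apply Cmod_ge_0]. apply T. intros t _.
  rewrite Hp. simpl. rewrite Cmod_0. lra. }
replace (p z) with ((p z - taylor c d p z) + taylor c d p z)%C by ring.
rewrite E. ring.
Qed.

(** * The Frechet space H(C): disks, Baire category, uniform boundedness *)

Lemma bounded_on_le f r r' M M' : r' <= r -> M <= M' -> bounded_on f r M -> bounded_on f r' M'.
Proof. intros Hr HM H z Hz. eapply Rle_trans; [apply H|exact HM]. unfold disk in *; lra. Qed.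

Lemma near_le r r' eps eps' f g : r' <= r -> eps <= eps' -> near r eps f g -> near r' eps' f g.
Proof. apply bounded_on_le. Qed.

Lemma near_refl r eps f : 0 <= eps -> near r eps f f.
Proof.
intros He z _. replace (f z - f z)%C with (RtoC 0) by ring. now rewrite Cmod_0.
Qed.

Lemma near_trans r e1 e2 f g h : near r e1 f g -> near r e2 g h -> near r (e1 + e2) f h.
Proof.
intros H1 H2 z Hz. replace (h z - f z)%C with ((g z - f z) + (h z - g z))%C by ring.
apply Cmod_plus_le; [now apply H1|now apply H2].
Qed.

Lemma near_plus_l r eps f (g : HC) : bounded_on g r eps -> near r eps f (HC_plus f g).
Proof.
intros H z Hz. simpl. replace (f z + g z - f z)%C with (g z) by ring. now apply H.
Qed.

Lemma ucc_cvg_lu u g : ucc_cvg u g <-> lu_cvg u g.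
Proof.
split.
- intros H r eps He. destruct (H (disk r) (mkposreal eps He) (compactC_disk r)) as [N HN].
  exists N. intros n Hn z Hz. left. now apply (HN n Hn).
- intros H K eps HK. destruct (compactC_subset_disk K HK) as [r [_ Hr]].
  assert (He := cond_pos eps).
  destruct (H r (eps / 2) ltac:(lra)) as [N HN]. exists N. intros n Hn z Hz.
  eapply Rle_lt_trans; [apply (HN n Hn); now apply Hr|lra].
Qed.

Lemma HC_continuous_disk S : HC_continuous S <->
  forall f r eps, 0 < eps -> exists r' delta, 0 < delta /\
    forall g, near r' delta f g -> near r eps (S f) (S g).
Proof.
split.
- intros H f r eps He.
  destruct (H f (near r eps (S f))) as [K [d [HK Hd]]].
  { exists (disk r), (mkposreal eps He). split; [apply compactC_disk|].
    intros g Hg z Hz. left. now apply Hg. }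
  destruct (compactC_subset_disk K HK) as [r' [_ Hr']].
  assert (Hd0 := cond_pos d).
  exists r', (d / 2). split; [lra|]. intros g Hg. apply Hd. intros z Hz.
  eapply Rle_lt_trans; [now apply Hg, Hr'|lra].
- intros H f P [K [eps [HK HP]]].
  destruct (compactC_subset_disk K HK) as [r [_ Hr]].
  assert (He := cond_pos eps).
  destruct (H f r (eps / 2) ltac:(lra)) as [r' [d [Hd Hg]]].
  exists (disk r'), (mkposreal d Hd). split; [apply compactC_disk|].
  intros g Hng. apply HP. intros z Hz.
  eapply Rle_lt_trans; [apply (Hg g); [|now apply Hr]|lra].
  intros w Hw. left. now apply Hng.
Qed.

Lemma near_closed (u : nat -> HC) (h : HC) r eps (f : HC) N : lu_cvg (fun n => u n) h ->
  (forall n, (N <= n)%nat -> near r eps f (u n)) -> near r eps f h.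
Proof.
intros Hu Hn z Hz. apply (C_cvg_bound (fun n => u n z - f z)%C _ _ N).
- apply (C_cvg_ext (fun n => u n z + - f z)%C); [intros; ring|].
  apply C_cvg_plus; [now apply (lu_cvg_pointwise (fun n => u n))|apply C_cvg_const].
- intros n Hle. now apply (Hn n Hle).
Qed.

(** Baire's theorem. Shrinking successively into the sets [V j] gives nested
    balls [near r delta f] with [r] tending to infinity and [delta] to zero; their
    centres converge locally uniformly, and the limit is entire and lies in every
    ball. *)
Theorem HC_baire (V : nat -> HC -> Prop) :
  (forall j f r delta, 0 < delta -> exists f' r' delta', 0 < delta' /\
     forall g, near r' delta' f' g -> near r delta f g /\ V j g) ->
  exists h, forall j, V j h.
Proof.
intros HV.
set (ball := fun s : HC * (R * R) => near (fst (snd s)) (snd (snd s)) (fst s)).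
destruct (dependent_choice (HC * (R * R))
  (fun n s => 0 < snd (snd s) <= / (INR n + 1) /\ INR n <= fst (snd s))
  (fun n s t => forall g, ball t g -> ball s g /\ V n g)) as [s Hs].
- exists (HC_zero, (0, 1)). simpl. rewrite Rplus_0_l, Rinv_1. lra.
- intros n [f [r d]] [[Hd _] _]; simpl in Hd.
  destruct (HV n f r d Hd) as [f' [r' [d' [Hd' H']]]].
  assert (Hn : 0 < / (INR (S n) + 1)).
  { apply Rinv_0_lt_compat. assert (T := pos_INR (S n)). lra. }
  exists (f', (Rmax r' (INR (S n)), Rmin d' (/ (INR (S n) + 1)))). simpl fst; simpl snd.
  split; [split; [split|]|].
  + now apply Rmin_pos.
  + apply Rmin_r.
  + apply Rmax_r.
  + intros g Hg. apply H'. revert Hg. apply near_le; [apply Rmax_l|apply Rmin_l].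
- assert (Hnest : forall n k g, ball (s (n + k)%nat) g -> ball (s n) g).
  { intros n k g. induction k as [|k IH]; [now rewrite Nat.add_0_r|].
    rewrite Nat.add_succ_r. intros Hg. apply IH. now apply (Hs (n + k)%nat). }
  assert (Hin : forall n m, (n <= m)%nat -> ball (s n) (fst (s m))).
  { intros n m Hnm. apply (Hnest n (m - n)%nat). replace (n + (m - n))%nat with m by lia.
    apply near_refl. destruct (Hs m) as [[[H _] _] _]. lra. }
  destruct (lu_complete (fun n => fst (s n))) as [h Hh].
  { intros r eps He. destruct (INR_unbounded (Rmax r (2 / eps))) as [N HN].
    assert (HN1 : r < INR N) by (eapply Rle_lt_trans; [apply Rmax_l|exact HN]).
    assert (HN2 : 2 / eps < INR N) by (eapply Rle_lt_trans; [apply Rmax_r|exact HN]).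
    destruct (Hs N) as [[[Hd0 Hd] HrN] _].
    assert (Hdeps : snd (snd (s N)) <= eps / 2).
    { eapply Rle_trans; [exact Hd|]. replace (eps / 2) with (/ (2 / eps)) by (field; lra).
      apply Rinv_le_contravar; [apply Rdiv_lt_0_compat; lra|lra]. }
    exists N. intros n m Hn Hm z Hz.
    replace (fst (s n) z - fst (s m) z)%C with
      ((fst (s n) z - fst (s N) z) - (fst (s m) z - fst (s N) z))%C by ring.
    replace eps with (eps / 2 + eps / 2) by field.
    apply Cmod_minus_le; (eapply Rle_trans; [|exact Hdeps]);
      (apply Hin; [assumption|]); unfold disk in *; lra. }
  destruct (weierstrass (fun n => fst (s n)) h) as [Hent _]; [intros n; apply HC_entire|exact Hh|].
  exists (mkHC h Hent). intros j. apply (Hs j).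
  apply (near_closed (fun n => fst (s n)) (mkHC h Hent) _ _ _ (S j)); [exact Hh|].
  intros n Hn. now apply (Hin (S j) n).
Qed.

(** If the conclusion failed, adding to any [f] a large multiple of a small [g]
    on which some functional is not small would make each set
    [sup_k |L k f| > j] open and dense, and Baire would produce a function on
    which the functionals are unbounded. *)
Theorem banach_steinhaus (L : nat -> HC -> C) :
  (forall k f g, L k (HC_plus f g) = (L k f + L k g)%C) ->
  (forall k c f, L k (HC_scal c f) = (c * L k f)%C) ->
  (forall k, exists r K, 0 <= K /\ forall (f : HC) M, bounded_on f r M -> Cmod (L k f) <= K * M) ->
  (forall f, exists M, forall k, Cmod (L k f) <= M) ->
  exists r delta, 0 < delta /\
    forall (g : HC) k, bounded_on g r delta -> Cmod (L k g) <= 1.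
Proof.
intros Hplus Hscal Hcont Hpt. apply NNPP; intros Hno.
assert (Hbad : forall r delta, 0 < delta -> exists (g : HC) k, bounded_on g r delta /\ 1 < Cmod (L k g)).
{ intros r delta Hd. apply NNPP; intros H. apply Hno. exists r, delta. split; [exact Hd|].
  intros g k Hg. apply Rnot_lt_le; intros Hlt. apply H. now exists g, k. }
destruct (HC_baire (fun j f => exists k, INR j < Cmod (L k f))) as [h Hh].
- intros j f r delta Hd. destruct (Hpt f) as [M HM].
  assert (HM0 : 0 <= M) by (eapply Rle_trans; [apply Cmod_ge_0|apply (HM 0%nat)]).
  assert (Hj := pos_INR j).
  (* scaled by [A], the functional value of [g] exceeds that of [f] by more than [j] *)
  set (A := INR j + M + 1). assert (HA : 0 < A) by (unfold A; lra).
  destruct (Hbad r (delta / 2 / A)) as [g [k [Hg Hk]]].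
  { apply Rdiv_lt_0_compat; lra. }
  destruct (Hcont k) as [rk [K [HK HLk]]].
  set (f' := HC_plus f (HC_scal (RtoC A) g)).
  assert (Hf' : near r (delta / 2) f f').
  { apply near_plus_l. intros z Hz. simpl. rewrite Cmod_mult, Cmod_R, Rabs_pos_eq by lra.
    replace (delta / 2) with (A * (delta / 2 / A)) by (field; lra).
    apply Rmult_le_compat_l; [lra|now apply Hg]. }
  assert (HLf' : INR j + 1 < Cmod (L k f')).
  { unfold f'. rewrite Hplus, Hscal.
    assert (T := Cmod_triangle_inv (RtoC A * L k g) (- L k f)).
    replace (RtoC A * L k g - - L k f)%C with (L k f + RtoC A * L k g)%C in T by ring.
    rewrite Cmod_opp, Cmod_mult, Cmod_R, Rabs_pos_eq in T by lra.
    specialize (HM k). assert (A * 1 < A * Cmod (L k g)) by (apply Rmult_lt_compat_l; lra).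
    unfold A in *. lra. }
  exists f', (Rmax r rk), (Rmin (delta / 2) (/ (K + 1))).
  assert (HKi : 0 < / (K + 1)) by (apply Rinv_0_lt_compat; lra).
  split; [apply Rmin_pos; lra|]. intros h Hh. split.
  + replace delta with (delta / 2 + delta / 2) by field.
    apply near_trans with f'; [exact Hf'|]. revert Hh. apply near_le; [apply Rmax_l|apply Rmin_l].
  + exists k. set (g' := HC_plus h (HC_scal (- (1)) f')).
    assert (Hg' : Cmod (L k g') <= 1).
    { eapply Rle_trans; [apply (HLk g' (/ (K + 1)))|].
      - intros z Hz. simpl. replace (h z + - (1) * _)%C with (h z - f' z)%C by (simpl; ring).
        eapply Rle_trans; [apply Hh|apply Rmin_r]. unfold disk in *.
        eapply Rle_trans; [exact Hz|apply Rmax_r].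
      - apply Rmult_le_reg_r with (K + 1); [lra|]. field_simplify; lra. }
    unfold g' in Hg'. rewrite Hplus, Hscal in Hg'.
    replace (L k h + - (1) * L k f')%C with (L k h - L k f')%C in Hg' by ring.
    rewrite Cmod_minus_sym in Hg'. assert (T := Cmod_triangle_inv (L k f') (L k h)). lra.
- destruct (Hpt h) as [M HM]. destruct (INR_unbounded M) as [j Hj].
  destruct (Hh j) as [k Hk]. specialize (HM k). lra.
Qed.

(** * The operators [T] and their iterates *)

Lemma entire_T lambda b (f : HC) : entire (T lambda b f).
Proof.
apply (entire_cderiv _ (fun z => C_derive (HC_D f) (lambda * z + b) * lambda)%C).
intros z. apply (cderiv_comp (HC_D f) (fun w => lambda * w + b)%C); [apply cderiv_HC|apply cderiv_affine].
Qed.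

Definition TH (lambda b : C) (f : HC) : HC := mkHC (T lambda b f) (entire_T lambda b f).

Definition iterT (lambda b : C) (k : nat) (f : HC) : HC := Nat.iter k (TH lambda b) f.

Lemma iterT_fun lambda b k (f : HC) : HC_fun (iterT lambda b k f) = Nat.iter k (T lambda b) f.
Proof.
induction k as [|k IH]; [reflexivity|]. unfold iterT in *. simpl. now rewrite IH.
Qed.

Lemma TH_linear lambda b : HC_linear (TH lambda b).
Proof.
split; intros; apply HC_ext; intros z; apply C_derive_eq.
- apply cderiv_plus; apply cderiv_HC.
- apply cderiv_scal, cderiv_HC.
Qed.

Lemma iterT_linear lambda b k : HC_linear (iterT lambda b k).
Proof. apply HC_linear_iter, TH_linear. Qed.

Definition phin (lambda b : C) (k : nat) (z : C) : C := Nat.iter k (fun w => lambda * w + b)%C z.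

Lemma phin_affine lambda b k z : phin lambda b k z = (lambda ^ k * z + phin lambda b k 0)%C.
Proof.
induction k as [|k IH]; [simpl; ring|]. unfold phin in *. simpl. rewrite IH. ring.
Qed.

(** [tri k = k (k - 1) / 2], the exponent produced by differentiating
    [f^(j) (phi^j z)] for [j < k]. *)
Fixpoint tri (k : nat) : nat := match k with O => O | S j => (tri j + j)%nat end.

Lemma iterT_formula lambda b k (f : HC) : forall z,
  iterT lambda b k f z = (lambda ^ tri k * Dn k f (phin lambda b k z))%C.
Proof.
induction k as [|k IH]; intros z; [simpl; ring|].
apply (C_derive_eq (iterT lambda b k f)).
apply (cderiv_ext (fun w => lambda ^ tri k * Dn k f (lambda ^ k * w + phin lambda b k 0))%C).
{ intros w. now rewrite IH, <- phin_affine. }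
apply (cderiv_eq _ _ (lambda ^ tri k * (Dn (S k) f (phin lambda b (S k) z) * lambda ^ k))%C).
- apply cderiv_scal, (cderiv_comp (Dn k f) (fun w => lambda ^ k * w + phin lambda b k 0)%C);
    [|apply cderiv_affine].
  replace (lambda ^ k * (lambda * z + b) + phin lambda b k 0)%C with (phin lambda b (S k) z)
    by (rewrite <- phin_affine; symmetry; apply (iter_shift C (fun w => lambda * w + b)%C)).
  apply cderiv_D.
- simpl tri. rewrite Cpow_add_r. ring.
Qed.

(** * Growth of the coefficients of a convergent operator series *)

(** Partial sums with [n] terms instead of [n + 1], over locally uniform
    convergence on disks instead of compact sets. *)
Definition series_op (lambda b : C) (w : nat -> C) (S : HC -> HC) : Prop :=
  forall f, lu_cvg (fun n z => csum (fun k => w k * iterT lambda b k f z)%C n) (S f).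

Lemma sum_n_csum (a : nat -> C) n : sum_n (G:=C_AbelianMonoid) a n = csum a (S n).
Proof.
induction n as [|n IH].
- rewrite sum_O. simpl. ring.
- rewrite sum_Sn, IH. reflexivity.
Qed.

Lemma is_series_op_iff lambda b w S : is_series_op lambda b w S <-> series_op lambda b w S.
Proof.
assert (E : forall (f : HC) n z, sum_n (fun k => w k * Nat.iter k (T lambda b) f z)%C n =
  csum (fun k => w k * iterT lambda b k f z)%C (Datatypes.S n)).
{ intros f n z. rewrite sum_n_csum. apply csum_ext. intros i _. now rewrite iterT_fun. }
split; intros H f; specialize (H f).
- apply ucc_cvg_lu in H. intros r eps He. destruct (H r eps He) as [N HN].
  exists (Datatypes.S N). intros [|n] Hn; [lia|]. intros z Hz. rewrite <- E. apply (HN n); [lia|exact Hz].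
- apply ucc_cvg_lu. intros r eps He. destruct (H r eps He) as [N HN].
  exists N. intros n Hn z Hz. rewrite E. apply (HN (Datatypes.S n)); [lia|exact Hz].
Qed.

Lemma prefix_bound (Q : nat -> R -> Prop) :
  (forall n M M', M <= M' -> Q n M -> Q n M') -> (forall n, exists M, Q n M) ->
  forall N, exists M, 0 <= M /\ forall n, (n < N)%nat -> Q n M.
Proof.
intros Hm He. induction N as [|N [M [HM0 HM]]].
- exists 0. split; [lra|]. intros n Hn; lia.
- destruct (He N) as [M' HM']. exists (Rmax M M'). split.
  + eapply Rle_trans; [exact HM0|apply Rmax_l].
  + intros n Hn. destruct (Nat.eq_dec n N) as [->|Hne].
    * apply (Hm N M'); [apply Rmax_r|exact HM'].
    * apply (Hm n M); [apply Rmax_l|apply HM; lia].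
Qed.

Lemma C_cvg_bounded u l : C_cvg u l -> exists M, 0 <= M /\ forall n, Cmod (u n) <= M.
Proof.
intros H. destruct (H 1 Rlt_0_1) as [N HN].
destruct (prefix_bound (fun n M => Cmod (u n) <= M)) with (N := N) as [M [HM0 HM]].
- intros; lra.
- intros n. now exists (Cmod (u n)); right.
- exists (M + Cmod l + 1). assert (T := Cmod_ge_0 l). split; [lra|]. intros n.
  destruct (Nat.lt_ge_cases n N) as [L|L]; [specialize (HM n L); lra|].
  specialize (HN n L). assert (T' := Cmod_triangle_inv (u n) l). lra.
Qed.

Lemma csum_cvg_terms_bounded a l : C_cvg (csum a) l -> exists M, 0 <= M /\ forall n, Cmod (a n) <= M.
Proof.
intros H. destruct (C_cvg_bounded _ _ H) as [M [HM0 HM]]. exists (M + M). split; [lra|].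
intros n. replace (a n) with (csum a (S n) - csum a n)%C by (simpl; ring).
now apply Cmod_minus_le.
Qed.

Lemma bounded_on_nonneg f r M : 0 <= r -> bounded_on f r M -> 0 <= M.
Proof.
intros Hr H. eapply Rle_trans; [apply Cmod_ge_0|apply (H (RtoC 0))].
unfold disk. now rewrite Cmod_0.
Qed.

Lemma phin_disk lambda b k r z : disk r z ->
  disk (Cmod (lambda ^ k) * r + Cmod (phin lambda b k 0)) (phin lambda b k z).
Proof.
intros Hz. unfold disk in *. rewrite phin_affine.
apply Cmod_plus_le; [|lra]. rewrite Cmod_mult. apply Rmult_le_compat_l; [apply Cmod_ge_0|exact Hz].
Qed.

Lemma iterT_bounded lambda b k r : 0 <= r -> exists r' K, 0 <= K /\
  forall (f : HC) M, bounded_on f r' M -> bounded_on (iterT lambda b k f) r (K * M).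
Proof.
intros Hr. set (r1 := Cmod (lambda ^ k) * r + Cmod (phin lambda b k 0)).
assert (Hr1 : 0 <= r1).
{ apply Rplus_le_le_0_compat; [apply Rmult_le_pos|]; try apply Cmod_ge_0; exact Hr. }
exists (r1 + 1), (Cmod (lambda ^ tri k) * (INR (fact k) * (6 / 1) ^ k)). split.
- apply Rmult_le_pos; [apply Cmod_ge_0|]. apply Rmult_le_pos; [left; apply fact_pos|apply pow_le; lra].
- intros f M HM z Hz. rewrite iterT_formula, Cmod_mult, Rmult_assoc.
  apply Rmult_le_compat_l; [apply Cmod_ge_0|]. rewrite <- (Rmult_comm M), <- Rmult_assoc.
  apply (cauchy_factorial f r1 1 M k Rlt_0_1); [|exact HM|now apply phin_disk].
  apply (bounded_on_nonneg f (r1 + 1)); [lra|exact HM].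
Qed.

Lemma iterT_cvg lambda b k (u : nat -> HC) (g : HC) z : lu_cvg (fun n => u n) g ->
  C_cvg (fun n => iterT lambda b k (u n) z) (iterT lambda b k g z).
Proof.
intros H eps He. destruct (iterT_bounded lambda b k (Cmod z) (Cmod_ge_0 z)) as [r' [K [HK HT]]].
destruct (H r' (eps / (K + 1))) as [N HN]; [apply Rdiv_lt_0_compat; lra|].
exists N. intros n Hn.
specialize (HT (HC_plus (u n) (HC_scal (- (1)) g)) (eps / (K + 1))).
rewrite (proj1 (iterT_linear lambda b k)), (proj2 (iterT_linear lambda b k)) in HT.
replace (iterT lambda b k (u n) z - iterT lambda b k g z)%C with
  (HC_plus (iterT lambda b k (u n)) (HC_scal (- (1)) (iterT lambda b k g)) z) by (simpl; ring).
eapply Rle_trans; [apply HT; [|apply Rle_refl]|].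
- intros v Hv. simpl. replace (u n v + - (1) * g v)%C with (u n v - g v)%C by ring. now apply (HN n Hn).
- apply Rle_trans with ((K + 1) * (eps / (K + 1))).
  + apply Rmult_le_compat_r; [|lra]. left. apply Rdiv_lt_0_compat; lra.
  + right; field; lra.
Qed.

Lemma HC_scal_apply a (g : HC) z : HC_scal a g z = (a * g z)%C.
Proof. reflexivity. Qed.

(** Banach-Steinhaus for the functionals [f |-> w_k (T^k f)(z0)], whose values
    are the terms of a convergent series, tested on powers of [z - c]. *)
Lemma coefficient_growth lambda b w S (c z0 : C) : series_op lambda b w S ->
  exists rho K, 1 <= rho /\ 0 <= K /\ forall k m,
    Cmod (w k) * Cmod lambda ^ tri k * INR (fact k) * Cmod (phin lambda b k z0 - c) ^ m <= K * rho ^ (k + m).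
Proof.
intros HS.
destruct (banach_steinhaus (fun k f => w k * iterT lambda b k f z0)%C) as [r [d [Hd H]]].
- intros k f g. rewrite (proj1 (iterT_linear lambda b k)). simpl. ring.
- intros k a f. rewrite (proj2 (iterT_linear lambda b k)). simpl. ring.
- intros k. destruct (iterT_bounded lambda b k (Cmod z0) (Cmod_ge_0 z0)) as [r [K [HK HT]]].
  exists r, (Cmod (w k) * K). split; [apply Rmult_le_pos; [apply Cmod_ge_0|exact HK]|].
  intros f M HM. rewrite Cmod_mult, Rmult_assoc. apply Rmult_le_compat_l; [apply Cmod_ge_0|].
  apply HT; [exact HM|apply Rle_refl].
- intros f. destruct (csum_cvg_terms_bounded _ _ (lu_cvg_pointwise _ _ z0 (HS f))) as [M [_ HM]].
  now exists M.
- set (rho := Rmax 0 r + Cmod c + 1).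
  assert (H0 := Rmax_l 0 r). assert (H1 := Rmax_r 0 r). assert (H2 := Cmod_ge_0 c).
  assert (Hrho : 1 <= rho) by (unfold rho; lra).
  assert (Hdi : 0 < / d) by now apply Rinv_0_lt_compat.
  exists rho, (/ d). split; [exact Hrho|]. split; [lra|]. intros k m.
  set (n := (k + m)%nat). assert (Hpow : 0 < rho ^ n) by (apply pow_lt; lra).
  specialize (H (HC_scal (RtoC (d * INR (fact n) / rho ^ n)) (Mono c n)) k).
  assert (Hq : 0 <= d * INR (fact n) / rho ^ n).
  { apply Rmult_le_pos; [apply Rmult_le_pos; [lra|left; apply fact_pos]|].
    left. now apply Rinv_0_lt_compat. }
  assert (HF : INR (fact k) * INR (fact m) <= INR (fact n)).
  { rewrite <- mult_INR. apply le_INR. unfold n. clear. induction k as [|k IH]; [simpl; lia|].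
    simpl Nat.add. rewrite !fact_simpl. nia. }
  rewrite (proj2 (iterT_linear lambda b k)) in H.
  rewrite HC_scal_apply, iterT_formula in H.
  replace (Dn k (Mono c n)) with (Mono c m) in H by (symmetry; apply Dn_Mono).
  rewrite !Cmod_mult, Cmod_Mono, Cmod_pow, Cmod_R, Rabs_pos_eq in H by exact Hq.
  set (y := Cmod (phin lambda b k z0 - c)) in *.
  assert (Hy : 0 <= y ^ m) by (apply pow_le, Cmod_ge_0).
  assert (HWL : 0 <= Cmod (w k) * Cmod lambda ^ tri k).
  { apply Rmult_le_pos; [apply Cmod_ge_0|apply pow_le, Cmod_ge_0]. }
  assert (G : Cmod (w k) * (d * INR (fact n) / rho ^ n * (Cmod lambda ^ tri k * (y ^ m / INR (fact m)))) <= 1).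
  { apply H. intros z Hz. simpl HC_fun. rewrite Cmod_mult.
    change (RtoC (/ INR (fact n)) * (z - c) ^ n)%C with (Mono c n z).
    rewrite Cmod_Mono, Cmod_R, Rabs_pos_eq by exact Hq.
    replace (d * INR (fact n) / rho ^ n * (Cmod (z - c) ^ n / INR (fact n)))
      with (d * (Cmod (z - c) ^ n / rho ^ n)) by (field; split; apply Rgt_not_eq; [apply fact_pos|exact Hpow]).
    rewrite <- (Rmult_1_r d) at 2. apply Rmult_le_compat_l; [lra|].
    apply Rmult_le_reg_r with (rho ^ n); [exact Hpow|].
    replace (Cmod (z - c) ^ n / rho ^ n * rho ^ n) with (Cmod (z - c) ^ n) by (field; lra).
    rewrite Rmult_1_l. apply pow_incr. split; [apply Cmod_ge_0|].
    apply Rle_trans with (r + Cmod c); [apply Cmod_minus_le; [exact Hz|lra]|unfold rho; lra]. }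
  apply Rmult_le_reg_l with (d / rho ^ n); [apply Rdiv_lt_0_compat; lra|].
  replace (d / rho ^ n * (/ d * rho ^ n)) with 1 by (field; split; lra).
  eapply Rle_trans; [|exact G].
  assert (HFm := fact_pos m). assert (HFk := fact_pos k).
  replace (Cmod (w k) * (d * INR (fact n) / rho ^ n * (Cmod lambda ^ tri k * (y ^ m / INR (fact m)))))
    with (d / rho ^ n * (Cmod (w k) * Cmod lambda ^ tri k * (INR (fact n) / INR (fact m)) * y ^ m))
    by (field; split; lra).
  apply Rmult_le_compat_l; [left; apply Rdiv_lt_0_compat; lra|].
  apply Rmult_le_compat_r; [exact Hy|]. apply Rmult_le_compat_l; [exact HWL|].
  apply Rmult_le_reg_r with (INR (fact m)); [exact HFm|].
  replace (INR (fact n) / INR (fact m) * INR (fact m)) with (INR (fact n)) by (field; lra). exact HF.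
Qed.

Lemma pow_unbounded q M : 1 < q -> exists m, M < q ^ m.
Proof.
intros Hq. destruct (Pow_x_infinity q) with (b := M + 1) as [m Hm].
- rewrite Rabs_pos_eq; lra.
- exists m. specialize (Hm m (Nat.le_refl m)). rewrite Rabs_pos_eq in Hm by (apply pow_le; lra). lra.
Qed.

(** When the points [phi^k z0] escape to infinity, large powers of [z - c]
    violate the growth estimate unless [w k] vanishes: the symbol is a polynomial. *)
Lemma coefficients_finite lambda b w S (c z0 : C) : series_op lambda b w S ->
  1 <= Cmod lambda ->
  (forall A, exists N, forall k, (N <= k)%nat -> A < Cmod (phin lambda b k z0 - c)) ->
  exists N, forall k, (N <= k)%nat -> w k = RtoC 0.
Proof.
intros HS Hl Hesc.
destruct (coefficient_growth _ _ _ _ c z0 HS) as [rho [K [Hrho [HK H]]]].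
destruct (Hesc rho) as [N HN]. exists N. intros k Hk. specialize (HN k Hk).
apply Cmod_eq_0, Rle_antisym; [|apply Cmod_ge_0]. apply Rnot_lt_le; intros Hw.
set (y := Cmod (phin lambda b k z0 - c)) in *.
assert (Hq : 1 < y / rho).
{ apply Rmult_lt_reg_r with rho; [lra|]. replace (y / rho * rho) with y by (field; lra). lra. }
destruct (pow_unbounded (y / rho) (K * rho ^ k / Cmod (w k)) Hq) as [m Hm].
specialize (H k m). rewrite pow_add in H.
assert (Hrm : 0 < rho ^ m) by (apply pow_lt; lra).
assert (Hy : y ^ m = (y / rho) ^ m * rho ^ m).
{ rewrite <- Rpow_mult_distr. f_equal. field; lra. }
assert (L : Cmod (w k) * y ^ m <= K * (rho ^ k * rho ^ m)).
{ eapply Rle_trans; [|exact H]. apply Rmult_le_compat_r; [apply pow_le, Cmod_ge_0|].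
  rewrite <- (Rmult_1_r (Cmod (w k))) at 1. rewrite Rmult_assoc.
  apply Rmult_le_compat_l; [lra|]. rewrite <- (Rmult_1_l 1).
  apply Rmult_le_compat; try lra; [now apply pow_R1_Rle|].
  change 1 with (INR 1). apply le_INR. assert (T := lt_O_fact k). lia. }
rewrite Hy in L.
apply (Rmult_lt_compat_l (Cmod (w k) * rho ^ m)) in Hm; [|now apply Rmult_lt_0_compat].
replace (Cmod (w k) * rho ^ m * (K * rho ^ k / Cmod (w k))) with (K * (rho ^ k * rho ^ m)) in Hm
  by (field; lra).
lra.
Qed.

Lemma phin_fixed lambda b c k z : (lambda * c + b = c)%C ->
  (phin lambda b k z - c = lambda ^ k * (z - c))%C.
Proof.
intros Hc. induction k as [|k IH]; [simpl; ring|].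
change (phin lambda b (S k) z) with (lambda * phin lambda b k z + b)%C.
replace (lambda * phin lambda b k z + b - c)%C with (lambda * (phin lambda b k z - c))%C.
- rewrite IH. simpl. ring.
- generalize (phin lambda b k z). intros p.
  replace (lambda * p + b - c)%C with (lambda * p + (b - c))%C by ring.
  replace (b - c)%C with (- (lambda * c))%C by (rewrite <- Hc at 2; ring). ring.
Qed.

Lemma affine_fixed_point (lambda b : C) : lambda <> 1%C -> exists c, (lambda * c + b = c)%C.
Proof.
intros H. exists (b / (1 - lambda))%C. field.
intros E. apply H. transitivity (1 - (1 - lambda))%C; [ring|]. rewrite E. ring.
Qed.

(** If [|lambda| > 1] the orbit of [c + 1] around the fixed point [c] escapes; if
    [lambda = 1] and [b] is nonzero there is no fixed point and every orbit
    escapes. *)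
Lemma affine_dichotomy (lambda b : C) :
  (Cmod lambda <= 1 /\ exists c, (lambda * c + b = c)%C) \/
  (1 <= Cmod lambda /\ exists c z0, forall A, exists N, forall k, (N <= k)%nat ->
     A < Cmod (phin lambda b k z0 - c)).
Proof.
destruct (Rle_lt_dec (Cmod lambda) 1) as [Hle|Hgt].
- destruct (Ceq_dec lambda 1) as [->|Hl].
  + destruct (Ceq_dec b 0) as [->|Hb].
    * left. split; [exact Hle|]. exists (RtoC 0). ring.
    * right. rewrite Cmod_1. split; [lra|]. exists (RtoC 0), (RtoC 0). intros A.
      assert (Hb0 : 0 < Cmod b) by now apply Cmod_gt_0.
      assert (E : forall k, phin 1 b k 0 = (RtoC (INR k) * b)%C).
      { induction k as [|k IH]; [simpl; ring|]. unfold phin in *. rewrite S_INR, RtoC_plus.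
        simpl Nat.iter. rewrite IH. ring. }
      destruct (INR_unbounded (A / Cmod b)) as [N HN]. exists N. intros k Hk.
      apply le_INR in Hk.
      replace (phin 1 b k 0 - 0)%C with (RtoC (INR k) * b)%C by (rewrite E; ring).
      rewrite Cmod_mult, Cmod_R, Rabs_pos_eq by apply pos_INR.
      replace A with (A / Cmod b * Cmod b) by (field; lra). apply Rmult_lt_compat_r; lra.
  + left. split; [exact Hle|]. now apply affine_fixed_point.
- right. split; [lra|]. destruct (affine_fixed_point lambda b) as [c Hc].
  { intros ->. rewrite Cmod_1 in Hgt. lra. }
  exists c, (c + 1)%C. intros A.
  destruct (Pow_x_infinity (Cmod lambda)) with (b := A + 1) as [N HN].
  { rewrite Rabs_pos_eq; lra. }
  exists N. intros k Hk. specialize (HN k Hk).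
  rewrite phin_fixed by exact Hc. replace (c + 1 - c)%C with (RtoC 1) by ring.
  rewrite Cmult_1_r, Cmod_pow. rewrite Rabs_pos_eq in HN by (apply pow_le; lra). lra.
Qed.

Lemma tri_add j k : tri (j + k) = (tri j + tri k + j * k)%nat.
Proof. induction j as [|j IH]; simpl; [lia|]. rewrite IH. lia. Qed.

Lemma fact_add_le j k : INR (fact (j + k)) <= 2 ^ (j + k) * (INR (fact j) * INR (fact k)).
Proof.
revert k. induction j as [|j IHj]; intros k.
- simpl. rewrite Rmult_1_l. rewrite <- (Rmult_1_l (INR (fact k))) at 1.
  apply Rmult_le_compat_r; [left; apply fact_pos|apply pow_R1_Rle; lra].
- induction k as [|k IHk].
  + rewrite Nat.add_0_r. simpl (fact 0). rewrite Rmult_1_r. rewrite <- (Rmult_1_l (INR (fact (S j)))) at 1.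
    apply Rmult_le_compat_r; [left; apply fact_pos|apply pow_R1_Rle; lra].
  + specialize (IHj (S k)).
    assert (E1 : INR (fact (S j + S k)) =
      INR (S j) * INR (fact (j + S k)) + INR (S k) * INR (fact (S j + k))).
    { replace (S j + k)%nat with (j + S k)%nat by lia.
      change (S j + S k)%nat with (S (j + S k)). rewrite fact_simpl, mult_INR.
      replace (S (j + S k)) with (S j + S k)%nat by lia. rewrite plus_INR. ring. }
    rewrite E1.
    replace (S j + k)%nat with (j + S k)%nat in * by lia.
    change (S j + S k)%nat with (S (j + S k)).
    replace (2 ^ S (j + S k) * (INR (fact (S j)) * INR (fact (S k)))) with
      (INR (S j) * (2 ^ (j + S k) * (INR (fact j) * INR (fact (S k)))) +
       INR (S k) * (2 ^ (j + S k) * (INR (fact (S j)) * INR (fact k)))).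
    * apply Rplus_le_compat; apply Rmult_le_compat_l; try apply pos_INR; assumption.
    * rewrite (fact_simpl j), (fact_simpl k), !mult_INR. simpl (2 ^ S _). ring.
Qed.

Lemma pow_le_1 x n : 0 <= x <= 1 -> x ^ n <= 1.
Proof. intros H. rewrite <- (pow1 n). now apply pow_incr. Qed.

(** The estimate that makes products of symbols act as compositions. With an
    attracting or neutral fixed point [c] it combines the growth bounds for both
    symbols with Cauchy's estimates on a disk of large radius; otherwise both
    symbols are polynomials. *)
Lemma double_series_tame lambda b w1 w2 S1 S2 :
  series_op lambda b w1 S1 -> series_op lambda b w2 S2 ->
  forall (f : HC) r, 0 <= r -> exists K, 0 <= K /\ forall j k z, disk r z ->
    Cmod (w1 j * w2 k * iterT lambda b (j + k) f z) <= K * (/ 4) ^ (j + k).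
Proof.
intros H1 H2 f r Hr.
destruct (affine_dichotomy lambda b) as [[Hl [c Hc]]|[Hl [c [z0 Hesc]]]].
- destruct (coefficient_growth _ _ _ _ c c H1) as [rho1 [K1 [Hr1 [HK1 G1]]]].
  destruct (coefficient_growth _ _ _ _ c c H2) as [rho2 [K2 [Hr2 [HK2 G2]]]].
  set (rho := Rmax rho1 rho2).
  assert (Hm1 := Rmax_l rho1 rho2). assert (Hm2 := Rmax_r rho1 rho2). fold rho in Hm1, Hm2.
  set (r' := r + Cmod c + Cmod c).
  (* [48 rho] offsets the [6] of Cauchy's estimate, the [2] of the binomial bound
     and the [rho] of the coefficients, and leaves the ratio [1/4] *)
  destruct (entire_bounded_on f (r' + 48 * rho) (HC_entire f)) as [M [HM0 HM]].
  assert (Hc0 := Cmod_ge_0 c). assert (Hl0 := Cmod_ge_0 lambda).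
  exists (K1 * K2 * M). split; [repeat apply Rmult_le_pos; assumption|].
  intros j k z Hz.
  assert (B1 : Cmod (w1 j) * Cmod lambda ^ tri j * INR (fact j) <= K1 * rho ^ j).
  { specialize (G1 j 0%nat). rewrite Nat.add_0_r, pow_O, Rmult_1_r in G1.
    eapply Rle_trans; [exact G1|]. apply Rmult_le_compat_l; [exact HK1|]. apply pow_incr; lra. }
  assert (B2 : Cmod (w2 k) * Cmod lambda ^ tri k * INR (fact k) <= K2 * rho ^ k).
  { specialize (G2 k 0%nat). rewrite Nat.add_0_r, pow_O, Rmult_1_r in G2.
    eapply Rle_trans; [exact G2|]. apply Rmult_le_compat_l; [exact HK2|]. apply pow_incr; lra. }
  assert (Hphi : disk r' (phin lambda b (j + k) z)).
  { unfold disk. replace (phin lambda b (j + k) z) with ((phin lambda b (j + k) z - c) + c)%C by ring.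
    rewrite phin_fixed by exact Hc. unfold r'. apply Cmod_plus_le; [|lra].
    rewrite Cmod_mult, Cmod_pow. rewrite <- (Rmult_1_l (r + Cmod c)).
    apply Rmult_le_compat; [apply pow_le, Cmod_ge_0|apply Cmod_ge_0|apply pow_le_1; lra|].
    apply Cmod_minus_le; [exact Hz|lra]. }
  assert (B3 := cauchy_factorial f r' (48 * rho) M (j + k) ltac:(lra) HM0 HM _ Hphi).
  rewrite iterT_formula, !Cmod_mult, Cmod_pow, tri_add, !pow_add.
  assert (P1 : 0 <= Cmod (w1 j) * Cmod lambda ^ tri j) by (apply Rmult_le_pos; [apply Cmod_ge_0|now apply pow_le]).
  assert (P2 : 0 <= Cmod (w2 k) * Cmod lambda ^ tri k) by (apply Rmult_le_pos; [apply Cmod_ge_0|now apply pow_le]).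
  assert (P3 : 0 <= (6 / (48 * rho)) ^ (j + k)) by (apply pow_le; left; apply Rdiv_lt_0_compat; lra).
  set (X := Cmod (w1 j) * Cmod lambda ^ tri j) in *.
  set (Y := Cmod (w2 k) * Cmod lambda ^ tri k) in *.
  assert (F1 := fact_pos j). assert (F2 := fact_pos k).
  apply Rle_trans with (X * Y * (M * (2 ^ (j + k) * (INR (fact j) * INR (fact k))) * (6 / (48 * rho)) ^ (j + k))).
  + replace (Cmod (w1 j) * Cmod (w2 k) * (Cmod lambda ^ tri j * Cmod lambda ^ tri k * Cmod lambda ^ (j * k) *
      Cmod (Dn (j + k) f (phin lambda b (j + k) z)))) with
      (X * Y * (Cmod lambda ^ (j * k) * Cmod (Dn (j + k) f (phin lambda b (j + k) z)))) by (unfold X, Y; ring).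
    apply Rmult_le_compat_l; [now apply Rmult_le_pos|].
    rewrite <- (Rmult_1_l (M * _ * _)).
    apply Rmult_le_compat; [now apply pow_le|apply Cmod_ge_0|apply pow_le_1; lra|].
    eapply Rle_trans; [exact B3|]. apply Rmult_le_compat_r; [exact P3|].
    apply Rmult_le_compat_l; [exact HM0|apply fact_add_le].
  + replace (X * Y * (M * (2 ^ (j + k) * (INR (fact j) * INR (fact k))) * (6 / (48 * rho)) ^ (j + k))) with
      ((X * INR (fact j)) * (Y * INR (fact k)) * (M * (2 * (6 / (48 * rho))) ^ (j + k)))
      by (rewrite (Rpow_mult_distr 2); ring).
    apply Rle_trans with ((K1 * rho ^ j) * (K2 * rho ^ k) * (M * (2 * (6 / (48 * rho))) ^ (j + k))).
    * apply Rmult_le_compat_r.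
      { apply Rmult_le_pos; [exact HM0|]. apply pow_le. assert (0 < 6 / (48 * rho)) by (apply Rdiv_lt_0_compat; lra). lra. }
      apply Rmult_le_compat; try assumption; apply Rmult_le_pos; try assumption; lra.
    * right. replace (/ 4) with (rho * (2 * (6 / (48 * rho)))) by (field; lra).
      rewrite <- pow_add, (Rpow_mult_distr rho), (pow_add rho). ring.
- destruct (coefficients_finite _ _ _ _ c z0 H1 Hl Hesc) as [N1 HN1].
  destruct (coefficients_finite _ _ _ _ c z0 H2 Hl Hesc) as [N2 HN2].
  destruct (prefix_bound (fun n M => Cmod (w1 n) <= M)) with (N := N1) as [A1 [HA1 B1]];
    [intros; lra|intros n; now exists (Cmod (w1 n)); right|].
  destruct (prefix_bound (fun n M => Cmod (w2 n) <= M)) with (N := N2) as [A2 [HA2 B2]];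
    [intros; lra|intros n; now exists (Cmod (w2 n)); right|].
  destruct (prefix_bound (fun n M => bounded_on (iterT lambda b n f) r M)) with (N := (N1 + N2)%nat) as [A3 [HA3 B3]].
  { intros n M M' HMM. apply bounded_on_le; [apply Rle_refl|exact HMM]. }
  { intros n. destruct (entire_bounded_on (iterT lambda b n f) r (HC_entire _)) as [M [_ HM]]. now exists M. }
  assert (H4 : forall n, 0 < (/ 4) ^ n) by (intros; apply pow_lt; lra).
  assert (HK : 0 <= A1 * A2 * A3 * 4 ^ (N1 + N2)).
  { repeat apply Rmult_le_pos; try assumption. apply pow_le; lra. }
  exists (A1 * A2 * A3 * 4 ^ (N1 + N2)). split; [exact HK|].
  intros j k z Hz.
  assert (Hz0 : 0 <= A1 * A2 * A3 * 4 ^ (N1 + N2) * (/ 4) ^ (j + k)) by (apply Rmult_le_pos; [exact HK|left; apply H4]).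
  destruct (Nat.lt_ge_cases j N1) as [Lj|Lj].
  2:{ rewrite HN1 by exact Lj. rewrite !Cmult_0_l, Cmod_0. exact Hz0. }
  destruct (Nat.lt_ge_cases k N2) as [Lk|Lk].
  2:{ rewrite HN2 by exact Lk. rewrite Cmult_0_r, Cmult_0_l, Cmod_0. exact Hz0. }
  rewrite !Cmod_mult.
  apply Rle_trans with (A1 * A2 * A3 * 1).
  + rewrite Rmult_1_r. apply Rmult_le_compat; try apply Cmod_ge_0.
    * apply Rmult_le_pos; apply Cmod_ge_0.
    * apply Rmult_le_compat; try apply Cmod_ge_0; [now apply B1|now apply B2].
    * apply B3; [lia|exact Hz].
  + rewrite !Rmult_assoc. repeat (apply Rmult_le_compat_l; [assumption|]).
    replace (N1 + N2)%nat with ((N1 + N2 - (j + k)) + (j + k))%nat by lia.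
    rewrite pow_add, Rmult_assoc, <- Rpow_mult_distr. replace (4 * / 4) with 1 by field.
    rewrite pow1, Rmult_1_r. apply pow_R1_Rle; lra.
Qed.

(** * Cauchy products and the algebra of operators *)

Definition conv (a c : nat -> C) (n : nat) : C := csum (fun i => a i * c (n - i)%nat)%C (S n).

Lemma csum_antidiagonals (x : nat -> nat -> C) N :
  csum (fun n => csum (fun i => x i (n - i)%nat) (S n)) N = csum (fun j => csum (x j) (N - j)) N.
Proof.
induction N as [|N IH]; [reflexivity|].
change (csum ?F (S N)) with (csum F N + F N)%C. cbv beta. rewrite IH.
change (csum (fun i => x i (N - i)%nat) (S N)) with (csum (fun i => x i (N - i)%nat) N + x N (N - N)%nat)%C.
rewrite Nat.sub_diag. replace (S N - N)%nat with 1%nat by lia.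
rewrite (csum_ext (fun j => csum (x j) (S N - j)) (fun j => csum (x j) (N - j) + x j (N - j)%nat)%C).
- rewrite csum_plus. simpl. ring.
- intros i Hi. now replace (S N - i)%nat with (S (N - i)) by lia.
Qed.

Lemma geometric_tail a A m p : 0 <= A -> (forall k, Cmod (a k) <= A * (/ 4) ^ k) ->
  Cmod (csum a (m + p) - csum a m) <= 2 * A * (/ 4) ^ m.
Proof.
intros HA H.
assert (G : Cmod (csum a (m + p) - csum a m) <= 2 * A * ((/ 4) ^ m - (/ 4) ^ (m + p))).
{ induction p as [|p IH].
  - rewrite Nat.add_0_r. replace (csum a m - csum a m)%C with (RtoC 0) by ring. rewrite Cmod_0. lra.
  - rewrite Nat.add_succ_r. simpl csum.
    replace (csum a (m + p) + a (m + p)%nat - csum a m)%C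
      with ((csum a (m + p) - csum a m) + a (m + p)%nat)%C by ring.
    eapply Rle_trans; [apply Cmod_plus_le; [exact IH|apply H]|].
    assert (0 <= A * (/ 4) ^ (m + p)) by (apply Rmult_le_pos; [exact HA|apply pow_le; lra]).
    change ((/ 4) ^ S (m + p)) with (/ 4 * (/ 4) ^ (m + p)). lra. }
assert (0 <= A * (/ 4) ^ (m + p)) by (apply Rmult_le_pos; [exact HA|apply pow_le; lra]). lra.
Qed.

(** The triangular partial sum differs from [X 0 + ... + X (N - 1)] by one row tail for
    each [j < N], each of size [4^-N]; the resulting factor [N] is absorbed by
    replacing [4] with [2]. *)
Lemma double_series_remainder (x : nat -> nat -> C) (X : nat -> C) K N : 0 <= K ->
  (forall j k, Cmod (x j k) <= K * (/ 4) ^ (j + k)) ->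
  (forall j, C_cvg (csum (x j)) (X j)) ->
  Cmod (csum (fun n => csum (fun i => x i (n - i)%nat) (S n)) N - csum X N) <= 2 * K * (/ 2) ^ N.
Proof.
intros HK Hx HX. rewrite csum_antidiagonals.
replace (csum (fun j => csum (x j) (N - j)) N - csum X N)%C with
  (csum (fun j => csum (x j) (N - j) + - (1) * X j)%C N) by (rewrite csum_plus, csum_scal; ring).
eapply Rle_trans; [apply (csum_bound _ (2 * K * (/ 4) ^ N))|].
- intros j Hj. replace (csum (x j) (N - j) + - (1) * X j)%C with (csum (x j) (N - j) - X j)%C by ring.
  rewrite Cmod_minus_sym.
  apply (C_cvg_bound (fun n => csum (x j) n - csum (x j) (N - j))%C _ _ (N - j)).
  + apply (C_cvg_ext (fun n => csum (x j) n + - csum (x j) (N - j))%C); [intros; ring|].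
    apply C_cvg_plus; [apply HX|apply C_cvg_const].
  + intros n Hn. replace n with ((N - j) + (n - (N - j)))%nat by lia.
    replace (2 * K * (/ 4) ^ N) with (2 * (K * (/ 4) ^ j) * (/ 4) ^ (N - j)).
    * apply geometric_tail; [apply Rmult_le_pos; [exact HK|apply pow_le; lra]|].
      intros k. rewrite Rmult_assoc, <- pow_add. apply Hx.
    * replace N with (j + (N - j))%nat at 2 by lia. rewrite pow_add. ring.
- assert (HN : INR N <= 2 ^ N).
  { clear. induction N as [|N IH]; [simpl; lra|]. rewrite S_INR. simpl.
    assert (1 <= 2 ^ N) by (apply pow_R1_Rle; lra). lra. }
  replace (/ 4) with (/ 2 * / 2) by field. rewrite Rpow_mult_distr.
  assert (Hp : 0 < (/ 2) ^ N) by (apply pow_lt; lra).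
  apply Rle_trans with (2 ^ N * (2 * K * ((/ 2) ^ N * (/ 2) ^ N))).
  + apply Rmult_le_compat_r; [|exact HN]. repeat apply Rmult_le_pos; lra.
  + right. replace (2 ^ N * (2 * K * ((/ 2) ^ N * (/ 2) ^ N))) with
      (2 * K * (/ 2) ^ N * (2 * / 2) ^ N) by (rewrite Rpow_mult_distr; ring).
    replace (2 * / 2) with 1 by field. rewrite pow1. ring.
Qed.

Lemma pow_half_small K eps : 0 <= K -> 0 < eps -> exists N, forall n, (N <= n)%nat -> K * (/ 2) ^ n <= eps.
Proof.
intros HK He. destruct (pow_lt_1_zero (/ 2)) with (y := eps / (K + 1)) as [N HN].
- rewrite Rabs_pos_eq; lra.
- apply Rdiv_lt_0_compat; lra.
- exists N. intros n Hn. specialize (HN n Hn). rewrite Rabs_pos_eq in HN by (apply pow_le; lra).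
  apply Rle_trans with ((K + 1) * (eps / (K + 1))).
  + apply Rmult_le_compat; [exact HK|apply pow_le; lra|lra|lra].
  + right; field; lra.
Qed.

(** Each [T^j] is continuous, so [T^j (S2 f)] is the sum of the rows
    [w2_k T^(j + k) f], and the double series may be summed along antidiagonals. *)
Theorem series_op_comp lambda b w1 w2 S1 S2 :
  series_op lambda b w1 S1 -> series_op lambda b w2 S2 ->
  series_op lambda b (conv w1 w2) (op_comp S1 S2).
Proof.
intros H1 H2 f r eps He.
destruct (double_series_tame _ _ _ _ _ _ H1 H2 f (Rmax 0 r) (Rmax_l _ _)) as [K [HK Htame]].
destruct (pow_half_small (2 * K) (eps / 2)) as [N1 HN1]; [lra|lra|].
destruct (H1 (S2 f) r (eps / 2) ltac:(lra)) as [N2 HN2].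
exists (max N1 N2). intros n Hn z Hz.
set (x := fun j k => (w1 j * w2 k * iterT lambda b (j + k) f z)%C).
set (X := fun j => (w1 j * iterT lambda b j (S2 f) z)%C).
replace (csum (fun k => conv w1 w2 k * iterT lambda b k f z)%C n - op_comp S1 S2 f z)%C with
  ((csum (fun m => csum (fun i => x i (m - i)%nat) (S m)) n - csum X n) + (csum X n - S1 (S2 f) z))%C.
2:{ replace (csum (fun k => conv w1 w2 k * iterT lambda b k f z)%C n) with
     (csum (fun m => csum (fun i => x i (m - i)%nat) (S m)) n); [unfold op_comp; ring|].
    apply csum_ext. intros m _. unfold conv. rewrite Cmult_comm, <- csum_scal. apply csum_ext.
    intros i Hi. unfold x. replace (i + (m - i))%nat with m by lia. ring. }
replace eps with (eps / 2 + eps / 2) by field. apply Cmod_plus_le.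
- eapply Rle_trans; [apply (double_series_remainder x X K n HK)|apply HN1; lia].
  + intros j k. apply Htame. unfold disk in *. eapply Rle_trans; [exact Hz|apply Rmax_r].
  + intros j. unfold X.
    apply (C_cvg_ext (fun m => w1 j * iterT lambda b j (hsum (fun k => HC_scal (w2 k) (iterT lambda b k f)) m) z)%C).
    * intros m. rewrite (linear_hsum _ _ _ (iterT_linear lambda b j)), hsum_csum, <- csum_scal.
      apply csum_ext. intros k _. unfold x. rewrite (proj2 (iterT_linear lambda b j)).
      unfold iterT. rewrite Nat.iter_add. simpl. ring.
    * apply C_cvg_scal, iterT_cvg. intros r' e' He'. destruct (H2 f r' e' He') as [N HN].
      exists N. intros m Hm v Hv. rewrite hsum_csum. now apply (HN m).
- apply (HN2 n); [lia|exact Hz].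
Qed.

Lemma is_pseries_C_cvg (w : nat -> C) z l :
  @is_pseries C_AbsRing C_NormedModule w z l <-> C_cvg (csum (fun k => w k * z ^ k)%C) l.
Proof.
assert (E : forall n, sum_n (G:=C_NormedModule) (fun k => scal (pow_n (K:=C_AbsRing) z k) (w k)) n =
  csum (fun k => w k * z ^ k)%C (S n)).
{ intros n. etransitivity; [exact (sum_n_csum (fun k => scal (pow_n (K:=C_AbsRing) z k) (w k)) n)|].
  apply csum_ext. intros k _.
  replace (pow_n (K:=C_AbsRing) z k) with (z ^ k)%C; [apply Cmult_comm|].
  induction k as [|k IH]; [reflexivity|]. simpl. now rewrite IH. }
split.
- intros H eps He.
  assert (He2 : 0 < eps / 2) by lra.
  assert (Hb := proj1 (filterlim_locally (U:=C_UniformSpace) _ l) H (mkposreal _ He2)).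
  destruct Hb as [N HN]. exists (S N). intros [|n] Hn; [lia|].
  destruct (HN n ltac:(lia)) as [B1 B2]. rewrite E in B1, B2.
  eapply Rle_trans; [apply (Cmod_le_abs (fst (csum (fun k => w k * z ^ k)%C (S n)) - fst l)
    (snd (csum (fun k => w k * z ^ k)%C (S n)) - snd l))|].
  change (Rabs (fst (csum (fun k => w k * z ^ k)%C (S n)) - fst l) < eps / 2) in B1.
  change (Rabs (snd (csum (fun k => w k * z ^ k)%C (S n)) - snd l) < eps / 2) in B2. lra.
- intros H. apply (proj2 (filterlim_locally (U:=C_UniformSpace) _ l)). intros eps.
  assert (He := cond_pos eps). destruct (H (eps / 2) ltac:(lra)) as [N HN].
  exists N. intros n Hn. specialize (HN (S n) ltac:(lia)). rewrite E.
  split.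
  + apply Rle_lt_trans with (eps / 2); [|lra]. eapply Rle_trans; [apply (Cmod_fst (csum _ _ - l)%C)|exact HN].
  + apply Rle_lt_trans with (eps / 2); [|lra]. eapply Rle_trans; [apply (Cmod_snd (csum _ _ - l)%C)|exact HN].
Qed.

Lemma pseries_coef_bound (w : nat -> C) (g : C -> C) z :
  (forall z, C_cvg (csum (fun k => w k * z ^ k)%C) (g z)) ->
  exists A, 0 <= A /\ forall k, Cmod (w k) * Cmod z ^ k <= A.
Proof.
intros H. destruct (csum_cvg_terms_bounded _ _ (H z)) as [A [HA HAk]].
exists A. split; [exact HA|]. intros k. rewrite <- Cmod_pow, <- Cmod_mult. apply HAk.
Qed.

Lemma pseries_conv w1 w2 (g1 g2 : C -> C) :
  (forall z, C_cvg (csum (fun k => w1 k * z ^ k)%C) (g1 z)) ->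
  (forall z, C_cvg (csum (fun k => w2 k * z ^ k)%C) (g2 z)) ->
  forall z, C_cvg (csum (fun k => conv w1 w2 k * z ^ k)%C) (g1 z * g2 z)%C.
Proof.
intros H1 H2 z.
(* convergence at [4 z] makes the terms at [z] decay like [4^-k] *)
destruct (pseries_coef_bound _ _ (RtoC 4 * z)%C H1) as [A1 [HA1 B1]].
destruct (pseries_coef_bound _ _ (RtoC 4 * z)%C H2) as [A2 [HA2 B2]].
assert (E4 : Cmod (RtoC 4 * z) = 4 * Cmod z) by (rewrite Cmod_mult, Cmod_R, Rabs_pos_eq; lra).
assert (G : forall w A k, (forall k, Cmod (w k) * Cmod (RtoC 4 * z) ^ k <= A) ->
  Cmod (w k * z ^ k)%C <= A * (/ 4) ^ k).
{ intros w A k H. specialize (H k). rewrite E4, Rpow_mult_distr in H.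
  rewrite Cmod_mult, Cmod_pow.
  replace (Cmod (w k) * Cmod z ^ k) with (Cmod (w k) * (4 ^ k * Cmod z ^ k) * (/ 4) ^ k).
  - apply Rmult_le_compat_r; [apply pow_le; lra|exact H].
  - replace (Cmod (w k) * (4 ^ k * Cmod z ^ k) * (/ 4) ^ k) with
      (Cmod (w k) * Cmod z ^ k * (4 * / 4) ^ k) by (rewrite Rpow_mult_distr; ring).
    replace (4 * / 4) with 1 by field. rewrite pow1. ring. }
set (x := fun j k => ((w1 j * z ^ j) * (w2 k * z ^ k))%C).
set (X := fun j => (g2 z * (w1 j * z ^ j))%C).
intros eps He.
destruct (pow_half_small (2 * (A1 * A2)) (eps / 2)) as [N1 HN1]; [|lra|].
{ assert (0 <= A1 * A2) by now apply Rmult_le_pos. lra. }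
destruct (C_cvg_scal (g2 z) _ _ (H1 z) (eps / 2) ltac:(lra)) as [N2 HN2].
exists (max N1 N2). intros n Hn.
replace (csum (fun k => conv w1 w2 k * z ^ k)%C n - g1 z * g2 z)%C with
  ((csum (fun m => csum (fun i => x i (m - i)%nat) (S m)) n - csum X n) + (csum X n - g2 z * g1 z))%C.
2:{ replace (csum (fun k => conv w1 w2 k * z ^ k)%C n) with
     (csum (fun m => csum (fun i => x i (m - i)%nat) (S m)) n); [ring|].
    apply csum_ext. intros m _. unfold conv. rewrite Cmult_comm, <- csum_scal. apply csum_ext.
    intros i Hi. unfold x. replace (z ^ m)%C with (z ^ i * z ^ (m - i))%C; [ring|].
    rewrite <- Cpow_add_r. f_equal. lia. }
replace eps with (eps / 2 + eps / 2) by field. apply Cmod_plus_le.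
- eapply Rle_trans; [apply (double_series_remainder x X (A1 * A2) n)|apply HN1; lia].
  + now apply Rmult_le_pos.
  + intros j k. unfold x. rewrite Cmod_mult, pow_add.
    replace (A1 * A2 * ((/ 4) ^ j * (/ 4) ^ k)) with ((A1 * (/ 4) ^ j) * (A2 * (/ 4) ^ k)) by ring.
    apply Rmult_le_compat; try apply Cmod_ge_0; now apply G.
  + intros j. unfold X, x.
    apply (C_cvg_ext (fun m => (w1 j * z ^ j) * csum (fun k => w2 k * z ^ k) m)%C).
    { intros m. now rewrite csum_scal. }
    rewrite (Cmult_comm (g2 z)). apply C_cvg_scal, H2.
- unfold X. rewrite csum_scal. apply HN2. lia.
Qed.

Lemma scaled_half eps x (y : C) : 0 <= x ->
  Cmod y <= eps / (2 * (x + 1)) -> x * Cmod y <= eps / 2.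
Proof.
intros Hx Hy. apply Rle_trans with ((x + 1) * (eps / (2 * (x + 1)))).
- apply Rmult_le_compat; try lra. apply Cmod_ge_0.
- right; field; lra.
Qed.

Lemma lu_cvg_linear_comb a c (u v : nat -> C -> C) g h : lu_cvg u g -> lu_cvg v h ->
  lu_cvg (fun n z => a * u n z + c * v n z)%C (fun z => a * g z + c * h z)%C.
Proof.
intros Hu Hv r eps He.
assert (Ha := Cmod_ge_0 a). assert (Hc := Cmod_ge_0 c).
destruct (Hu r (eps / (2 * (Cmod a + 1)))) as [N1 H1]; [apply Rdiv_lt_0_compat; lra|].
destruct (Hv r (eps / (2 * (Cmod c + 1)))) as [N2 H2]; [apply Rdiv_lt_0_compat; lra|].
exists (max N1 N2). intros n Hn z Hz.
replace (a * u n z + c * v n z - (a * g z + c * h z))%C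
  with (a * (u n z - g z) + c * (v n z - h z))%C by ring.
replace eps with (eps / 2 + eps / 2) by field.
apply Cmod_plus_le; rewrite Cmod_mult; apply scaled_half; try assumption.
- apply (H1 n); [lia|exact Hz].
- apply (H2 n); [lia|exact Hz].
Qed.

Lemma series_op_linear_comb lambda b a c w1 w2 S1 S2 :
  series_op lambda b w1 S1 -> series_op lambda b w2 S2 ->
  series_op lambda b (fun k => a * w1 k + c * w2 k)%C (op_plus (op_scal a S1) (op_scal c S2)).
Proof.
intros H1 H2 f r eps He.
destruct (lu_cvg_linear_comb a c _ _ _ _ (H1 f) (H2 f) r eps He) as [N HN].
exists N. intros n Hn z Hz. specialize (HN n Hn z Hz).
rewrite (csum_ext _ (fun k => a * (w1 k * iterT lambda b k f z) + c * (w2 k * iterT lambda b k f z))%C)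
  by (intros; ring).
rewrite csum_plus, !csum_scal. exact HN.
Qed.

Lemma pseries_linear_comb a c w1 w2 (g1 g2 : C -> C) z :
  C_cvg (csum (fun k => w1 k * z ^ k)%C) (g1 z) -> C_cvg (csum (fun k => w2 k * z ^ k)%C) (g2 z) ->
  C_cvg (csum (fun k => (a * w1 k + c * w2 k) * z ^ k)%C) (a * g1 z + c * g2 z)%C.
Proof.
intros H1 H2.
apply (C_cvg_ext (fun n => a * csum (fun k => w1 k * z ^ k) n + c * csum (fun k => w2 k * z ^ k) n)%C).
- intros n. rewrite <- !csum_scal, <- csum_plus. apply csum_ext. intros; ring.
- now apply C_cvg_plus; apply C_cvg_scal.
Qed.

Lemma HC_linear_comb a c S1 S2 : HC_linear S1 -> HC_linear S2 ->
  HC_linear (op_plus (op_scal a S1) (op_scal c S2)).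
Proof.
intros [P1 Q1] [P2 Q2]. split; intros; unfold op_plus, op_scal; apply HC_ext; intros z.
- rewrite P1, P2. simpl. ring.
- rewrite Q1, Q2. simpl. ring.
Qed.

Lemma HC_continuous_linear_comb a c S1 S2 : HC_continuous S1 -> HC_continuous S2 ->
  HC_continuous (op_plus (op_scal a S1) (op_scal c S2)).
Proof.
rewrite !HC_continuous_disk. intros H1 H2 f r eps He.
assert (Ha := Cmod_ge_0 a). assert (Hc := Cmod_ge_0 c).
destruct (H1 f r (eps / (2 * (Cmod a + 1)))) as [r1 [d1 [Hd1 G1]]]; [apply Rdiv_lt_0_compat; lra|].
destruct (H2 f r (eps / (2 * (Cmod c + 1)))) as [r2 [d2 [Hd2 G2]]]; [apply Rdiv_lt_0_compat; lra|].
exists (Rmax r1 r2), (Rmin d1 d2). split; [now apply Rmin_pos|]. intros g Hg z Hz.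
assert (Hg1 : near r1 d1 f g) by (revert Hg; apply near_le; [apply Rmax_l|apply Rmin_l]).
assert (Hg2 : near r2 d2 f g) by (revert Hg; apply near_le; [apply Rmax_r|apply Rmin_r]).
unfold op_plus, op_scal. simpl.
replace (a * S1 g z + c * S2 g z - (a * S1 f z + c * S2 f z))%C
  with (a * (S1 g z - S1 f z) + c * (S2 g z - S2 f z))%C by ring.
replace eps with (eps / 2 + eps / 2) by field.
apply Cmod_plus_le; rewrite Cmod_mult; apply scaled_half; try assumption.
- now apply (G1 g Hg1).
- now apply (G2 g Hg2).
Qed.

Lemma psi_algebra_linear_comb lambda b a c S1 S2 :
  psi_algebra lambda b S1 -> psi_algebra lambda b S2 ->
  psi_algebra lambda b (op_plus (op_scal a S1) (op_scal c S2)).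
Proof.
intros [p1 [w1 [E1 [Z1 [H1 [L1 C1]]]]]] [p2 [w2 [E2 [Z2 [H2 [L2 C2]]]]]].
exists (HC_plus (HC_scal a p1) (HC_scal c p2)), (fun k => a * w1 k + c * w2 k)%C.
split; [|split; [|split; [|split]]].
- intros z. apply is_pseries_C_cvg, (pseries_linear_comb a c w1 w2 p1 p2); now apply is_pseries_C_cvg.
- simpl. rewrite Z1, Z2. ring.
- apply is_series_op_iff, series_op_linear_comb; now apply is_series_op_iff.
- now apply HC_linear_comb.
- now apply HC_continuous_linear_comb.
Qed.

Lemma psi_algebra_comp lambda b S1 S2 :
  psi_algebra lambda b S1 -> psi_algebra lambda b S2 -> psi_algebra lambda b (op_comp S1 S2).
Proof.
intros [p1 [w1 [E1 [Z1 [H1 [L1 C1]]]]]] [p2 [w2 [E2 [Z2 [H2 [L2 C2]]]]]].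
assert (Hent : entire (fun z => p1 z * p2 z)%C).
{ apply (entire_cderiv _ (fun z => C_derive p1 z * p2 z + p1 z * C_derive p2 z)%C).
  intros z. apply cderiv_mult; apply cderiv_HC. }
exists (mkHC _ Hent), (conv w1 w2).
split; [|split; [|split; [|split]]].
- intros z. apply is_pseries_C_cvg, (pseries_conv w1 w2 p1 p2); intros v; now apply is_pseries_C_cvg.
- simpl. rewrite Z1. ring.
- apply is_series_op_iff, series_op_comp; now apply is_series_op_iff.
- destruct L1 as [P1 Q1], L2 as [P2 Q2].
  split; intros; unfold op_comp; [now rewrite P2, P1|now rewrite Q2, Q1].
- intros f. exact (filterlim_comp _ _ _ S2 S1 _ _ _ (C2 f) (C1 (S2 f))).
Qed.

Lemma psi_algebra_zero lambda b : psi_algebra lambda b op_zero.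
Proof.
exists HC_zero, (fun _ => RtoC 0).
split; [|split; [|split; [|split]]].
- intros z. apply is_pseries_C_cvg. apply (C_cvg_ext (fun _ => RtoC 0)); [|apply C_cvg_const].
  intros n. symmetry. apply csum_zero. intros; ring.
- reflexivity.
- apply is_series_op_iff. intros f r eps He. exists 0%nat. intros n _ z _.
  rewrite csum_zero by (intros; ring). simpl.
  replace (0 - 0)%C with (RtoC 0) by ring. rewrite Cmod_0. lra.
- split; intros; unfold op_zero; apply HC_ext; intros z; simpl; ring.
- apply HC_continuous_disk. intros f r eps He. exists 0, 1. split; [lra|].
  intros g _. apply near_refl. lra.
Qed.

Theorem psi_algebra_is_algebra lambda b : operator_algebra (psi_algebra lambda b).
Proof.
assert (E1 : forall S1 S2, op_plus (op_scal 1 S1) (op_scal 1 S2) = op_plus S1 S2).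
{ intros. apply functional_extensionality. intros f. apply HC_ext. intros z.
  unfold op_plus, op_scal. simpl. ring. }
assert (E2 : forall c S, op_plus (op_scal c S) (op_scal 0 S) = op_scal c S).
{ intros. apply functional_extensionality. intros f. apply HC_ext. intros z.
  unfold op_plus, op_scal. simpl. ring. }
split; [apply psi_algebra_zero|split; [|split]].
- intros S1 S2 H1 H2. rewrite <- E1. now apply psi_algebra_linear_comb.
- intros c S H. rewrite <- E2. now apply psi_algebra_linear_comb.
- intros S1 S2. apply psi_algebra_comp.
Qed.

(** * Powers of a symbol *)

(** The coefficients of the [n]-th power of the series with coefficients [w]. *)
Fixpoint cpow (w : nat -> C) (n : nat) : nat -> C :=
  match n with
  | O => fun k => match k with O => RtoC 1 | S _ => RtoC 0 end
  | S m => conv w (cpow w m)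
  end.

Lemma series_op_iter lambda b w S n : series_op lambda b w S ->
  series_op lambda b (cpow w n) (Nat.iter n S).
Proof.
intros H. induction n as [|n IH].
- intros f r eps He. exists 1%nat. intros n Hn z _.
  rewrite (csum_one_term _ _ 0%nat) by (lia || (intros [|i] Hi Hne; [lia|simpl; ring])).
  simpl. replace (1 * f z - f z)%C with (RtoC 0) by ring. rewrite Cmod_0. lra.
- exact (series_op_comp _ _ _ _ _ _ H IH).
Qed.

Lemma csum_geometric_bound a A n : 0 <= A -> (forall i, Cmod (a i) <= A * (/ 2) ^ i) ->
  Cmod (csum a n) <= 2 * A.
Proof.
intros HA H. assert (G : Cmod (csum a n) <= 2 * A * (1 - (/ 2) ^ n)).
{ induction n as [|n IH].
  - simpl. rewrite Cmod_0. lra.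
  - simpl csum. eapply Rle_trans; [apply Cmod_plus_le; [exact IH|apply H]|].
    simpl. lra. }
assert (0 <= A * (/ 2) ^ n) by (apply Rmult_le_pos; [exact HA|apply pow_le; lra]). lra.
Qed.

Lemma cpow_bound w A n : 0 <= A -> (forall k, Cmod (w k) <= A * (/ 2) ^ k) ->
  forall k, Cmod (cpow w n k) <= (2 * A) ^ n.
Proof.
intros HA Hw. induction n as [|n IH]; intros k.
- destruct k; simpl; [rewrite Cmod_1|rewrite Cmod_0]; lra.
- simpl cpow. unfold conv. replace ((2 * A) ^ S n) with (2 * (A * (2 * A) ^ n)) by (simpl; ring).
  apply csum_geometric_bound.
  + apply Rmult_le_pos; [exact HA|apply pow_le; lra].
  + intros i. rewrite Cmod_mult.
    replace (A * (2 * A) ^ n * (/ 2) ^ i) with (A * (/ 2) ^ i * (2 * A) ^ n) by ring.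
    apply Rmult_le_compat; try apply Cmod_ge_0; [apply Hw|apply IH].
Qed.

Lemma cpow_low w m n : (forall k, (k < m)%nat -> w k = RtoC 0) ->
  (forall k, (k < m * n)%nat -> cpow w n k = RtoC 0) /\ cpow w n (m * n) = (w m ^ n)%C.
Proof.
intros Hw. induction n as [|n [IH1 IH2]].
- split; [intros k Hk; lia|]. rewrite Nat.mul_0_r. reflexivity.
- rewrite Nat.mul_succ_r. simpl cpow. unfold conv. split.
  + intros k Hk. apply csum_zero. intros i Hi.
    destruct (Nat.lt_ge_cases i m) as [L|L].
    * rewrite Hw by exact L. ring.
    * rewrite IH1 by lia. ring.
  + rewrite (csum_one_term _ _ m).
    * replace (m * n + m - m)%nat with (m * n)%nat by lia. rewrite IH2. reflexivity.
    * lia.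
    * intros i Hi Hne. destruct (Nat.lt_ge_cases i m) as [L|L].
      -- rewrite Hw by exact L. ring.
      -- rewrite IH1 by lia. ring.
Qed.

(** * The operators on polynomials *)

Lemma Dn_TH lambda b k (f : HC) : forall z,
  Dn k (TH lambda b f) z = (lambda ^ k * Dn (S k) f (lambda * z + b))%C.
Proof.
induction k as [|k IH]; intros z; [symmetry; apply Cmult_1_l|].
apply (C_derive_eq (Dn k (TH lambda b f))).
apply (cderiv_ext (fun w => lambda ^ k * Dn (S k) f (lambda * w + b))%C); [intros w; now rewrite IH|].
apply (cderiv_eq _ _ (lambda ^ k * (Dn (S (S k)) f (lambda * z + b) * lambda))%C); [|rewrite Cpow_S; ring].
apply cderiv_scal, (cderiv_comp (Dn (S k) f) (fun w => lambda * w + b)%C);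
  [apply cderiv_D|apply cderiv_affine].
Qed.

Lemma is_poly_TH lambda b d f : is_poly (S d) f -> is_poly d (TH lambda b f).
Proof.
intros H. apply HC_ext. intros z. rewrite Dn_TH. rewrite H. simpl. ring.
Qed.

Lemma is_poly_iterT lambda b k d f : is_poly (k + d) f -> is_poly d (iterT lambda b k f).
Proof.
revert d. induction k as [|k IH]; intros d H; [exact H|].
apply (is_poly_TH lambda b d (iterT lambda b k f)). apply IH.
now replace (k + S d)%nat with (S k + d)%nat by lia.
Qed.

Lemma iterT_poly_zero lambda b d k f : (d <= k)%nat -> is_poly d f -> iterT lambda b k f = HC_zero.
Proof.
intros Hk H. apply HC_ext. intros z. rewrite iterT_formula.
rewrite (is_poly_le d k f Hk H). simpl. ring.
Qed.

Lemma series_op_finite lambda b w S g N : series_op lambda b w S ->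
  (forall k, (N <= k)%nat -> iterT lambda b k g = HC_zero) ->
  S g = hsum (fun k => HC_scal (w k) (iterT lambda b k g)) N.
Proof.
intros HS Hg. apply HC_ext. intros z. rewrite hsum_csum.
apply (C_cvg_unique (csum (fun k => w k * iterT lambda b k g z)%C)).
- now apply (lu_cvg_pointwise (fun n z => csum (fun k => w k * iterT lambda b k g z)%C n)).
- intros eps He. exists N. intros n Hn. replace n with (N + (n - N))%nat by lia.
  rewrite csum_split, (csum_zero _ (n - N)).
  + replace (csum (fun k => w k * iterT lambda b k g z)%C N + 0 -
      csum (fun i => HC_scal (w i) (iterT lambda b i g) z) N)%C with (RtoC 0) by (simpl; ring).
    rewrite Cmod_0. lra.
  + intros i _. rewrite Hg by lia. simpl. ring.
Qed.

(** * Preimages decaying faster than every geometric sequence *)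

(** Decay beyond every geometric rate: unlike convergence to zero, this is
    stable under multiplication by coefficients of geometric growth. *)
Definition super_small (u : nat -> HC) : Prop :=
  forall r Q, 0 <= Q -> exists B, forall n z, disk r z -> Q ^ n * Cmod (u n z) <= B.

Lemma super_small_zero : super_small (fun _ => HC_zero).
Proof. intros r Q HQ. exists 0. intros n z _. simpl. rewrite Cmod_0. lra. Qed.

Lemma super_small_plus u v : super_small u -> super_small v ->
  super_small (fun n => HC_plus (u n) (v n)).
Proof.
intros Hu Hv r Q HQ. destruct (Hu r Q HQ) as [B1 H1]. destruct (Hv r Q HQ) as [B2 H2].
exists (B1 + B2). intros n z Hz. specialize (H1 n z Hz). specialize (H2 n z Hz).
apply Rle_trans with (Q ^ n * (Cmod (u n z) + Cmod (v n z))).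
- apply Rmult_le_compat_l; [now apply pow_le|apply Cmod_triangle].
- lra.
Qed.

Lemma super_small_scal c u Q0 : 0 <= Q0 -> (forall n, Cmod (c n) <= Q0 ^ n) ->
  super_small u -> super_small (fun n => HC_scal (c n) (u n)).
Proof.
intros HQ0 Hc Hu r Q HQ. destruct (Hu r (Q * Q0)) as [B H]; [now apply Rmult_le_pos|].
exists B. intros n z Hz. eapply Rle_trans; [|apply (H n z Hz)].
simpl. rewrite Cmod_mult, Rpow_mult_distr, Rmult_assoc.
apply Rmult_le_compat_l; [now apply pow_le|]. apply Rmult_le_compat_r; [apply Cmod_ge_0|apply Hc].
Qed.

Lemma super_small_hsum (u : nat -> nat -> HC) d : (forall i, (i < d)%nat -> super_small (u i)) ->
  super_small (fun n => hsum (fun i => u i n) d).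
Proof.
intros H. induction d as [|d IH]; [apply super_small_zero|]. simpl.
apply super_small_plus; [apply IH; intros; apply H; lia|apply H; lia].
Qed.

Lemma pow_fact_bounded x : exists B, 0 <= B /\ forall k, x ^ k / INR (fact k) <= B.
Proof.
destruct (cv_speed_pow_fact x 1 Rlt_0_1) as [N HN].
destruct (prefix_bound (fun n M => x ^ n / INR (fact n) <= M)) with (N := N) as [M [HM0 HM]].
- intros; lra.
- intros n. now exists (x ^ n / INR (fact n)); right.
- exists (M + 1). split; [lra|]. intros k.
  destruct (Nat.lt_ge_cases k N) as [L|L]; [specialize (HM k L); lra|].
  specialize (HN k L). unfold Rdist in HN. rewrite Rminus_0_r in HN.
  assert (T := Rle_abs (x ^ k / INR (fact k))). lra.
Qed.

Lemma fact_ge_1 n : 1 <= INR (fact n).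
Proof. change 1 with (INR 1). apply le_INR. assert (T := lt_O_fact n). lia. Qed.

Lemma poly_growth d q : is_poly d q -> exists A, 0 <= A /\ forall y, Cmod (q y) <= A * exp (INR d * Cmod y).
Proof.
intros Hq.
destruct (prefix_bound (fun n M => Cmod (Dn n q 0) <= M)) with (N := d) as [M [HM0 HM]].
{ intros; lra. }
{ intros n. now exists (Cmod (Dn n q 0)); right. }
exists (INR d * M). split; [apply Rmult_le_pos; [apply pos_INR|exact HM0]|].
intros y. rewrite (poly_eq_taylor d q 0 y Hq). unfold taylor. rewrite hsum_csum, Rmult_assoc.
apply csum_bound. intros i Hi. rewrite HC_scal_apply, Cmod_mult, Cmod_Mono.
assert (Hy := Cmod_ge_0 y).
apply Rmult_le_compat; [apply Cmod_ge_0| |now apply HM|].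
- apply Rmult_le_pos; [apply pow_le, Cmod_ge_0|]. left. apply Rinv_0_lt_compat, fact_pos.
- replace (y - 0)%C with y by ring.
  apply Rle_trans with (Cmod y ^ i).
  + apply Rmult_le_reg_r with (INR (fact i)); [apply fact_pos|].
    replace (Cmod y ^ i / INR (fact i) * INR (fact i)) with (Cmod y ^ i * 1)
      by (field; apply Rgt_not_eq, fact_pos).
    apply Rmult_le_compat_l; [now apply pow_le|apply fact_ge_1].
  + apply Rle_trans with ((1 + Cmod y) ^ d).
    * apply Rle_trans with ((1 + Cmod y) ^ i); [apply pow_incr; lra|apply Rle_pow; [lra|lia]].
    * rewrite <- exp_pow. apply pow_incr. split; [lra|apply exp_ineq1_le].
Qed.

Lemma phin_0_bound lambda b k : 1 <= Cmod lambda ->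
  Cmod (phin lambda b k 0) <= INR k * Cmod b * Cmod lambda ^ k.
Proof.
intros Hl. induction k as [|k IH].
- simpl. rewrite Cmod_0. lra.
- change (phin lambda b (S k) 0) with (lambda * phin lambda b k 0 + b)%C.
  eapply Rle_trans; [apply Cmod_triangle|]. rewrite Cmod_mult, S_INR.
  assert (Hb := Cmod_ge_0 b).
  assert (H1 : Cmod lambda * Cmod (phin lambda b k 0) <= Cmod lambda * (INR k * Cmod b * Cmod lambda ^ k))
    by (apply Rmult_le_compat_l; lra).
  assert (H2 : Cmod b * 1 <= Cmod b * Cmod lambda ^ S k).
  { apply Rmult_le_compat_l; [exact Hb|now apply pow_R1_Rle]. }
  replace ((INR k + 1) * Cmod b * Cmod lambda ^ S k) with
    (Cmod lambda * (INR k * Cmod b * Cmod lambda ^ k) + Cmod b * Cmod lambda ^ S k) by (simpl; ring).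
  lra.
Qed.

(** [T^k a = p] prescribes the [k]-th derivative of [a] as a rescaled translate
    of [p]; integrating [k] times from [0] divides the coefficients by factorials.
    As [|lambda| >= 1], the centre [phi^{-k} 0] is at distance at most
    [k |b|], so the translation costs only a geometric factor. *)
Lemma super_small_T_preimages lambda b d p : 1 <= Cmod lambda -> is_poly d p ->
  exists a : nat -> HC, (forall k, iterT lambda b k (a k) = p) /\ super_small a.
Proof.
intros Hl Hp.
assert (Hl0 : lambda <> 0%C) by (intros ->; rewrite Cmod_0 in Hl; lra).
set (psi := fun k => (- (phin lambda b k 0 / lambda ^ k))%C).
set (coef := fun k i => (/ lambda ^ tri k * ((/ lambda ^ k) ^ i * Dn i p (psi k)))%C).
set (a := fun k => hsum (fun i => HC_scal (coef k i) (Mono 0 (k + i))) d).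
assert (Hinv : forall n, Cmod (/ lambda ^ n) <= 1).
{ intros n. rewrite Cmod_inv by now apply Cpow_nz. rewrite Cmod_pow.
  rewrite <- Rinv_1. apply Rinv_le_contravar; [lra|now apply pow_R1_Rle]. }
exists a. split.
- intros k. apply HC_ext. intros z. rewrite iterT_formula. unfold a.
  rewrite (linear_hsum _ _ _ (Dn_linear k)), hsum_csum, <- csum_scal.
  rewrite (poly_eq_taylor d p (psi k) z Hp). unfold taylor. rewrite hsum_csum.
  apply csum_ext. intros i _. rewrite (proj2 (Dn_linear k)), Dn_Mono.
  rewrite !HC_scal_apply. simpl (HC_fun (Mono _ _)). cbv beta.
  replace (phin lambda b k z - 0)%C with (lambda ^ k * (z - psi k))%C.
  2:{ rewrite phin_affine. unfold psi. field. now apply Cpow_nz. }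
  unfold coef. rewrite Cpow_mult_l, (Cpow_inv _ i) by now apply Cpow_nz.
  field. repeat split; now repeat apply Cpow_nz.
- intros r Q HQ.
  destruct (prefix_bound (fun i M => forall y, Cmod (Dn i p y) <= M * exp (INR d * Cmod y))) with (N := d)
    as [A [HA0 HA]].
  { intros n M M' HM H y. eapply Rle_trans; [apply H|]. apply Rmult_le_compat_r; [left; apply exp_pos|exact HM]. }
  { intros i. destruct (poly_growth d (Dn i p)) as [A [_ H]].
    - unfold is_poly, Dn. rewrite <- Nat.iter_add, Nat.add_comm, Nat.iter_add.
      change (Nat.iter d HC_D p) with (Dn d p). rewrite Hp. apply (Dn_zero i).
    - now exists A. }
  set (E := exp (INR d * Cmod b)). set (R0 := Rmax r 1).
  assert (HE : 0 < E) by apply exp_pos.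
  assert (HR1 : 1 <= R0) by apply Rmax_r.
  assert (HRr : r <= R0) by apply Rmax_l.
  destruct (pow_fact_bounded (Q * (E * R0))) as [B [HB0 HB]].
  exists (INR d * (A * R0 ^ d * B)). intros k z Hz.
  replace (Q ^ k * Cmod (a k z)) with (Cmod (RtoC (Q ^ k) * a k z)).
  2:{ rewrite Cmod_mult, Cmod_R, Rabs_pos_eq; [reflexivity|now apply pow_le]. }
  unfold a. rewrite hsum_csum, <- csum_scal. apply csum_bound. intros i Hi.
  rewrite HC_scal_apply, !Cmod_mult, Cmod_Mono, Cmod_R, Rabs_pos_eq by now apply pow_le.
  assert (Hpsi : Cmod (psi k) <= INR k * Cmod b).
  { unfold psi. rewrite Cmod_opp, Cmod_div, Cmod_pow by now apply Cpow_nz.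
    assert (Hlk : 0 < Cmod lambda ^ k) by (apply pow_lt; lra).
    apply Rmult_le_reg_r with (Cmod lambda ^ k); [exact Hlk|].
    replace (Cmod (phin lambda b k 0) / Cmod lambda ^ k * Cmod lambda ^ k)
      with (Cmod (phin lambda b k 0)) by (field; lra).
    now apply phin_0_bound. }
  assert (Hcoef : Cmod (coef k i) <= A * E ^ k).
  { unfold coef. rewrite !Cmod_mult, Cmod_pow.
    assert (HD : Cmod (Dn i p (psi k)) <= A * E ^ k).
    { eapply Rle_trans; [now apply HA|]. apply Rmult_le_compat_l; [exact HA0|].
      unfold E. rewrite exp_pow.
      assert (X : INR d * Cmod (psi k) <= INR k * (INR d * Cmod b)).
      { replace (INR k * (INR d * Cmod b)) with (INR d * (INR k * Cmod b)) by ring.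
        apply Rmult_le_compat_l; [apply pos_INR|exact Hpsi]. }
      destruct X as [X|X]; [left; now apply exp_increasing|right; now rewrite X]. }
    rewrite <- (Rmult_1_l (A * E ^ k)). apply Rmult_le_compat; try apply Cmod_ge_0.
    - apply Rmult_le_pos; [apply pow_le|]; apply Cmod_ge_0.
    - apply Hinv.
    - rewrite <- (Rmult_1_l (A * E ^ k)).
      apply Rmult_le_compat; [apply pow_le, Cmod_ge_0|apply Cmod_ge_0| |exact HD].
      apply pow_le_1. split; [apply Cmod_ge_0|apply Hinv]. }
  assert (Hmono : Cmod (z - 0) ^ (k + i) / INR (fact (k + i)) <= R0 ^ d * (R0 ^ k / INR (fact k))).
  { replace (z - 0)%C with z by ring.
    assert (F1 := fact_pos k). assert (F2 := fact_pos (k + i)).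
    replace (R0 ^ d * (R0 ^ k / INR (fact k))) with (R0 ^ (k + d) * / INR (fact k))
      by (rewrite pow_add; field; lra).
    apply Rmult_le_compat; [apply pow_le, Cmod_ge_0|left; now apply Rinv_0_lt_compat| |].
    - apply Rle_trans with (R0 ^ (k + i)).
      + apply pow_incr. split; [apply Cmod_ge_0|unfold disk in Hz; lra].
      + apply Rle_pow; [exact HR1|lia].
    - apply Rinv_le_contravar; [exact F1|]. apply le_INR, fact_le. lia. }
  apply Rle_trans with (Q ^ k * (A * E ^ k * (R0 ^ d * (R0 ^ k / INR (fact k))))).
  + apply Rmult_le_compat_l; [now apply pow_le|].
    apply Rmult_le_compat; [apply Cmod_ge_0| |exact Hcoef|exact Hmono].
    apply Rmult_le_pos; [apply pow_le, Cmod_ge_0|]. left. apply Rinv_0_lt_compat, fact_pos.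
  + replace (Q ^ k * (A * E ^ k * (R0 ^ d * (R0 ^ k / INR (fact k))))) with
      (A * R0 ^ d * ((Q * (E * R0)) ^ k / INR (fact k)))
      by (rewrite !Rpow_mult_distr; field; apply Rgt_not_eq, fact_pos).
    apply Rmult_le_compat_l; [|apply HB]. apply Rmult_le_pos; [exact HA0|apply pow_le; lra].
Qed.

Lemma indexed_choice (A : Type) (a0 : A) (P : nat -> A -> Prop) d :
  (forall i, (i < d)%nat -> exists x, P i x) -> exists u : nat -> A, forall i, (i < d)%nat -> P i (u i).
Proof.
intros H.
assert (H' : forall i, exists x, (i < d)%nat -> P i x).
{ intros i. destruct (Nat.lt_ge_cases i d) as [L|L].
  - destruct (H i L) as [x Hx]. now exists x.
  - exists a0. lia. }
exists (fun i => proj1_sig (constructive_indefinite_description _ (H' i))).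
intros i Hi. now apply (proj2_sig (constructive_indefinite_description _ (H' i))).
Qed.

(** [w_m^{-n}] times a [T^{m n}]-preimage of [p] is mapped by [S^n] to [p] plus a
    combination of [T p], [T^2 p], ..., whose coefficients grow at most
    geometrically in [n]; these have lower degree and are corrected by induction. *)
Lemma super_small_preimages lambda b w S m A : 1 <= Cmod lambda ->
  series_op lambda b w S -> HC_linear S ->
  (1 <= m)%nat -> (forall k, (k < m)%nat -> w k = RtoC 0) -> w m <> RtoC 0 ->
  0 <= A -> (forall k, Cmod (w k) <= A * (/ 2) ^ k) ->
  forall d p, is_poly d p ->
  exists g : nat -> HC, (forall n, Nat.iter n S (g n) = p) /\ super_small g.
Proof.
intros Hl HS HL Hm Hw0 Hwm HA Hw. induction d as [|d IH]; intros p Hp.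
- exists (fun _ => HC_zero). split; [|apply super_small_zero]. intros n.
  unfold is_poly, Dn in Hp. simpl in Hp. rewrite Hp.
  apply HC_linear_zero. now apply HC_linear_iter.
- destruct (super_small_T_preimages lambda b (Datatypes.S d) p Hl Hp) as [a [Ha Hsm]].
  destruct (indexed_choice (nat -> HC) (fun _ => HC_zero)
    (fun j g => (forall n, Nat.iter n S (g n) = iterT lambda b (Datatypes.S j) p) /\ super_small g) d) as [G HG].
  { intros j Hj. apply IH. apply is_poly_iterT. apply (is_poly_le (Datatypes.S d)); [lia|exact Hp]. }
  set (q := (/ Cmod (w m))).
  assert (Hwm0 : 0 < Cmod (w m)) by now apply Cmod_gt_0.
  assert (Hq : 0 < q) by now apply Rinv_0_lt_compat.
  assert (Hwn : forall n, (w m ^ n)%C <> 0%C) by (intros n; now apply Cpow_nz).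
  assert (Hcn : forall n, Cmod (/ w m ^ n) = q ^ n).
  { intros n. rewrite Cmod_inv by apply Hwn. rewrite Cmod_pow. symmetry. apply pow_inv. }
  set (c := fun j n => (- (/ w m ^ n * cpow w n (m * n + Datatypes.S j)))%C).
  set (h := fun n => HC_scal (/ w m ^ n) (a (m * n)%nat)).
  assert (Hh : forall n, Nat.iter n S (h n) =
    HC_plus p (hsum (fun j => HC_scal (- c j n) (iterT lambda b (Datatypes.S j) p)) d)).
  { intros n. destruct (HC_linear_iter S n HL) as [_ Hsc]. unfold h. rewrite Hsc.
    destruct (cpow_low w m n Hw0) as [Hlow Htop].
    assert (HTj : forall j, iterT lambda b (m * n + j) (a (m * n)%nat) = iterT lambda b j p).
    { intros j. rewrite Nat.add_comm. unfold iterT. rewrite Nat.iter_add.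
      change (Nat.iter (m * n) (TH lambda b) (a (m * n)%nat)) with (iterT lambda b (m * n) (a (m * n)%nat)).
      now rewrite Ha. }
    rewrite (series_op_finite _ _ _ _ _ (m * n + Datatypes.S d) (series_op_iter _ _ _ _ n HS)).
    - apply HC_ext. intros z. rewrite HC_scal_apply, hsum_csum, csum_split.
      rewrite (csum_zero _ (m * n)).
      2:{ intros i Hi. cbv beta. rewrite HC_scal_apply, Hlow by exact Hi. ring. }
      rewrite csum_head. change (HC_fun (HC_plus p ?x) z) with (p z + x z)%C.
      rewrite hsum_csum. cbv beta.
      rewrite !HC_scal_apply, HTj, Nat.add_0_r, Htop. change (iterT lambda b 0 p) with p.
      rewrite !Cplus_0_l, Cmult_plus_distr_l. f_equal.
      + field. apply Hwn.
      + rewrite <- csum_scal. apply csum_ext. intros j _. rewrite !HC_scal_apply, HTj. unfold c. ring.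
    - intros k Hk. replace k with (m * n + (k - m * n))%nat by lia. rewrite HTj.
      apply (iterT_poly_zero _ _ (Datatypes.S d)); [lia|exact Hp]. }
  (* the preimages [G j n] of [T^(j + 1) p] cancel the error terms of [h n] *)
  exists (fun n => HC_plus (h n) (hsum (fun j => HC_scal (c j n) (G j n)) d)). split.
  + intros n. destruct (HC_linear_iter S n HL) as [Hpl Hsc].
    rewrite Hpl, Hh, (linear_hsum _ _ _ (HC_linear_iter S n HL)).
    apply HC_ext. intros z.
    change (p z + hsum (fun j => HC_scal (- c j n) (iterT lambda b (Datatypes.S j) p)) d z +
      hsum (fun j => Nat.iter n S (HC_scal (c j n) (G j n))) d z = p z)%C.
    rewrite !hsum_csum, <- Cplus_assoc, <- csum_plus, csum_zero; [ring|].
    intros j Hj. rewrite Hsc, (proj1 (HG j Hj)), !HC_scal_apply. ring.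
  + apply super_small_plus.
    * apply (super_small_scal _ _ q); [lra|intros n; rewrite Hcn; lra|].
      intros r Q HQ. assert (HM := Rmax_l Q 1). assert (HM1 := Rmax_r Q 1).
      destruct (Hsm r (Rmax Q 1)) as [B HB]; [lra|].
      exists B. intros n z Hz. eapply Rle_trans; [|apply (HB (m * n)%nat z Hz)].
      apply Rmult_le_compat_r; [apply Cmod_ge_0|].
      apply Rle_trans with (Rmax Q 1 ^ n); [apply pow_incr; lra|].
      apply Rle_pow; [exact HM1|]. nia.
    * apply (super_small_hsum (fun j n => HC_scal (c j n) (G j n))). intros j Hj.
      apply (super_small_scal _ _ (q * (2 * A))); [apply Rmult_le_pos; lra| |apply (HG j Hj)].
      intros n. unfold c. rewrite Cmod_opp, Cmod_mult, Hcn, Rpow_mult_distr.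
      apply Rmult_le_compat_l; [apply pow_le; lra|]. now apply cpow_bound.
Qed.

(** * A hypercyclicity criterion *)

Definition rational_code (y : nat) : R :=
  let (p, q) := Cantor.of_nat y in let (p1, p2) := Cantor.of_nat p in
  (INR p1 - INR p2) / (INR q + 1).

Lemma rational_code_dense t eps : 0 < eps -> exists y, Rabs (rational_code y - t) <= eps.
Proof.
intros He. destruct (INR_unbounded (/ eps)) as [q Hq].
assert (Hq0 := pos_INR q).
destruct (archimed (t * (INR q + 1))) as [H1 H2].
set (p := up (t * (INR q + 1))) in *.
exists (Cantor.to_nat (Cantor.to_nat (Z.to_nat p, Z.to_nat (- p)), q)).
unfold rational_code. rewrite !Cantor.cancel_of_to.
assert (E : INR (Z.to_nat p) - INR (Z.to_nat (- p)) = IZR p).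
{ rewrite !INR_IZR_INZ, <- minus_IZR. f_equal. lia. }
rewrite E.
replace (IZR p / (INR q + 1) - t) with ((IZR p - t * (INR q + 1)) * / (INR q + 1)) by (field; lra).
rewrite Rabs_mult, (Rabs_pos_eq (/ _)) by (left; apply Rinv_0_lt_compat; lra).
rewrite Rabs_pos_eq by lra.
apply Rle_trans with (1 * / (INR q + 1)).
- apply Rmult_le_compat_r; [left; apply Rinv_0_lt_compat; lra|lra].
- rewrite Rmult_1_l, <- (Rinv_inv eps). apply Rinv_le_contravar; [now apply Rinv_0_lt_compat|lra].
Qed.

Definition complex_code (x : nat) : C :=
  let (u, v) := Cantor.of_nat x in (rational_code u, rational_code v).

Lemma complex_code_dense z eps : 0 < eps -> exists x, Cmod (complex_code x - z) <= eps.
Proof.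
intros He. destruct (rational_code_dense (fst z) (eps / 2)) as [u Hu]; [lra|].
destruct (rational_code_dense (snd z) (eps / 2)) as [v Hv]; [lra|].
exists (Cantor.to_nat (u, v)). unfold complex_code. rewrite Cantor.cancel_of_to.
eapply Rle_trans; [apply (Cmod_le_abs (rational_code u - fst z) (rational_code v - snd z))|lra].
Qed.

(** An enumeration of the polynomials of degree less than [d] whose coefficients
    in the basis [Mono 0 i] have rational real and imaginary parts. *)
Fixpoint poly_code (d a : nat) : HC :=
  match d with
  | O => HC_zero
  | S e => let (a', x) := Cantor.of_nat a in
           HC_plus (poly_code e a') (HC_scal (complex_code x) (Mono 0 e))
  end.

Lemma is_poly_code d : forall a, is_poly d (poly_code d a).
Proof.
induction d as [|d IH]; intros a; [reflexivity|]. simpl. destruct (Cantor.of_nat a) as [a' x].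
apply is_poly_plus; [apply (is_poly_le d); [lia|apply IH]|]. apply is_poly_scal, is_poly_Mono.
Qed.

Lemma poly_code_dense (c : nat -> C) r d : forall eps, 0 < eps ->
  exists a, near r eps (hsum (fun i => HC_scal (c i) (Mono 0 i)) d) (poly_code d a).
Proof.
induction d as [|d IH]; intros eps He.
- exists 0%nat. apply near_refl. lra.
- destruct (IH (eps / 2) ltac:(lra)) as [a Ha].
  destruct (entire_bounded_on (Mono 0 d) r (HC_entire _)) as [B [HB0 HB]].
  destruct (complex_code_dense (c d) (eps / 2 / (B + 1))) as [x Hx].
  { apply Rdiv_lt_0_compat; lra. }
  exists (Cantor.to_nat (a, x)). cbn [poly_code]. rewrite Cantor.cancel_of_to.
  intros z Hz.
  change (Cmod (poly_code d a z + complex_code x * Mono 0 d z -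
    (hsum (fun i => HC_scal (c i) (Mono 0 i)) d z + c d * Mono 0 d z)) <= eps).
  replace (poly_code d a z + complex_code x * Mono 0 d z -
    (hsum (fun i => HC_scal (c i) (Mono 0 i)) d z + c d * Mono 0 d z))%C with
    ((poly_code d a z - hsum (fun i => HC_scal (c i) (Mono 0 i)) d z) +
     (complex_code x - c d) * Mono 0 d z)%C by ring.
  replace eps with (eps / 2 + eps / 2) by field. apply Cmod_plus_le; [now apply Ha|].
  rewrite Cmod_mult. apply Rle_trans with (eps / 2 / (B + 1) * (B + 1)).
  + apply Rmult_le_compat; try apply Cmod_ge_0; [exact Hx|].
    eapply Rle_trans; [now apply HB|lra].
  + right. field. lra.
Qed.

Lemma poly_code_dense_HC (f : HC) r eps : 0 <= r -> 0 < eps ->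
  exists d a, near r eps f (poly_code d a).
Proof.
intros Hr He. destruct (taylor_cvg f r (eps / 2) Hr) as [d Hd]; [lra|].
destruct (poly_code_dense (fun i => Dn i f 0) r d (eps / 2)) as [a Ha]; [lra|].
exists d, a. replace eps with (eps / 2 + eps / 2) by field. now apply near_trans with (taylor 0 d f).
Qed.

Lemma HC_continuous_iter S n : HC_continuous S -> HC_continuous (Nat.iter n S).
Proof.
intros HS. induction n as [|n IH]; [intros f; apply filterlim_id|].
intros f. exact (filterlim_comp _ _ _ (Nat.iter n S) S _ _ _ (IH f) (HS (Nat.iter n S f))).
Qed.

(** Given a ball around [f] and a target [q], replace [f] by a nearby polynomial
    [p] and add a small [g] with [S^n g = q], for [n] so large that [S^n p = 0]:
    then [S^n (p + g) = q]. Continuity of [S^n] turns this into a smaller ball,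
    and Baire handles countably many targets at once. *)
Theorem hypercyclicity_criterion S : HC_linear S -> HC_continuous S ->
  (forall d p, is_poly d p -> exists N, forall n, (N <= n)%nat -> Nat.iter n S p = HC_zero) ->
  (forall d p, is_poly d p -> exists g : nat -> HC, (forall n, Nat.iter n S (g n) = p) /\
     forall r eps, 0 < eps -> exists N, forall n, (N <= n)%nat -> bounded_on (g n) r eps) ->
  hypercyclic S.
Proof.
intros HL HC0 Hnil Hpre.
(* the index [j] codes a target polynomial together with a radius and a precision *)
destruct (HC_baire (fun j h => let (da, N) := Cantor.of_nat j in let (d, a) := Cantor.of_nat da in
  exists n, near (INR N) (/ (INR N + 1)) (poly_code d a) (Nat.iter n S h))) as [h Hh].
- intros j f r delta Hdelta.
  destruct (Cantor.of_nat j) as [da N]. destruct (Cantor.of_nat da) as [d a].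
  destruct (taylor_cvg f (Rmax 0 r) (delta / 3) (Rmax_l _ _)) as [e He]; [lra|].
  set (p := taylor 0 e f) in *.
  destruct (Hnil e p (is_poly_taylor _ _ _)) as [N1 HN1].
  destruct (Hpre d (poly_code d a) (is_poly_code d a)) as [g [Hg Hsmall]].
  destruct (Hsmall r (delta / 3)) as [N2 HN2]; [lra|].
  set (n := max N1 N2). set (f' := HC_plus p (g n)).
  assert (Hf' : near r (delta / 3 + delta / 3) f f').
  { apply near_trans with p; [|apply near_plus_l, HN2; lia].
    revert He. apply near_le; [apply Rmax_r|lra]. }
  assert (HSf' : Nat.iter n S f' = poly_code d a).
  { unfold f'. rewrite (proj1 (HC_linear_iter S n HL)), Hg, HN1 by lia.
    apply HC_ext. intros z. simpl. ring. }
  assert (HN0 : 0 < / (INR N + 1)) by (apply Rinv_0_lt_compat; assert (T := pos_INR N); lra).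
  destruct (proj1 (HC_continuous_disk _) (HC_continuous_iter S n HC0) f' (INR N) _ HN0)
    as [r' [d' [Hd' Hcont]]].
  exists f', (Rmax r r'), (Rmin (delta / 3) d'). split; [apply Rmin_pos; lra|].
  intros k Hk. split.
  + replace delta with (delta / 3 + delta / 3 + delta / 3) by field.
    apply near_trans with f'; [exact Hf'|]. revert Hk. apply near_le; [apply Rmax_l|apply Rmin_l].
  + exists n. rewrite <- HSf'. apply Hcont. revert Hk. apply near_le; [apply Rmax_r|apply Rmin_r].
- exists h. intros f P [K [eps [HK HP]]].
  destruct (compactC_subset_disk K HK) as [r [Hr0 Hr]].
  assert (He := cond_pos eps).
  destruct (INR_unbounded (Rmax r (3 / eps))) as [N HN].
  assert (HNr : r <= INR N) by (assert (T := Rmax_l r (3 / eps)); lra).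
  assert (HNe : 3 / eps < INR N) by (assert (T := Rmax_r r (3 / eps)); lra).
  destruct (poly_code_dense_HC f (INR N) (eps / 3)) as [d [a Hda]]; [lra|lra|].
  specialize (Hh (Cantor.to_nat (Cantor.to_nat (d, a), N))).
  rewrite !Cantor.cancel_of_to in Hh. destruct Hh as [n Hn].
  exists (Nat.iter n S h). split; [now exists n|]. apply HP. intros z Hz.
  assert (HzN : disk (INR N) z) by (specialize (Hr z Hz); unfold disk in *; lra).
  apply Rle_lt_trans with (eps / 3 + / (INR N + 1)).
  + apply (near_trans (INR N) (eps / 3) _ f (poly_code d a)); assumption.
  + assert (/ (INR N + 1) <= eps / 3); [|lra].
    replace (eps / 3) with (/ (3 / eps)) by (field; lra).
    apply Rinv_le_contravar; [apply Rdiv_lt_0_compat|]; lra.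
Qed.

(** * Hypercyclicity when |lambda| >= 1 *)

Lemma super_small_eventually g r eps : super_small g -> 0 < eps ->
  exists N, forall n, (N <= n)%nat -> bounded_on (g n) r eps.
Proof.
intros Hg He. destruct (Hg r 2 ltac:(lra)) as [B HB].
destruct (pow_half_small (Rmax 0 B) eps (Rmax_l _ _) He) as [N HN].
exists N. intros n Hn z Hz. eapply Rle_trans; [|apply (HN n Hn)].
specialize (HB n z Hz). assert (T := Rmax_r 0 B).
assert (H2 : 0 < (/ 2) ^ n) by (apply pow_lt; lra).
replace (Cmod (g n z)) with (2 ^ n * Cmod (g n z) * (/ 2) ^ n).
- apply Rmult_le_compat_r; lra.
- replace (2 ^ n * Cmod (g n z) * (/ 2) ^ n) with (Cmod (g n z) * (2 * / 2) ^ n)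
    by (rewrite Rpow_mult_distr; ring).
  replace (2 * / 2) with 1 by field. rewrite pow1. ring.
Qed.

Lemma symbol_coefficients (psi : HC) (w : nat -> C) :
  (forall z, @is_pseries C_AbsRing C_NormedModule w z (psi z)) -> psi 0 = 0%C ->
  w 0%nat = 0%C /\ exists A, 0 <= A /\ forall k, Cmod (w k) <= A * (/ 2) ^ k.
Proof.
intros Hps H0.
assert (H : forall z, C_cvg (csum (fun k => w k * z ^ k)%C) (psi z)) by (intros z; now apply is_pseries_C_cvg).
split.
- rewrite <- H0. apply (C_cvg_unique (csum (fun k => w k * 0 ^ k)%C)); [|apply H].
  intros eps He. exists 1%nat. intros n Hn.
  rewrite (csum_one_term _ _ 0%nat) by (lia || (intros [|i] Hi Hne; [lia|simpl; ring])).
  simpl. replace (w 0%nat * 1 - w 0%nat)%C with (RtoC 0) by ring. rewrite Cmod_0. lra.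
- destruct (pseries_coef_bound w psi (RtoC 2) H) as [A [HA HAk]].
  exists A. split; [exact HA|]. intros k. specialize (HAk k).
  rewrite Cmod_R, Rabs_pos_eq in HAk by lra.
  replace (Cmod (w k)) with (Cmod (w k) * 2 ^ k * (/ 2) ^ k).
  + apply Rmult_le_compat_r; [apply pow_le; lra|exact HAk].
  + rewrite Rmult_assoc, <- Rpow_mult_distr. replace (2 * / 2) with 1 by field. rewrite pow1. ring.
Qed.

Lemma series_op_zero_symbol lambda b w S : series_op lambda b w S ->
  (forall k, w k = RtoC 0) -> S = op_zero.
Proof.
intros HS Hw. apply functional_extensionality. intros f. apply HC_ext. intros z.
apply (C_cvg_unique (csum (fun k => w k * iterT lambda b k f z)%C)).
- apply (lu_cvg_pointwise (fun n z => csum (fun k => w k * iterT lambda b k f z)%C n)), HS.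
- apply (C_cvg_ext (fun _ => RtoC 0)); [|apply C_cvg_const].
  intros n. symmetry. apply csum_zero. intros i _. rewrite Hw. ring.
Qed.

Lemma first_nonzero (w : nat -> C) : ~ (forall k, w k = RtoC 0) ->
  exists m, w m <> RtoC 0 /\ forall k, (k < m)%nat -> w k = RtoC 0.
Proof.
intros H. apply NNPP; intros Hno. apply H.
assert (G : forall n k, (k < n)%nat -> w k = RtoC 0).
{ induction n as [|n IH]; intros k Hk; [lia|].
  apply NNPP; intros Hk0. apply Hno. exists k. split; [exact Hk0|].
  intros i Hi. apply IH. lia. }
intros k. apply (G (S k)). lia.
Qed.

Theorem psi_algebra_hypercyclic lambda b S : 1 <= Cmod lambda ->
  psi_algebra lambda b S -> S <> op_zero -> hypercyclic S.
Proof.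
intros Hl [psi [w [Hps [Hpsi0 [HS [HL HC0]]]]]] Hne.
apply is_series_op_iff in HS.
destruct (symbol_coefficients psi w Hps Hpsi0) as [Hw0 [A [HA Hw]]].
destruct (first_nonzero w) as [m [Hm Hlow]].
{ intros Hall. apply Hne. now apply (series_op_zero_symbol lambda b w). }
assert (Hm1 : (1 <= m)%nat) by (destruct m; [now elim Hm|lia]).
apply hypercyclicity_criterion; [exact HL|exact HC0| |].
- intros d p Hp. exists d. intros n Hn.
  rewrite (series_op_finite _ _ _ _ p n (series_op_iter _ _ _ _ n HS)).
  + apply HC_ext. intros z. rewrite hsum_csum. apply csum_zero. intros k Hk.
    rewrite HC_scal_apply, (proj1 (cpow_low w m n Hlow)) by nia. ring.
  + intros k Hk. apply (iterT_poly_zero _ _ d); [lia|exact Hp].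
- intros d p Hp.
  destruct (super_small_preimages lambda b w S m A Hl HS HL Hm1 Hlow Hm HA Hw d p Hp) as [g [Hg Hsm]].
  exists g. split; [exact Hg|]. intros r eps He. now apply super_small_eventually.
Qed.

(** * Bounded point evaluations when |lambda| < 1 *)

Lemma linear_times_geometric_small l eps : 0 <= l < 1 -> 0 < eps ->
  exists N, forall k, (N <= k)%nat -> INR (S k) * l ^ k <= eps.
Proof.
intros Hl He.
(* squaring a ratio [q] leaves one factor [q^k] to absorb [k], by Bernoulli *)
set (q := sqrt (Rmax l (/ 2))).
assert (Hm : / 2 <= Rmax l (/ 2) < 1) by (split; [apply Rmax_r|apply Rmax_lub_lt; lra]).
assert (Hqq : q * q = Rmax l (/ 2)) by (apply sqrt_sqrt; lra).
assert (Hq0 : 0 < q) by (apply sqrt_lt_R0; lra).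
assert (Hq1 : q < 1) by (rewrite <- sqrt_1; apply sqrt_lt_1; lra).
set (x := / q - 1).
assert (Hx : 0 < x).
{ unfold x. assert (1 < / q); [|lra]. rewrite <- Rinv_1. apply Rinv_lt_contravar; lra. }
set (K := 1 + / x). assert (Hxi : 0 < / x) by now apply Rinv_0_lt_compat.
assert (HK : forall k, INR (S k) * q ^ k <= K).
{ intros k. assert (B := poly k x Hx).
  assert (E : (1 + x) ^ k * q ^ k = 1).
  { rewrite <- Rpow_mult_distr. replace ((1 + x) * q) with 1 by (unfold x; field; lra). apply pow1. }
  assert (Hqk : 0 < q ^ k) by now apply pow_lt.
  assert (Hqk1 : q ^ k <= 1) by (apply pow_le_1; lra).
  assert (L : INR k * x * q ^ k <= 1).
  { rewrite <- E. apply Rmult_le_compat_r; lra. }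
  assert (L2 : INR k * q ^ k <= / x).
  { apply Rmult_le_reg_r with x; [exact Hx|]. rewrite Rinv_l by lra.
    replace (INR k * q ^ k * x) with (INR k * x * q ^ k) by ring. exact L. }
  rewrite S_INR. unfold K. lra. }
destruct (pow_lt_1_zero q) with (y := eps / K) as [N HN].
- rewrite Rabs_pos_eq; lra.
- apply Rdiv_lt_0_compat; [exact He|unfold K; lra].
- exists N. intros k Hk. specialize (HN k Hk).
  assert (Hqk : 0 < q ^ k) by now apply pow_lt. rewrite Rabs_pos_eq in HN by lra.
  apply Rle_trans with (INR (S k) * (q ^ k * q ^ k)).
  + apply Rmult_le_compat_l; [apply pos_INR|]. rewrite <- Rpow_mult_distr, Hqq.
    apply pow_incr. split; [lra|apply Rmax_l].
  + rewrite <- Rmult_assoc. apply Rle_trans with (K * (eps / K)).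
    * apply Rmult_le_compat; [|lra|apply HK|lra]. apply Rmult_le_pos; [apply pos_INR|lra].
    * right. field. unfold K. lra.
Qed.

(** The ratio of consecutive terms is [x (k + 1) l^k], which tends to zero. *)
Lemma tri_beats_factorial l x : 0 <= l < 1 -> 0 <= x ->
  exists B, 0 <= B /\ forall k, x ^ k * l ^ tri k * INR (fact k) <= B * (/ 2) ^ k.
Proof.
intros Hl Hx.
set (s := fun k => (2 * x) ^ k * l ^ tri k * INR (fact k)).
assert (Hs0 : forall k, 0 <= s k).
{ intros k. unfold s. repeat apply Rmult_le_pos; [apply pow_le; lra|apply pow_le; lra|].
  left; apply fact_pos. }
assert (Hs : forall k, s (S k) = s k * (2 * x * (INR (S k) * l ^ k))).
{ intros k. unfold s. rewrite fact_simpl, mult_INR. simpl tri. rewrite pow_add. simpl (_ ^ S k). ring. }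
destruct (linear_times_geometric_small l (/ (2 * x + 1)) Hl) as [N HN].
{ apply Rinv_0_lt_compat. lra. }
destruct (prefix_bound (fun n M => s n <= M)) with (N := S N) as [B [HB0 HB]].
{ intros; lra. }
{ intros n. now exists (s n); right. }
exists B. split; [exact HB0|]. intros k.
assert (Hsk : s k <= B).
{ destruct (Nat.lt_ge_cases k (S N)) as [L|L]; [now apply HB|].
  replace k with (N + (k - N))%nat by lia. generalize (k - N)%nat. intros i.
  induction i as [|i IH]; [rewrite Nat.add_0_r; apply HB; lia|].
  rewrite Nat.add_succ_r, Hs.
  specialize (HN (N + i)%nat ltac:(lia)).
  assert (T : 2 * x * (INR (S (N + i)) * l ^ (N + i)) <= 1).
  { apply Rle_trans with ((2 * x + 1) * / (2 * x + 1)); [|right; field; lra].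
    apply Rmult_le_compat; [lra| |lra|exact HN]. apply Rmult_le_pos; [apply pos_INR|apply pow_le; lra]. }
  rewrite <- (Rmult_1_r B).
  apply Rmult_le_compat; [apply Hs0| |exact IH|exact T].
  apply Rmult_le_pos; [lra|]. apply Rmult_le_pos; [apply pos_INR|apply pow_le; lra]. }
replace (x ^ k * l ^ tri k * INR (fact k)) with (s k * (/ 2) ^ k).
- apply Rmult_le_compat_r; [apply pow_le; lra|exact Hsk].
- unfold s. replace ((2 * x) ^ k * l ^ tri k * INR (fact k) * (/ 2) ^ k) with
    ((2 * x * / 2) ^ k * l ^ tri k * INR (fact k)) by (rewrite (Rpow_mult_distr (2 * x)); ring).
  now replace (2 * x * / 2) with x by field.
Qed.

(** At the fixed point [c] of [phi], [(T^k f)(c)] is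
    [lambda^(k (k - 1) / 2) f^(k)(c)], so small that the bound [W^n] for the
    coefficients of [psi^n], which start at order [n], cannot compensate. *)
Lemma orbit_bounded_at_fixed_point lambda b w S c A (f : HC) : Cmod lambda < 1 ->
  (lambda * c + b = c)%C -> series_op lambda b w S -> w 0%nat = RtoC 0 ->
  0 <= A -> (forall k, Cmod (w k) <= A * (/ 2) ^ k) ->
  exists B, 0 <= B /\ forall n, Cmod (Nat.iter n S f c) <= B.
Proof.
intros Hl Hc HS Hw0 HA Hw.
set (W := Rmax 1 (2 * A)). assert (HW1 : 1 <= W) by apply Rmax_l.
assert (HWA : 2 * A <= W) by apply Rmax_r.
destruct (entire_bounded_on f (Cmod c + 1) (HC_entire f)) as [M [HM0 HM]].
assert (Hl0 := Cmod_ge_0 lambda).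
destruct (tri_beats_factorial (Cmod lambda) (6 * W)) as [B [HB0 HB]]; [lra|lra|].
exists (2 * (M * B)). split.
{ assert (0 <= M * B) by now apply Rmult_le_pos. lra. }
intros n.
apply (C_cvg_bound (csum (fun k => cpow w n k * iterT lambda b k f c)%C) _ _ 0%nat).
- apply (lu_cvg_pointwise (fun m z => csum (fun k => cpow w n k * iterT lambda b k f z)%C m)).
  now apply series_op_iter.
- intros N _. apply csum_geometric_bound; [now apply Rmult_le_pos|]. intros k.
  assert (Hfix : phin lambda b k c = c).
  { replace (phin lambda b k c) with ((phin lambda b k c - c) + c)%C by ring.
    rewrite phin_fixed by exact Hc. ring. }
  assert (HD := cauchy_factorial f (Cmod c) 1 M k Rlt_0_1 HM0 HM c (Rle_refl _)).
  rewrite iterT_formula, Hfix, !Cmod_mult, Cmod_pow.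
  assert (Hcp : Cmod (cpow w n k) <= W ^ k).
  { destruct (Nat.lt_ge_cases k n) as [L|L].
    - destruct (cpow_low w 1 n) as [Hz _].
      { intros i Hi. now replace i with 0%nat by lia. }
      rewrite Hz by lia. rewrite Cmod_0. apply pow_le. lra.
    - eapply Rle_trans; [exact (cpow_bound w A n HA Hw k)|].
      apply Rle_trans with (W ^ n); [apply pow_incr; lra|now apply Rle_pow]. }
  apply Rle_trans with (W ^ k * (Cmod lambda ^ tri k * (M * INR (fact k) * (6 / 1) ^ k))).
  + apply Rmult_le_compat; [apply Cmod_ge_0| |exact Hcp|].
    * apply Rmult_le_pos; [now apply pow_le|apply Cmod_ge_0].
    * apply Rmult_le_compat_l; [now apply pow_le|exact HD].
  + replace (6 / 1) with 6 by field.
    replace (W ^ k * (Cmod lambda ^ tri k * (M * INR (fact k) * 6 ^ k))) with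
      (M * ((6 * W) ^ k * Cmod lambda ^ tri k * INR (fact k))) by (rewrite Rpow_mult_distr; ring).
    rewrite (Rmult_assoc M B). now apply Rmult_le_compat_l.
Qed.

Lemma compactC_singleton c : compactC (fun z => z = c).
Proof.
intros U _ Hcov. destruct (Hcov c eq_refl) as [A [HA Ac]].
exists (A :: nil). split; [now intros B [<-|[]]|].
intros z ->. exists A. split; [now left|exact Ac].
Qed.

Theorem psi_algebra_not_hypercyclic lambda b S : Cmod lambda < 1 ->
  psi_algebra lambda b S -> ~ hypercyclic S.
Proof.
intros Hl [psi [w [Hps [Hpsi0 [HS _]]]]] [f Hf].
apply is_series_op_iff in HS.
destruct (symbol_coefficients psi w Hps Hpsi0) as [Hw0 [A [HA Hw]]].
destruct (affine_fixed_point lambda b) as [c Hc].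
{ intros ->. rewrite Cmod_1 in Hl. lra. }
destruct (orbit_bounded_at_fixed_point lambda b w S c A f Hl Hc HS Hw0 HA Hw) as [B [HB0 HB]].
destruct (Hf (HC_scal (RtoC (B + 1)) (Mono c 0)) (fun g => Cmod (g c - RtoC (B + 1)) < 1))
  as [g [[n ->] Hg]].
- exists (fun z => z = c), (mkposreal 1 Rlt_0_1). split; [apply compactC_singleton|].
  intros g Hg. specialize (Hg c eq_refl). rewrite HC_scal_apply, Mono_center_0, Cmult_1_r in Hg. exact Hg.
- specialize (HB n). assert (T := Cmod_triangle_inv (RtoC (B + 1)) (Nat.iter n S f c)).
  rewrite Cmod_minus_sym in T. rewrite Cmod_R, Rabs_pos_eq in T by lra. lra.
Qed.

Theorem theorem5 (lambda b : C) :
  operator_algebra (psi_algebra lambda b) /\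
  ((1 <= Cmod lambda)%R ->
     forall S : HC -> HC, psi_algebra lambda b S -> S <> op_zero -> hypercyclic S) /\
  ((Cmod lambda < 1)%R ->
     forall S : HC -> HC, psi_algebra lambda b S -> ~ hypercyclic S).
Proof.
split; [apply psi_algebra_is_algebra|split].
- intros Hl S. now apply psi_algebra_hypercyclic.
- intros Hl S. now apply psi_algebra_not_hypercyclic.
Qed.
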